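(* Let $D$ be a bounded domain of $\mathbb{R}^d$ ($d\ge 2$) with Lipschitz boundary $\partial D$. Consider $\gamma$ a Lipschitz continuous conductivity in $\overline{D}$. Then, for almost every $P\in\partial D$, there exists an explicit sequence $\{f_N : N\in\mathbb{N}\setminus\{0\}\}$ in $H^{1/2}(\partial D)$ such that $$\lim_{N\to\infty}\mathcal{N}_\gamma(f_N,\overline{f_N})=\gamma(P)$$ almost surely.
   Context: Conductivity: a real-valued function $\gamma$ with a positive lower bound, $\gamma(x)\ge\gamma_0>0$ for all $x\in\overline D$. DN map: $\Lambda_\gamma:H^{1/2}(\partial D)\to H^{-1/2}(\partial D)$ is defined weakly by $\Lambda_\gamma f=\gamma\,\partial_\nu u|_{\partial D}$, where $\nu$ is the outward unit normal and $u\in H^1(D)$ solves $\nabla\cdot(\gamma\nabla u)=0$ in $D$, $u|_{\partial D}=f$. The notation $\int_{\partial D}\Lambda_\gamma f\,g$ means the duality pairing between $H^{-1/2}(\partial D)$ and $H^{1/2}(\partial D)$. Noise: $(\Omega,\mathcal{H},\mathbb{P})$ is a complete probability space and $\{X_\alpha:\alpha\in\mathbb{N}^2\}$ is a family of independent complex Gaussian random variables with $\mathbb{E}X_\alpha=0$, $\mathbb{E}(X_\alpha\overline{X_\alpha})=1$, $\mathbb{E}(X_\alpha X_\alpha)=0$ for all $\alpha$. $\{e_n:n\in\mathbb{N}\}$ is an orthonormal basis of $L^2(\partial D)$, and $(\phi|\psi)=\int_{\partial D}\phi\overline{\psi}$. The noisy data is the bilinear form $$\mathcal{N}_\gamma(f,g)=\int_{\partial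 D}\Lambda_\gamma f\,g+\sum_{\alpha=(\alpha_1,\alpha_2)\in\mathbb{N}^2}(f|e_{\alpha_1})(g|e_{\alpha_2})X_\alpha,\qquad f,g\in H^{1/2}(\partial D),$$ which takes values in $L^2(\Omega,\mathcal{H},\mathbb{P})$. *)

(* Defs.v *)
From HB Require Import structures.
From mathcomp Require Import all_boot all_order all_algebra finmap.
From mathcomp Require Import complex.
From mathcomp Require Import all_classical all_reals all_analysis.

Set Implicit Arguments.
Unset Strict Implicit.
Unset Printing Implicit Defensive.
Import Order.TTheory GRing.Theory Num.Theory numFieldNormedType.Exports.

Local Open Scope classical_set_scope.
Local Open Scope ring_scope.
Local Open Scope complex_scope.

(* MathComp-Analysis. Points of R^n are row vectors 'rV[R]_n. The library norm
   on 'rV[R]_n is the sup norm; it gives the usual topology, but lengths and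
   diameters below are Euclidean. *)

Section euclidean.
Context {R : realType} {n : nat}.
Implicit Types x y : 'rV[R]_n.

Definition dotp x y : R := \sum_(i < n) x 0 i * y 0 i.
Definition enorm x : R := Num.sqrt (dotp x x).

Definition lipschitz_on_set (A : set 'rV[R]_n) (f : 'rV[R]_n -> R) :=
  exists L : R, forall x y, A x -> A y -> `|f x - f y| <= L * enorm (x - y).

End euclidean.

(* Every subset is measurable on [power_type T], so that [mu_ext] ranges over
   countable covers by arbitrary subsets of T. *)
Definition power_type (T : pointedType) : Type := T.

Section power_type.
Variable T : pointedType.
HB.instance Definition _ := Pointed.on (power_type T).
HB.instance Definition _ := @isMeasurable.Build default_measure_display
  (power_type T) (fun _ => True) I (fun _ _ => I) (fun _ _ => I).
End power_type.

Section method_one.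
Context {R : realType} {T : pointedType}.
Local Open Scope ereal_scope.
Variable w : set T -> \bar R.
Hypothesis w_ge0 : forall A, 0 <= w A.

Definition gauge (A : set (power_type T)) : \bar R :=
  if A == set0 then 0 else w A.

(* The outer measure inf { sum_k w (B_k) | A included in the union of the B_k },
   where empty B_k count for 0. *)
Definition method1 : set T -> \bar R := mu_ext gauge.

Lemma gauge_ge0 A : 0 <= gauge A.
Proof. by rewrite /gauge; case: ifP. Qed.

Lemma gauge0 : gauge set0 = 0.
Proof. by rewrite /gauge eqxx. Qed.

Lemma method1_0 : method1 set0 = 0.
Proof. exact: mu_ext0 gauge0 gauge_ge0. Qed.

Lemma method1_ge0 A : 0 <= method1 A.
Proof. exact: mu_ext_ge0 gauge_ge0 A. Qed.

Lemma le_method1 : {homo method1 : A B / A `<=` B >-> A <= B}.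
Proof. by move=> A B; exact: (@le_mu_ext _ (power_type T) R gauge). Qed.

Lemma method1_sigma_subadditive : sigma_subadditive method1.
Proof. exact: (@mu_ext_sigma_subadditive _ (power_type T) R gauge gauge_ge0). Qed.

End method_one.

Section lebesgue.
Variables (R : realType) (n : nat).
Local Open Scope ereal_scope.

Definition box_vol (A : set 'rV[R]_n) : \bar R :=
  ereal_inf [set v | exists a b : 'rV[R]_n,
    [/\ forall i, (a 0 i <= b 0 i)%R,
        A `<=` [set x | forall i, (a 0 i <= x 0 i <= b 0 i)%R] &
        v = (\prod_(i < n) (b 0 i - a 0 i))%:E]].

Lemma box_vol_ge0 A : 0 <= box_vol A.
Proof.
apply: le_ereal_inf_tmp => _ [a [b [ab _ ->]]].
by rewrite lee_fin; apply: prodr_ge0 => i _; rewrite subr_ge0.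
Qed.

Definition lebesgue_outer : set 'rV[R]_n -> \bar R := method1 box_vol.

HB.instance Definition _ := isOuterMeasure.Build R 'rV[R]_n lebesgue_outer
  (method1_0 box_vol_ge0) (method1_ge0 box_vol_ge0)
  (@le_method1 _ _ box_vol) (method1_sigma_subadditive box_vol_ge0).

Definition lebesgue_om : {outer_measure set 'rV[R]_n -> \bar R} :=
  lebesgue_outer.

(* the complete measure given by Caratheodory's theorem *)
Definition lebesgue_rV :
    {measure set (caratheodory_type lebesgue_om) -> \bar R} :=
  (lebesgue_om : set (caratheodory_type lebesgue_om) -> \bar R).

End lebesgue.

Section hausdorff.
Variables (R : realType) (n s : nat).
Local Open Scope ereal_scope.

(* Volume of the Euclidean unit ball of R^s; with this constant the
   s-dimensional Hausdorff measure is the surface measure on s-dimensional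
   Lipschitz graphs. *)
Definition ball_vol : R :=
  fine (lebesgue_outer [set x : 'rV[R]_s | (enorm x <= 1)%R]).

Lemma ball_vol_ge0 : (0 <= ball_vol)%R.
Proof. by apply: fine_ge0; exact: method1_ge0 (@box_vol_ge0 R s) _. Qed.

(* ball_vol * (diam A / 2) ^ s if diam A <= delta, and +oo otherwise *)
Definition diam_weight (delta : R) (A : set 'rV[R]_n) : \bar R :=
  ereal_inf [set v | exists r : R,
    [/\ (0 <= r <= delta)%R, forall x y, A x -> A y -> (enorm (x - y) <= r)%R &
        v = (ball_vol * (r / 2) ^+ s)%:E]].

Lemma diam_weight_ge0 delta A : 0 <= diam_weight delta A.
Proof.
apply: le_ereal_inf_tmp => _ [r [/andP[r0 _] _ ->]].
by rewrite lee_fin mulr_ge0 ?ball_vol_ge0// exprn_ge0// divr_ge0.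
Qed.

Definition hausdorff_outer (A : set 'rV[R]_n) : \bar R :=
  ereal_sup [set method1 (diam_weight delta) A | delta in [set e | (0 < e)%R]].

Lemma hausdorff_outer_ge0 A : 0 <= hausdorff_outer A.
Proof.
apply: le_trans (method1_ge0 (diam_weight_ge0 1) A) _.
by apply: ereal_sup_ubound; exists 1%R => //=.
Qed.

Lemma hausdorff_outer0 : hausdorff_outer set0 = 0.
Proof.
apply/eqP; rewrite eq_le hausdorff_outer_ge0 andbT.
apply: ge_ereal_sup => _ [e _ <-].
by rewrite (method1_0 (diam_weight_ge0 e)).
Qed.

Lemma le_hausdorff_outer : {homo hausdorff_outer : A B / A `<=` B >-> A <= B}.
Proof.
move=> A B AB; apply: ge_ereal_sup => _ [e e0 <-].
apply: le_trans (le_method1 _ AB) _.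
by apply: ereal_sup_ubound; exists e.
Qed.

Lemma hausdorff_outer_sigma_subadditive : sigma_subadditive hausdorff_outer.
Proof.
move=> A; apply: ge_ereal_sup => _ [e e0 <-].
apply: le_trans (method1_sigma_subadditive (diam_weight_ge0 e) A) _.
apply: lee_nneseries => [k _ _|k _].
  exact: method1_ge0 (diam_weight_ge0 e) _.
by apply: ereal_sup_ubound; exists e.
Qed.

HB.instance Definition _ := isOuterMeasure.Build R 'rV[R]_n hausdorff_outer
  hausdorff_outer0 hausdorff_outer_ge0 le_hausdorff_outer
  hausdorff_outer_sigma_subadditive.

Definition hausdorff_om : {outer_measure set 'rV[R]_n -> \bar R} :=
  hausdorff_outer.

Definition hausdorff :
    {measure set (caratheodory_type hausdorff_om) -> \bar R} :=
  (hausdorff_om : set (caratheodory_type hausdorff_om) -> \bar R).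

End hausdorff.

Section complex_integrals.
Context {d : measure_display} {T : measurableType d} {R : realType}.
Variable mu : {measure set T -> \bar R}.
Implicit Types (A : set T) (f g : T -> R[i]).

Definition sqabs (z : R[i]) : R := complex.Re z ^+ 2 + complex.Im z ^+ 2.

Definition cmeasurable A f :=
  measurable_fun A (fun x => complex.Re (f x)) /\
  measurable_fun A (fun x => complex.Im (f x)).

Definition cintegral A f : R[i] :=
  (\int[mu]_(x in A) complex.Re (f x)) +i*
  (\int[mu]_(x in A) complex.Im (f x)).

Definition sqnorm A f : \bar R := (\int[mu]_(x in A) (sqabs (f x))%:E)%E.

(* f represents an element of L^2(A, mu; C) *)
Definition inL2 A f := cmeasurable A f /\ (sqnorm A f < +oo)%E.

Definition L2dot A f g : R[i] := cintegral A (fun x => f x * conjc (g x)).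

Definition L2_cvg A (u : nat -> T -> R[i]) f :=
  sqnorm A (fun x => u k x - f x) @[k --> \oo] --> 0%E.

(* Hilbert basis of L^2(A, mu; C) *)
Definition orthonormal_basis A (e : nat -> T -> R[i]) :=
  [/\ forall n, inL2 A (e n),
      forall m n, L2dot A (e m) (e n) = (m == n)%:R &
      forall f, inL2 A f ->
        L2_cvg A (fun k x => \sum_(j < k) L2dot A f (e j) * e j x) f].

End complex_integrals.

Section domains.
Context {R : realType} {n : nat}.
Implicit Types (D : set 'rV[R]_n) (gamma : 'rV[R]_n -> R).

Definition bdry D : set 'rV[R]_n := closure D `\` interior D.

(* Near each boundary point, in orthonormal coordinates whose last axis is the
   unit vector nu, D is the set of points above the graph of a Lipschitz
   function phi of the remaining coordinates, which are those of the orthogonal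
   projection x - <x, nu> nu. *)
Definition lipschitz_boundary D :=
  forall p, bdry D p -> exists (nu : 'rV[R]_n) (phi : 'rV[R]_n -> R) (r : R),
    [/\ enorm nu = 1, lipschitz_on_set setT phi, 0 < r &
        forall x, enorm (x - p) < r ->
          (D x <-> phi (x - dotp x nu *: nu) < dotp x nu)].

Definition bounded_lipschitz_domain D :=
  [/\ open D, connected D, D !=set0, bounded_set D & lipschitz_boundary D].

Definition lipschitz_conductivity D gamma :=
  lipschitz_on_set (closure D) gamma /\
  exists gamma0 : R, 0 < gamma0 /\ forall x, closure D x -> gamma0 <= gamma x.

End domains.

Section sobolev.
Context {R : realType} {n : nat}.
Local Notation E := 'rV[R]_n.
Local Notation leb := (@lebesgue_rV R n).
Local Notation surf := (@hausdorff R n n.-1).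
Implicit Types (D : set E) (f g u v : E -> R[i]) (G H : 'I_n -> E -> R[i]).

Definition partial (i : 'I_n) (h : E -> R) : E -> R :=
  fun x => 'D_(delta_mx 0 i) h x.

Definition smooth (h : E -> R) :=
  forall s : seq 'I_n, let hs := foldr partial h s in
    continuous hs /\ forall x i, derivable hs x (delta_mx 0 i).

Definition csmooth u :=
  smooth (fun x => complex.Re (u x)) /\ smooth (fun x => complex.Im (u x)).

Definition cpartial i u : E -> R[i] := fun x =>
  partial i (fun y => complex.Re (u y)) x +i*
  partial i (fun y => complex.Im (u y)) x.

Definition test_function D (h : E -> R) :=
  smooth h /\ exists K, [/\ compact K, K `<=` D & forall x, ~ K x -> h x = 0].

(* u is in H^1(D), with weak gradient G *)
Definition inH1 D u G :=
  [/\ inL2 leb D u, forall i, inL2 leb D (G i) &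
      forall h, test_function D h -> forall i,
        cintegral leb D (fun x => u x * (partial i h x)%:C) =
        - cintegral leb D (fun x => G i x * (h x)%:C)].

(* u is in H^1(D), with weak gradient G and boundary trace f: the trace is the
   continuous extension to H^1(D), with values in L^2 of the boundary, of the
   restriction of functions that are smooth up to the boundary. *)
Definition has_trace D u G f :=
  [/\ inH1 D u G, inL2 surf (bdry D) f &
      exists w : nat -> E -> R[i],
        [/\ forall k, csmooth (w k), L2_cvg leb D w u,
            forall i, L2_cvg leb D (fun k => cpartial i (w k)) (G i) &
            L2_cvg surf (bdry D) w f]].

(* H^{1/2} of the boundary is the trace space of H^1(D). *)
Definition inHhalf D f := exists u G, has_trace D u G f.

Definition energy D (gamma : E -> R) G H : R[i] :=
  cintegral leb D (fun x => (gamma x)%:C * \sum_(i < n) G i x * H i x).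

(* weak solution of div(gamma grad u) = 0 in D, u = f on the boundary; the test
   space is H^1_0(D), i.e. the functions of H^1(D) with zero trace *)
Definition dirichlet_solution D gamma f u G :=
  has_trace D u G f /\
  forall v H, has_trace D v H (fun=> 0) -> energy D gamma G H = 0.

(* The pairing of Lambda_gamma f with g. Integrating by parts, the weak form of
   gamma d_nu u is int_D gamma grad u . grad v for any v in H^1(D) with trace g;
   the pairing is bilinear. The value 0 is only used if there are no u, v. *)
Definition DN_map D gamma f : (E -> R[i]) -> R[i] := fun g =>
  xget 0 [set z | exists u G v H,
    [/\ dirichlet_solution D gamma f u G, has_trace D v H g &
        z = energy D gamma G H]].

End sobolev.

Section noise.
Context {R : realType} {d : measure_display} {Omega : measurableType d}.
Variable P : probability Omega R.
Local Notation index := (nat * nat)%type.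

Definition cexpectation (Y : Omega -> R[i]) : R[i] := cintegral P setT Y.

(* possibly degenerate *)
Definition gaussian (Y : Omega -> R) :=
  (exists m s : R, 0 < s /\
     forall B, measurable B -> P (Y @^-1` B) = normal_prob m s B) \/
  (exists m : R, {ae P, forall w, Y w = m}).

(* the real and imaginary parts are jointly Gaussian *)
Definition complex_gaussian (Y : Omega -> R[i]) :=
  cmeasurable setT Y /\
  forall a b : R,
    gaussian (fun w => a * complex.Re (Y w) + b * complex.Im (Y w)).

Definition mutually_independent (X : index -> Omega -> R[i]) :=
  forall (J : {fset index}) (B : index -> set (R * R)),
    (forall a, measurable (B a)) ->
    let event a := [set w | B a (complex.Re (X a w), complex.Im (X a w))] in
    P (\bigcap_(a in [set` J]) event a) = (\prod_(a <- J) P (event a))%E.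

Definition standard_noise (X : index -> Omega -> R[i]) :=
  [/\ forall a, complex_gaussian (X a),
      forall a, cexpectation (X a) = 0,
      forall a, cexpectation (fun w => X a w * conjc (X a w)) = 1,
      forall a, cexpectation (fun w => X a w * X a w) = 0 &
      mutually_independent X].

(* W is the sum over nat * nat of c a * X a, in L^2(Omega) *)
Definition is_L2_sum (c : index -> R[i]) (X : index -> Omega -> R[i])
    (W : Omega -> R[i]) :=
  inL2 P setT W /\
  forall eps : R, 0 < eps -> exists J0 : {fset index},
    forall J : {fset index}, (J0 `<=` J)%fset ->
      (sqnorm P setT (fun w => W w - \sum_(a <- J) c a * X a w)%R
        < eps%:E)%E.

(* A representative of that sum; changing it for the terms of a sequence only
   changes the sequence on a null set. The value 0 is only used if there is no
   sum. *)
Definition L2_sum c X : Omega -> R[i] :=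
  xget (fun=> 0) [set W | is_L2_sum c X W].

Definition noisy_data {n : nat} (D : set 'rV[R]_n) (gamma : 'rV[R]_n -> R)
    (e : nat -> 'rV[R]_n -> R[i]) (X : index -> Omega -> R[i])
    (f g : 'rV[R]_n -> R[i]) : Omega -> R[i] := fun w =>
  DN_map D gamma f g +
  L2_sum (fun a => L2dot (@hausdorff R n n.-1) (bdry D) f (e a.1) *
                   L2dot (@hausdorff R n n.-1) (bdry D) g (e a.2)) X w.

End noise.

(* Main.v *)
Require Import Defs.
From HB Require Import structures.
From mathcomp Require Import all_boot all_order all_algebra finmap.
From mathcomp Require Import complex.
From mathcomp Require Import all_classical all_reals all_analysis.
From mathcomp Require Import measurable_realfun ring lra.

Set Implicit Arguments.
Unset Strict Implicit.
Unset Printing Implicit Defensive.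
Import Order.TTheory GRing.Theory Num.Theory numFieldNormedType.Exports.

Local Open Scope classical_set_scope.
Local Open Scope ring_scope.
Local Open Scope complex_scope.

(* The functions f_N are normalised dipole potentials. Let P be a boundary point,
   nu the chart direction at P, and q = P - delta nu, a point outside the closure
   of D since D lies above a Lipschitz graph. The harmonic function
   g(x) = y_1 |y|^(-n), y = x - q, satisfies |y|^(-2n) <= |grad g|^2 <= C |y|^(-2n),
   so that int_D |grad g|^2 >= c delta^(-n), while for any eta > 0 the part of the
   integral over |y| > eta stays bounded as delta tends to 0. Hence
   V = grad g / |grad g|_{L^2(D)} concentrates at P, and the Lipschitz bound gives
   int_D (gamma - gamma(P))^2 |V|^2 -> 0. If G is the gradient of the solution with
   the same boundary values, then G - V is orthogonal to V (g is harmonic) and to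
   gamma G (G is a solution), which forces int_D gamma |G|^2 -> gamma(P); this is
   the pairing of the Dirichlet-to-Neumann map.

   The surface measure of D within distance rho of P is at most C rho^(n-1), so
   int_{bdry D} g^2 <= C delta^(1-n) and |f_N|^2_{L^2(bdry D)} <= C delta. With
   delta proportional to 2^(-N), Bessel's inequality makes the variances of the
   noise terms summable, and these terms tend to 0 almost surely. The argument
   works at every boundary point.

   Traces, Poincare's inequality and the solution (by minimising the energy) all
   rest on |int_D d_i psi| <= 2 K int_{bdry D} |psi| dH, which is proved by
   translating D by t e_i: the points gained or lost lie in a thickening of the
   boundary, whose volume is at most K t H(bdry D). *)

(** * Lebesgue measure of boxes, measurability of open sets *)

(** The dipole is, up to a constant, a derivative of the fundamental solution of the Laplacian. The
    fundamental solution itself would be too weak: its energy is of order delta^(2-n), only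
    logarithmic in the plane, whereas the dipole leaves one full power of delta between boundary
    norm and energy in every dimension. Its gradient is bounded below in all directions, so its axis
    can be the first coordinate; only the position of the pole uses the chart.

    The trial functions are harmonic for constant coefficients and depend on D and P alone. The
    conductivity enters through the two orthogonality relations, which is why [F] can be chosen
    before [gamma], the noise and the basis. Since [has_trace] approximates by functions smooth on
    the whole space, the dipole must be continued smoothly across its pole; this is the purpose of
    [regdist].

    Both measures are given as outer measures built from covers. Volumes of boxes, measurability of
    open sets and finiteness of the surface measure are therefore obtained by covering and counting
    arguments. *)

Section method1_theory.
Context {R : realType} {T : pointedType}.
Local Open Scope ereal_scope.
Variable w : set T -> \bar R.
Hypothesis w_ge0 : forall A, 0 <= w A.

Lemma method1_le (A : set T) (B : nat -> set T) : A `<=` \bigcup_k B k ->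
  method1 w A <= \sum_(k <oo) gauge w (B k).
Proof.
by move=> AB; apply: ereal_inf_lbound; exists B => //; split.
Qed.

Lemma le_method1P (c : \bar R) (A : set T) :
  (forall B : nat -> set T, A `<=` \bigcup_k B k ->
    c <= \sum_(k <oo) gauge w (B k)) -> c <= method1 w A.
Proof. by move=> h; apply: le_ereal_inf_tmp => _ [B [_ AB] <-]; exact: h. Qed.

(** [method1 w] is the largest countably subadditive function below the gauge. Splitting by a
    half-space, translation, metric separation and thickening are all compared with outer measures
    through this principle, so only single covering sets have to be examined. *)
Lemma method1_greatest (Phi : set T -> \bar R) (K : R) (A : set T) : (0 < K)%R ->
  (forall B, 0 <= Phi B) ->
  (forall C F, C `<=` \bigcup_k F k -> Phi C <= \sum_(k <oo) Phi (F k)) ->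
  (forall B, Phi B <= K%:E * gauge w B) -> Phi A <= K%:E * method1 w A.
Proof.
move=> K0 Phi0 sub le; rewrite -lee_pdivrMl//; apply: le_method1P => B AB.
rewrite lee_pdivrMl// -nneseriesZl; last by move=> i _; exact: gauge_ge0.
by apply: (le_trans (sub _ _ AB)); apply: lee_nneseries => // k _; exact: Phi0.
Qed.

Lemma method1_gauge (A : set T) : method1 w A <= gauge w A.
Proof.
have := @method1_le A (fun k => if k is 0%N then A else set0).
rewrite nneseries_recl//; last by move=> k _; exact: gauge_ge0.
rewrite eseries_cond/= eseries0 ?adde0; last by case=> //= k _ _; rewrite gauge0.
by apply; move=> x Ax; exists 0%N.
Qed.

Lemma method1_subset_sigma (C : set T) (F : nat -> set T) :
  C `<=` \bigcup_k F k -> method1 w C <= \sum_(k <oo) method1 w (F k).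
Proof.
move=> CF; apply: le_trans (le_method1 w CF) _.
exact: method1_sigma_subadditive.
Qed.

End method1_theory.

Section lebesgue_boxes.
Context {R : realType} {n : nat}.
Local Notation E := 'rV[R]_n.
Local Notation lo := (@lebesgue_outer R n).
Implicit Types (a b x v : E) (A B : set E).

Definition cbox a b : set E := [set x | forall i, (a 0 i <= x 0 i <= b 0 i)].

Lemma box_vol_le a b A : (forall i, a 0 i <= b 0 i) -> A `<=` cbox a b ->
  (box_vol A <= (\prod_(i < n) (b 0 i - a 0 i))%:E)%E.
Proof. by move=> ab Aab; apply: ereal_inf_lbound; exists a, b. Qed.

Lemma gauge_box_vol_le A : (gauge (@box_vol R n) A <= box_vol A)%E.
Proof. by rewrite /gauge; case: ifP => // _; exact: box_vol_ge0. Qed.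

Lemma lebesgue_box_le a b : (forall i, a 0 i <= b 0 i) ->
  (lo (cbox a b) <= (\prod_(i < n) (b 0 i - a 0 i))%:E)%E.
Proof.
move=> ab; apply: le_trans (method1_gauge (@box_vol_ge0 R n) _) _.
by apply: le_trans (gauge_box_vol_le _) _; exact: box_vol_le.
Qed.

Lemma lebesgue_subset_sigma A (F : nat -> set E) : A `<=` \bigcup_k F k ->
  (lo A <= \sum_(k <oo) lo (F k))%E.
Proof. exact: (@method1_subset_sigma R _ (@box_vol R n) (@box_vol_ge0 R n)). Qed.

Let upd b i c : E := \row_j (if j == i then c else b 0 j).

Lemma prod_upd (i : 'I_n) (f g : 'I_n -> R) : (forall j, j != i -> f j = g j) ->
  (\prod_j f j = f i * \prod_(j | j != i) g j).
Proof.
by move=> fg; rewrite (bigD1 i)//=; congr (_ * _); apply: eq_bigr.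
Qed.

(** A hyperplane [x_i = c] cuts a box into two boxes that differ from it only in the [i]-th side,
    and these two sides add up. Caratheodory's criterion for half-spaces follows by comparing
    covers. *)
Lemma gauge_box_split (i : 'I_n) (c : R) A :
  (gauge (@box_vol R n) (A `&` [set x | x 0 i <= c]%R) +
  gauge (@box_vol R n) (A `&` ~` [set x | x 0 i <= c]%R)
    <= gauge (@box_vol R n) A)%E.
Proof.
have g0 := @gauge_ge0 R _ _ (@box_vol_ge0 R n).
have [->|/eqP A0] := pselect (A = set0).
  by rewrite !set0I gauge0 adde0.
rewrite [leRHS]/gauge (negbTE A0); apply: le_ereal_inf_tmp => _ [a [b [ab Aab ->]]].
have [bc|cb] := leP (b 0 i) c.
  rewrite (_ : A `&` ~` _ = set0); last first.
    apply/seteqP; split=> // x [/Aab /(_ i) /andP[_ xb]] /=.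
    by move=> /negP; rewrite (le_trans xb bc).
  rewrite gauge0 adde0; apply: le_trans (gauge_box_vol_le _) _.
  by apply: box_vol_le => // x [/Aab].
have [ca|ac] := ltP c (a 0 i).
  rewrite (_ : A `&` [set x | _] = set0); last first.
    apply/seteqP; split=> // x [/Aab /(_ i) /andP[ax _]] /= xc.
    by move: (lt_le_trans ca (le_trans ax xc)); rewrite ltxx.
  rewrite gauge0 add0e; apply: le_trans (gauge_box_vol_le _) _.
  by apply: box_vol_le => // x [/Aab].
have P0 : (forall j, a 0 j <= upd b i c 0 j).
  by move=> j; rewrite mxE; case: eqP => [->|].
have P1 : (forall j, upd a i c 0 j <= b 0 j).
  by move=> j; rewrite mxE; case: eqP => [->|//]; exact: ltW.
apply: (@le_trans _ _ ((\prod_j (upd b i c 0 j - a 0 j))%:E +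
    (\prod_j (b 0 j - upd a i c 0 j))%:E)%E).
  apply: leeD; apply: (le_trans (gauge_box_vol_le _)); apply: box_vol_le => //.
    move=> x [/Aab h /= xc] j; have /andP[h1 h2] := h j.
    by rewrite h1/= mxE; case: eqP => [->|].
  move=> x [/Aab h /= /negP]; rewrite -ltNge => xc j; have /andP[h1 h2] := h j.
  by rewrite h2 andbT mxE; case: eqP => [->|//]; exact: ltW.
rewrite -EFinD lee_fin; pose P := (\prod_(j | j != i) (b 0 j - a 0 j)).
rewrite (@prod_upd i _ (fun j => b 0 j - a 0 j)); last first.
  by move=> j /negbTE ji; rewrite mxE ji.
rewrite (@prod_upd i (fun j => b 0 j - upd a i c 0 j) (fun j => b 0 j - a 0 j));
  last by move=> j /negbTE ji; rewrite mxE ji.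
rewrite [leRHS](bigD1 i)//= !mxE eqxx -mulrDl -/P.
by rewrite (_ : c - a 0 i + (b 0 i - c) = b 0 i - a 0 i)//; ring.
Qed.

Lemma lebesgue_halfspace (i : 'I_n) (c : R) :
  (@lebesgue_om R n).-caratheodory [set x | x 0 i <= c].
Proof.
apply: le_caratheodory_measurable => X; rewrite -[leRHS]mul1e.
pose H : set E := [set x | x 0 i <= c].
apply: (@method1_greatest R _ (@box_vol R n) (@box_vol_ge0 R n)
  (fun X => lo (X `&` H) + lo (X `&` ~` H))%E 1) => //.
- by move=> B; apply: adde_ge0; exact: method1_ge0 (@box_vol_ge0 R n) _.
- move=> C F CF; rewrite nneseriesD; [|by move=> *; exact: method1_ge0 (@box_vol_ge0 R n) _..].
  by apply: leeD; apply: lebesgue_subset_sigma; rewrite -setI_bigcupl;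
    apply: setSI.
- move=> B; rewrite mul1e; apply: le_trans (gauge_box_split i c B).
  by apply: leeD; exact: method1_gauge (@box_vol_ge0 R n) _.
Qed.

Definition translate v A : set E := [set x | A (x - v)].

Lemma gauge_box_shift v A : (gauge (@box_vol R n) (translate v A) <= gauge (@box_vol R n) A)%E.
Proof.
have [->|/eqP A0] := pselect (A = set0).
  by rewrite (_ : translate v set0 = set0)// gauge0.
rewrite [leRHS]/gauge (negbTE A0); apply: le_ereal_inf_tmp => _ [a [b [ab Aab ->]]].
apply: le_trans (gauge_box_vol_le _) _.
rewrite (eq_bigr (fun j => (b + v) 0 j - (a + v) 0 j)); last first.
  by move=> j _; rewrite !mxE; ring.
apply: box_vol_le => [i|x /Aab h i]; first by rewrite !mxE lerD2r.
by move: (h i); rewrite !mxE lerBrDr lerBlDr.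
Qed.

Lemma lebesgue_shift_le v A : (lo (translate v A) <= lo A)%E.
Proof.
rewrite -[leRHS]mul1e.
apply: (@method1_greatest R _ (@box_vol R n) (@box_vol_ge0 R n)
  (fun X => lo (translate v X)) 1) => //.
- by move=> B; exact: method1_ge0 (@box_vol_ge0 R n) _.
- move=> C F CF; apply: lebesgue_subset_sigma => x /CF [k _ ?].
  by exists k.
- move=> B; rewrite mul1e; apply: le_trans (gauge_box_shift v B).
  exact: method1_gauge (@box_vol_ge0 R n) _.
Qed.

Lemma lebesgue_shift v A : lo (translate v A) = lo A.
Proof.
apply/eqP; rewrite eq_le lebesgue_shift_le /=.
rewrite {1}(_ : A = translate (- v) (translate v A)) ?lebesgue_shift_le//.
by apply/seteqP; split=> x; rewrite /translate /= opprK addrK.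
Qed.

End lebesgue_boxes.

(** * Volume of a box *)

Section cover_volume.
Context {R : realType}.
Local Open Scope ereal_scope.

(* Slicing along the last coordinate and integrating over it, by induction on
   the dimension. *)
Lemma box_cover_volume (m : nat) (K : pred nat) (a b : nat -> nat -> R)
    (c d : nat -> R) :
  (forall k i, a k i <= b k i)%R -> (forall i, c i <= d i)%R ->
  (forall x : nat -> R, (forall i, (i < m)%N -> c i <= x i <= d i)%R ->
    exists k, K k /\ forall i, (i < m)%N -> (a k i <= x i <= b k i)%R) ->
  (\prod_(i < m) (d i - c i))%:E <=
  \sum_(k <oo | K k) (\prod_(i < m) (b k i - a k i))%:E.
Proof.
move=> ab cd; elim: m K => [|m IH] K cov.
  have [k [Kk _]] := cov c (fun i (h : (i < 0)%N) => ltac:(by [])).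
  have f0 j : K j -> 0 <= (\prod_(i < 0) (b j i - a j i))%:E.
    by move=> _; rewrite big_ord0.
  rewrite (nneseriesD1 f0 Kk) [in leLHS]big_ord0 big_ord0.
  by apply: leeDl; apply: nneseries_ge0 => j _ /andP[/f0].
have V0 k : (0 <= \prod_(i < m) (b k i - a k i))%R.
  by apply: prodr_ge0 => i _; rewrite subr_ge0.
set P := (\prod_(i < m) (d i - c i))%R in IH.
pose I k : set R := [set` `[a k m, b k m]%R].
have slice (t : R) : (c m <= t <= d m)%R ->
    P%:E <= \sum_(k <oo) (if K k then (\prod_(i < m) (b k i - a k i))%:E *
      (\1_(I k) t)%:E else 0).
  move=> ct.
  (* The boxes whose last side contains [t] cover the slice at height [t]; the predicate [K] lets
     the induction restrict to them. *)
  have := IH (fun k => K k && (t \in I k)).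
  have cov' (x : nat -> R) : (forall i, (i < m)%N -> c i <= x i <= d i)%R ->
      exists k, K k && (t \in I k) /\ forall i, (i < m)%N -> (a k i <= x i <= b k i)%R.
    move=> cx; have [|k [Kk h]] := cov (fun i => if i == m then t else x i).
      by move=> i; rewrite ltnS leq_eqVlt; case: eqP => [->//|_ /cx].
    exists k; rewrite Kk; split.
      by rewrite inE /I /= in_itv/=; have := h m (leqnn _); rewrite eqxx.
    by move=> i im; have := h i (ltnW im); rewrite ltn_eqF.
  move=> /(_ cov') /le_trans; apply.
  rewrite eseries_mkcond; apply: lee_nneseries.
    by move=> k _ _; case: ifP => // _; rewrite lee_fin.
  move=> k _; rewrite indicE; case: (K k) => //=.
  by case: (_ \in _) => /=; rewrite ?mule1 ?mule0.
have mI k : measurable (I k) by exact: measurable_itv.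
rewrite big_ord_recr /= -/P.
pose J : set R := [set` `[c m, d m]%R].
have mJ : measurable J by exact: measurable_itv.
have muJ : lebesgue_measure J = (d m - c m)%:E.
  rewrite /J lebesgue_measure_itv/= lte_fin; have := cd m.
  by rewrite le_eqVlt => /orP[/eqP->|->//]; rewrite ltxx subrr.
rewrite EFinM -muJ -integral_cst//.
pose f k (t : R) : \bar R := if K k then (\prod_(i < m) (b k i - a k i))%:E *
      (\1_(I k) t)%:E else 0.
have f0 k t : 0 <= f k t by rewrite /f; case: ifP => // _; rewrite mule_ge0 ?lee_fin.
have mi k : measurable_fun J (fun t : R => (\1_(I k) t)%:E : \bar R).
  by apply/measurable_EFinP; exact: measurable_indic.
have mf k : measurable_fun J (f k : R -> \bar R).
  by rewrite /f; case: (K k) => //; exact: measurable_funeM.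
apply: (@le_trans _ _ (\int[lebesgue_measure]_(t in J) \sum_(k <oo) f k t)).
  apply: ge0_le_integral => //=.
  - by move=> t _; rewrite lee_fin; apply: prodr_ge0 => i _; rewrite subr_ge0.
  - by apply: (@ge0_emeasurable_sum _ _ _ _ f xpredT) => // k *; exact: f0.
rewrite integral_nneseries//.
rewrite [leRHS]eseries_mkcond; apply: lee_nneseries.
  by move=> k _ _; apply: integral_ge0 => t _; exact: f0.
move=> k _; rewrite /f; case: (K k); last by rewrite integral0_eq.
rewrite ge0_integralZl ?lee_fin//; last exact: (mi k).
rewrite integral_indic//; last exact: mI.
rewrite big_ord_recr /= EFinM; apply: lee_wpmul2l; first by rewrite lee_fin.
apply: (@le_trans _ _ (lebesgue_measure (I k))).
  by apply: le_measure; rewrite ?inE; [exact: (measurableI _ _ (mI k) mJ)|exact: mI|].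
rewrite /I lebesgue_measure_itv/= lte_fin; have := ab k m.
by rewrite le_eqVlt => /orP[/eqP->|->//]; rewrite ltxx subrr.
Qed.

Lemma lebesgue_box {n : nat} (a b : 'rV[R]_n) : (forall i, a 0 i <= b 0 i)%R ->
  @lebesgue_outer R n (cbox a b) = (\prod_(i < n) (b 0 i - a 0 i))%:E.
Proof.
move=> ab; apply/eqP; rewrite eq_le lebesgue_box_le//=.
apply: le_method1P => B abB.
have g0 := @gauge_ge0 R _ _ (@box_vol_ge0 R n).
have [[k koo]|] := pselect (exists k, gauge (@box_vol R n) (B k) = +oo).
  by rewrite (eseries_pinfty _ _ koo) ?leey// => j _; rewrite -ltNye (lt_le_trans _ (g0 _)).
rewrite -forallNE => Boo.
apply/lee_addgt0Pr => e e0.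
apply: le_trans (epsilon_trick _ _ (ltW e0)); last by move=> k; exact: g0.
(* A box around each nonempty [B k], optimal up to [e / 2 ^ k.+1]; empty sets have gauge 0 and are
   left out of the cover. *)
pose Q k (ab : 'rV[R]_n * 'rV[R]_n) := (forall i, ab.1 0 i <= ab.2 0 i)%R /\
  (B k !=set0 -> B k `<=` cbox ab.1 ab.2 /\
  (\prod_(i < n) (ab.2 0 i - ab.1 0 i))%:E <=
     gauge (@box_vol R n) (B k) + (e / (2 ^ k.+1)%:R)%:E).
have [G PG] : {G : nat -> 'rV[R]_n * 'rV[R]_n & forall k, Q k (G k)}.
  apply: (@choice _ _ Q) => k; have [Bk0|/eqP/[dup]/set0P Bk0 /negbTE Bk] := pselect (B k = set0).
    by exists (0, 0)%R; split=> //=; rewrite Bk0 => -[].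
  have := Boo k; have := g0 (B k); rewrite /gauge Bk /box_vol.
  set S := ereal_inf _; move=> S0 Sy.
  have e1 : (0 < e / (2 ^ k.+1)%:R)%R by rewrite divr_gt0// ltr0n expn_gt0.
  have /(lb_ereal_inf_adherent e1) : S \is a fin_num by case: S S0 Sy.
  move=> [_ [a' [b' [ab' Bab ->]]] h].
  by exists (a', b'); split=> // _; split=> //=; rewrite /gauge Bk; exact: ltW.
(* Extension by 0 to all natural indices, the form in which [box_cover_volume] can lower the
   dimension. *)
pose ext (v : 'rV[R]_n) (i : nat) : R := (if insub i is Some j then v 0 j else 0)%R.
have extE v (i : 'I_n) : ext v i = v 0%R i by rewrite /ext valK.
have ext_le (u v : 'rV[R]_n) : (forall i, u 0 i <= v 0 i)%R -> forall i, (ext u i <= ext v i)%R.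
  by move=> uv i; rewrite /ext; case: insub.
have := @box_cover_volume n (fun k => `[< B k !=set0 >])
  (fun k => ext (G k).1) (fun k => ext (G k).2) (ext a) (ext b)
  (fun k => ext_le _ _ (PG k).1) (ext_le _ _ ab).
have cov (x : nat -> R) : (forall i, (i < n)%N -> ext a i <= x i <= ext b i)%R ->
    exists k, `[< B k !=set0 >] /\
    forall i, (i < n)%N -> (ext (G k).1 i <= x i <= ext (G k).2 i)%R.
  move=> h; have /abB[k _ Bk] : cbox a b (\row_i x i).
    by move=> i; rewrite mxE -!extE; exact: h.
  have Bk0 : B k !=set0 by eexists; exact: Bk.
  exists k; split; first exact/asboolP.
  move=> i ilt; have [_ /(_ Bk0) [/(_ _ Bk) /(_ (Ordinal ilt)) + _]] := PG k.
  by rewrite mxE -!extE.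
move=> /(_ cov); rewrite (eq_bigr (fun i => b 0 i - a 0 i)%R); last first.
  by move=> i _; rewrite !extE.
move=> /le_trans; apply; rewrite eseries_mkcond; apply: lee_nneseries.
  move=> k _ _; case: ifP => // _; rewrite lee_fin; apply: prodr_ge0 => i _.
  by rewrite subr_ge0; apply: ext_le; exact: (PG k).1.
move=> k _; case: ifPn => [/asboolP Bk0|_]; last first.
  by apply: adde_ge0; rewrite ?g0// lee_fin divr_ge0// ltW.
have [_ /(_ Bk0)[_]] := PG k; rewrite (eq_bigr (fun i : 'I_n => ext (G k).2 i - ext (G k).1 i)%R)//.
by move=> i _; rewrite !extE.
Qed.

End cover_volume.

(** * Open sets for an outer measure that measures the coordinate half-spaces *)

Section open_measurable.
Context {R : realType} {n : nat}.
Local Notation E := 'rV[R]_n.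
Variable mu : {outer_measure set E -> \bar R}.
Hypothesis mu_halfspace : forall (i : 'I_n) (c : R),
  mu.-caratheodory [set x : E | x 0 i <= c].
Local Notation mT := (caratheodory_type mu).

Lemma caratheodory_ltr (i : 'I_n) (c : R) : mu.-caratheodory [set x : E | x 0 i < c].
Proof.
have -> : [set x : E | x 0 i < c] =
    \bigcup_(k : nat) [set x : E | x 0 i <= c - k.+1%:R^-1].
  apply/seteqP; split => x /=.
    rewrite -subr_gt0 => h; have [k hk] := ltr_add_invr h.
    by exists k => //=; rewrite add0r in hk; rewrite lerBrDr -lerBrDl ltW.
  move=> [k _ /=] /le_lt_trans; apply.
  by rewrite ltrBlDr ltrDl invr_gt0.
by apply: caratheodory_measurable_bigcup => k; exact: mu_halfspace.
Qed.

Definition ocube (x : E) (r : R) : set E := [set y | forall i, `|x 0 i - y 0 i| < r].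

Lemma caratheodory_bigcap (I : finType) (F : I -> set E) :
  (forall i, mu.-caratheodory (F i)) -> mu.-caratheodory [set y | forall i, F i y].
Proof.
move=> mF; have -> : ([set y | forall i, F i y] : set E) =
    ~` \bigcup_(k in [set: nat]) (if choice.unpickle k is Some i then ~` F i else set0).
  apply/seteqP; split => y /=.
    by move=> h [k _]; case: choice.unpickle => // i; apply; exact: h.
  move=> h i; apply: contrapT => nF; apply: h; exists (choice.pickle i) => //.
  by rewrite choice.pickleK.
apply: caratheodory_measurable_setC; apply: caratheodory_measurable_bigcup => k.
case: choice.unpickle => [i|]; last exact: caratheodory_measurable_set0.
exact: caratheodory_measurable_setC.
Qed.

Lemma caratheodory_ocube (x : E) (r : R) : mu.-caratheodory (ocube x r).
Proof.
have -> : ocube x r = [set y : E | forall i,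
    ((~` [set y : E | y 0 i <= x 0 i - r]) `&` [set y : E | y 0 i < x 0 i + r]) y].
  apply/seteqP; split => y /= h i; have := h i; rewrite ltr_distlC.
    by move=> /andP[h1 h2]; split=> //=; apply/negP; rewrite -ltNge.
  by move=> [/negP]; rewrite -ltNge => -> ->.
apply: caratheodory_bigcap => i; apply: caratheodory_measurable_setI.
  by apply: caratheodory_measurable_setC; exact: mu_halfspace.
exact: caratheodory_ltr.
Qed.

Lemma open_ocube (U : set E) (x : E) : open U -> U x ->
  exists r, 0 < r /\ ocube x r `<=` U.
Proof.
move=> oU Ux; have /nbhs_ballP[r /= r0 rU] := open_nbhs_nbhs (conj oU Ux).
exists r; split=> // y h; apply: rU; split=> // i j.
by rewrite (ord1 i); exact: h.
Qed.

(** An open set is the union of the rational cubes that it contains, and these are countably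
    many. *)
Lemma caratheodory_open (U : set E) : open U -> mu.-caratheodory U.
Proof.
move=> oU.
pose c (q : 'rV[rat]_n * rat) := ocube (map_mx ratr q.1) (ratr q.2).
have -> : U = \bigcup_(k in [set: nat]) (if choice.unpickle k is Some q then
    (if `[< c q `<=` U >] then c q else set0) else set0).
  apply/seteqP; split => x; last first.
    move=> [k _]; case: choice.unpickle => // q; case: ifPn => // /asboolP; exact.
  move=> Ux; have [r [r0 rU]] := open_ocube oU Ux.
  (* A half-side above [r / 4] and a centre within [r / 4] of [x] put [x] in the cube; a half-side
     below [r / 2] keeps the cube within [3 / 4 * r] of [x]. *)
  have r4 : r / 4 < r / 2 by lra.
  have [s] := rat_in_itvoo r4; rewrite in_itv/= => /andP[s1 s2].
  have /choice[q hq] : forall i : 'I_n, exists q : rat, `|ratr q - x 0 i| < r / 4.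
    move=> i; have [|q] := @rat_in_itvoo R (x 0 i - r / 4) (x 0 i + r / 4); first lra.
    rewrite in_itv/= => h; exists q; rewrite distrC ltr_distlC//.
  exists (choice.pickle (\row_i q i, s)) => //; rewrite choice.pickleK.
  have cx : c (\row_i q i, s) x.
    by move=> i; rewrite !mxE; apply: lt_trans (hq i) _.
  case: ifPn => // /asboolP; apply: contra_notP => _ y h; apply: rU => i.
  have := h i; have := hq i; rewrite !mxE /= !ltr_norml => /andP[? ?] /andP[? ?].
  apply/andP; split; lra.
apply: caratheodory_measurable_bigcup => k; case: choice.unpickle => [q|].
  by case: ifP => _; [exact: caratheodory_ocube|exact: caratheodory_measurable_set0].
exact: caratheodory_measurable_set0.
Qed.

Lemma cara_measurable_open (U : set mT) : open (U : set E) -> measurable U.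
Proof. exact: caratheodory_open. Qed.

Lemma cara_measurable_closed (F : set mT) : closed (F : set E) -> measurable F.
Proof.
by move=> cF; rewrite -(setCK F); apply: measurableC;
  apply: cara_measurable_open; exact: closed_openC.
Qed.

Lemma cara_measurable_continuous (D : set mT) (f : E -> R) : measurable D ->
  continuous f -> measurable_fun D (f : mT -> R).
Proof.
move=> mD cf; apply: (measurability _ (RGenOInfty.measurableE R)).
move=> _ [_ [a ->] <-]; apply: measurableI => //.
apply: cara_measurable_open; apply: open_comp; last exact: interval_open.
by move=> x _; exact: cf.
Qed.

End open_measurable.

(** * Euclidean norm and Caratheodory's criterion *)

Section euclidean_norm.
Context {R : realType} {n : nat}.
Local Notation E := 'rV[R]_n.
Implicit Types x y z : E.

Lemma dotpC x y : dotp x y = dotp y x.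
Proof. by apply: eq_bigr => i _; rewrite mulrC. Qed.

Lemma dotpDl x y z : dotp (x + y) z = dotp x z + dotp y z.
Proof. by rewrite -big_split; apply: eq_bigr => i _ /=; rewrite mxE mulrDl. Qed.

Lemma dotpZl (a : R) x z : dotp (a *: x) z = a * dotp x z.
Proof. by rewrite /dotp mulr_sumr; apply: eq_bigr => i _ /=; rewrite mxE mulrA. Qed.

Lemma dotpBl x y z : dotp (x - y) z = dotp x z - dotp y z.
Proof. by rewrite dotpDl -scaleN1r dotpZl mulN1r. Qed.

Lemma dotp_ge0 x : 0 <= dotp x x.
Proof. by apply: sumr_ge0 => i _; rewrite -expr2 sqr_ge0. Qed.

Lemma enorm_ge0 x : 0 <= enorm x. Proof. exact: sqrtr_ge0. Qed.

Lemma sqr_enorm x : enorm x ^+ 2 = dotp x x.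
Proof. by rewrite /enorm sqr_sqrtr// dotp_ge0. Qed.

Lemma enormZ (a : R) x : enorm (a *: x) = `|a| * enorm x.
Proof.
by rewrite /enorm dotpZl dotpC dotpZl mulrA -expr2 sqrtrM ?sqr_ge0// sqrtr_sqr.
Qed.

Lemma enormN x : enorm (- x) = enorm x.
Proof. by rewrite -scaleN1r enormZ normrN1 mul1r. Qed.

Lemma enormB x y : enorm (x - y) = enorm (y - x).
Proof. by rewrite -opprB enormN. Qed.

Lemma enorm0 : enorm (0 : E) = 0.
Proof. by rewrite -(scale0r 0) enormZ normr0 mul0r. Qed.

Lemma dotp_sqr_le x y : dotp x y ^+ 2 <= dotp x x * dotp y y.
Proof.
have [y0|y0] := eqVneq (dotp y y) 0.
  have h i : y 0 i = 0.
    move: y0 => /eqP; rewrite psumr_eq0; last by move=> j _; rewrite -expr2 sqr_ge0.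
    by move=> /allP /(_ i (mem_index_enum _)) /=; rewrite -expr2 sqrf_eq0 => /eqP.
  rewrite (_ : dotp x y = 0) ?expr0n ?mulr_ge0 ?dotp_ge0//.
  by rewrite /dotp big1// => i _; rewrite h mulr0.
have yp : 0 < dotp y y by rewrite lt_def y0 dotp_ge0.
have := dotp_ge0 (dotp y y *: x - dotp x y *: y).
rewrite !(dotpBl, dotpZl, dotpC x (_ - _), dotpC y (_ - _)).
set a := dotp x x; set b := dotp y y; set c := dotp x y; rewrite (dotpC y x) -/c.
rewrite (_ : _ - _ = b * (a * b - c ^+ 2)); last by ring.
by rewrite pmulr_rge0// subr_ge0.
Qed.

Lemma abs_dotp_le x y : `|dotp x y| <= enorm x * enorm y.
Proof.
rewrite -(@ler_pXn2r _ 2)// ?nnegrE ?mulr_ge0 ?enorm_ge0//.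
by rewrite -normrX ger0_norm ?sqr_ge0// exprMn !sqr_enorm dotp_sqr_le.
Qed.

Lemma enormD x y : enorm (x + y) <= enorm x + enorm y.
Proof.
rewrite -(@ler_pXn2r _ 2)// ?nnegrE ?addr_ge0 ?enorm_ge0//.
rewrite sqrrD !sqr_enorm dotpDl (dotpC x (x + y)) (dotpC y (x + y)) !dotpDl.
by rewrite (dotpC y x); have := le_trans (ler_norm _) (abs_dotp_le x y); lra.
Qed.

Lemma coord_le_enorm x (i : 'I_n) : `|x 0 i| <= enorm x.
Proof.
rewrite -(@ler_pXn2r _ 2)// ?nnegrE ?enorm_ge0//.
rewrite -normrX ger0_norm ?sqr_ge0// sqr_enorm /dotp (bigD1 i)//= -expr2 lerDl.
by apply: sumr_ge0 => j _; rewrite -expr2 sqr_ge0.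
Qed.

Lemma enorm_le_coord x (r : R) : 0 <= r -> (forall i, `|x 0 i| <= r) ->
  enorm x <= n%:R * r.
Proof.
move=> r0 h; rewrite -(@ler_pXn2r _ 2)// ?nnegrE ?mulr_ge0 ?enorm_ge0//.
rewrite sqr_enorm; apply: (@le_trans _ _ (\sum_(i < n) r ^+ 2)).
  apply: ler_sum => i _; rewrite -expr2.
  by rewrite -[leLHS]ger0_norm ?sqr_ge0// normrX ler_pXn2r ?nnegrE.
rewrite sumr_const card_ord -[leLHS]mulr_natl exprMn; apply: ler_wpM2r; first exact: sqr_ge0.
by rewrite -natrX ler_nat; case: (n) => // m; rewrite expnS expn1 leq_pmulr.
Qed.

End euclidean_norm.

(** * Caratheodory's criterion for metric outer measures *)

Section metric_outer_measure.
Context {R : realType} {n : nat}.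
Local Notation E := 'rV[R]_n.
Variables (mu : {outer_measure set E -> \bar R}) (i : 'I_n).
Hypothesis mu_metric : forall (A B : set E) (e : R), 0 < e ->
  (forall x y, A x -> B y -> e <= `|x 0 i - y 0 i|) ->
  (mu A + mu B <= mu (A `|` B))%E.

(* Caratheodory's criterion: the layers at distance between 1/(j+2) and 1/(j+1)
   from the half-space have summable measures. *)
Lemma metric_halfspace (c : R) : mu.-caratheodory [set x : E | x 0 i <= c].
Proof.
apply: le_caratheodory_measurable => X.
have mu0 := outer_measure_ge0 mu.
have [->|Xoo] := eqVneq (mu X) +oo%E; first by rewrite leey.
have Xfin : mu X \is a fin_num by rewrite ge0_fin_numE// ltey.
pose d (j : nat) : R := c + j.+1%:R^-1.
have d_lt j k : (j < k)%N -> d k < d j.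
  by move=> jk; rewrite /d ltrD2l ltf_pV2 ?posrE// ltr_nat ltnS.
have d_le j k : (j <= k)%N -> d k <= d j.
  by rewrite leq_eqVlt => /orP[/eqP->//|/d_lt/ltW].
pose L (j : nat) : set E := X `&` [set x : E | d j.+1 <= x 0 i < d j].
pose N (k : nat) : set E := X `&` [set x : E | d k <= x 0 i].
(* Two layers with indices of the same parity are separated by the layer in between, so [mu] is
   superadditive over the even ones and over the odd ones. *)
have sumL p m : (\sum_(0 <= j < m) mu (L (j.*2 + p)%N) <=
    mu (\bigcup_(j in `I_m) L (j.*2 + p)%N))%E.
  elim: m => [|m IH]; first by rewrite big_geq.
  rewrite big_nat_recr//= (_ : \bigcup_(j in `I_m.+1) _ =
    (\bigcup_(j in `I_m) L (j.*2 + p)%N) `|` L (m.*2 + p)%N); last first.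
    by rewrite IIS bigcup_setU bigcup_set1.
  case: m IH => [|m] IH; first by rewrite big_geq// II0 bigcup_set0 set0U add0e.
  apply: le_trans (@mu_metric _ _ (d (m.*2 + p).+1 - d (m.*2 + p).+2) _ _).
  - by rewrite leeD.
  - by rewrite subr_gt0; exact: d_lt.
  move=> x y [j /= jm [_ /andP[jx _]]] [_ /andP[_ yj]].
  have h : d (m.*2 + p).+1 <= x 0 i.
    by apply: le_trans jx; apply: d_le; rewrite ltnS leq_add2r leq_double.
  rewrite ger0_norm ?subr_ge0; first by rewrite lerB// ltW// (lt_le_trans yj).
  by rewrite ltW// (lt_le_trans yj)// (le_trans _ h)// d_le// doubleS addSn.
have sumL_le p m : (\sum_(0 <= j < m) mu (L (j.*2 + p)%N) <= mu X)%E.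
  apply: le_trans (sumL p m) _; apply: le_outer_measure.
  by apply: bigcup_sub => j _ x [].
have sumLoo : (\sum_(j <oo) mu (L j) < +oo)%E.
  apply: (@le_lt_trans _ _ (mu X + mu X)%E); last by rewrite lte_add_pinfty ?ltey.
  apply: lime_le; first exact: is_cvg_nneseries.
  apply: nearW => m; apply: (@le_trans _ _ (\sum_(0 <= j < m.*2) mu (L j))%E).
    by apply: lee_sum_nneg_natr => //; rewrite -addnn leq_addr.
  have -> : (\sum_(0 <= j < m.*2) mu (L j) =
     \sum_(0 <= j < m) mu (L (j.*2 + 0)%N) + \sum_(0 <= j < m) mu (L (j.*2 + 1)%N))%E.
    elim: m => [|m IH]; first by rewrite !big_geq// adde0.
    rewrite doubleS !big_nat_recr//= IH addn0 addn1.
    by rewrite -!addeA; congr (_ + _)%E; rewrite addeCA.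
  by apply: leeD; exact: sumL_le.
(* Above the hyperplane, whatever [N k] misses lies in the layers from index [k] on, whose total
   measure tends to 0; [N k] itself is at positive distance from the half-space. *)
have NL k : X `&` ~` [set x : E | x 0 i <= c] `<=`
    N k `|` \bigcup_(j in ~` `I_k) L j.
  move=> x [Xx /= /negP]; rewrite -ltNge => cx.
  have [kx|xk] := leP (d k) (x 0 i); [by left; split|right].
  have [m] : exists m, d m <= x 0 i.
    move: cx; rewrite -subr_gt0 => /ltr_add_invr[m]; rewrite add0r => hm.
    by exists m; rewrite /d -lerBrDl ltW.
  elim: m => [|m IH] mx.
    by move: (lt_le_trans xk (d_le 0%N k isT)); rewrite ltNge mx.
  have [/IH//|xm] := leP (d m) (x 0 i).
  exists m => //=; last by split=> //=; rewrite mx.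
  by move=> mk; move: (le_trans (d_le _ _ mk) mx); rewrite leNgt xk.
have tail := nneseries_tail_cvg sumLoo (fun k _ => mu0 _).
apply/lee_addgt0Pr => e e0.
have [] := tail [set y | (y < e%:E)%E].
  by apply: open_nbhs_nbhs; split; [exact: open_ereal_lt_ereal|rewrite /= lte_fin].
move=> k _ /(_ k (leqnn k)) /= tk.
set H : set E := [set x : E | x 0 i <= c].
apply: (@le_trans _ _ (mu (X `&` H) + (mu (N k) + e%:E))%E).
  rewrite leeD2lE//; last first.
    rewrite ge0_fin_numE//; apply: le_lt_trans (_ : mu X < +oo)%E; last by rewrite ltey.
    by apply: le_outer_measure; exact: subIsetl.
  apply: le_trans (le_outer_measure mu _ _ (NL k)) _.
  apply: le_trans (outer_measureU2 _ _ _) _; apply: leeD => //.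
  by apply: le_trans (ltW tk); exact: outer_measure_sigma_subadditive_tail.
rewrite addeA leeD2r//.
apply: le_trans (@mu_metric _ _ k.+1%:R^-1 _ _) _.
- by rewrite invr_gt0.
- move=> x y [_ /= xc] [_ /= dy]; rewrite distrC ger0_norm; last first.
    by rewrite subr_ge0 (le_trans xc)// (le_trans _ dy)// lerDl invr_ge0.
  by rewrite lerBrDr (le_trans _ dy)// addrC lerD2r.
by apply: le_outer_measure => x [[]|[]].
Qed.

End metric_outer_measure.

(** * Hausdorff measure and thickenings *)

Section unit_ball_volume.
Context {R : realType} {s : nat}.

Lemma cbox_center_prod (x : 'rV[R]_s) (a : R) : 0 <= a ->
  @lebesgue_outer R s (cbox (x - const_mx a) (x + const_mx a)) = ((2 * a) ^+ s)%:E.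
Proof.
move=> a0; rewrite lebesgue_box; last first.
  by move=> i; rewrite !mxE lerBlDr -addrA lerDl addr_ge0.
congr EFin; rewrite (eq_bigr (fun=> 2 * a)) ?prodr_const ?card_ord//.
by move=> i _; rewrite !mxE; ring.
Qed.

(** The ball lies between two cubes. The outer one matters as well, since [fine] would send an
    infinite volume to 0. *)
Lemma ball_vol_gt0 : 0 < ball_vol R s.
Proof.
pose B := [set x : 'rV[R]_s | enorm x <= 1].
have Bub : (lebesgue_outer B <= ((2 * 1) ^+ s)%:E)%E.
  rewrite -(@cbox_center_prod 0)//.
  apply: (le_outer_measure (lebesgue_om R s)) => x /= x1 i.
  have := le_trans (coord_le_enorm x i) x1.
  by rewrite !mxE !add0r ler_norml.
have Blb : (((2 * s.+1%:R^-1) ^+ s)%:E <= lebesgue_outer B)%E.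
  rewrite -(@cbox_center_prod 0) ?invr_ge0//.
  apply: (le_outer_measure (lebesgue_om R s)) => x /= hx.
  apply: le_trans (@enorm_le_coord _ _ x s.+1%:R^-1 _ _) _; rewrite ?invr_ge0//.
    by move=> i; have := hx i; rewrite !mxE !add0r ler_norml.
  by rewrite ler_pdivrMr// mul1r ler_nat.
have Bfin : lebesgue_outer B \is a fin_num.
  rewrite ge0_fin_numE ?(le_lt_trans Bub) ?ltry//.
  exact: (outer_measure_ge0 (lebesgue_om R s)).
rewrite /ball_vol -lte_fin fineK//; apply: lt_le_trans Blb.
by rewrite lte_fin exprn_gt0// mulr_gt0// invr_gt0.
Qed.

End unit_ball_volume.

Section hausdorff_measurable.
Context {R : realType} {n s : nat}.
Local Notation E := 'rV[R]_n.
Local Notation H := (@hausdorff_om R n s).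
Local Notation w := (@diam_weight R n s).

Lemma diam_weight_le delta (r : R) (A : set E) : 0 <= r <= delta ->
  (forall x y, A x -> A y -> enorm (x - y) <= r) ->
  (w delta A <= (ball_vol R s * (r / 2) ^+ s)%:E)%E.
Proof. by move=> r0 rA; apply: ereal_inf_lbound; exists r. Qed.

Lemma diam_weight_mono (d e : R) (A : set E) : d <= e -> (w e A <= w d A)%E.
Proof.
move=> de; apply: le_ereal_inf_tmp => _ [r [/andP[r0 rd] rA ->]].
by apply: diam_weight_le => //; rewrite r0 (le_trans rd).
Qed.

Lemma method1_diam_mono (d e : R) (A : set E) : d <= e ->
  (method1 (w e) A <= method1 (w d) A)%E.
Proof.
move=> de; apply: le_method1P => B AB; apply: le_trans (method1_le _ AB) _.
apply: lee_nneseries => [k _ _|k _]; first exact: gauge_ge0 (@diam_weight_ge0 R n s e) _.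
by rewrite /gauge; case: ifP => // _; exact: diam_weight_mono.
Qed.

Lemma method1_le_hausdorff (d : R) (A : set E) : 0 < d ->
  (method1 (w d) A <= H A)%E.
Proof. by move=> d0; apply: ereal_sup_ubound; exists d. Qed.

Lemma hausdorff_le_method1 (A : set E) (c : \bar R) (d0 : R) : 0 < d0 ->
  (forall d, 0 < d -> d <= d0 -> (method1 (w d) A <= c)%E) -> (H A <= c)%E.
Proof.
move=> d00 h; apply: ge_ereal_sup => _ [d /= dp <-].
apply: le_trans (@method1_diam_mono (Num.min d d0) d A _) _.
  by rewrite ge_min lexx.
by apply: h; rewrite ?lt_min ?dp// ge_min lexx orbT.
Qed.

(** A set of diameter at most [d < e] cannot meet both [A] and [B], so each member of a cover is
    charged to only one of them. *)
Lemma method1_metric (i : 'I_n) (A B : set E) (d e : R) : d < e ->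
  (forall x y, A x -> B y -> e <= `|x 0 i - y 0 i|) ->
  (method1 (w d) A + method1 (w d) B <= method1 (w d) (A `|` B))%E.
Proof.
move=> de AB; have w0 := @diam_weight_ge0 R n s d.
have m0 C := method1_ge0 w0 C.
pose Phi C := (method1 (w d) (C `&` A) + method1 (w d) (C `&` B))%E.
apply: (@le_trans _ _ (Phi (A `|` B))).
  by apply: leeD; apply: le_method1 => x Cx; split=> //; [left|right].
rewrite -[leRHS]mul1e.
apply: (@method1_greatest R _ (w d) w0 Phi) => //.
- by move=> C; exact: adde_ge0.
- move=> C F CF; rewrite nneseriesD//.
  by apply: leeD; apply: method1_subset_sigma => //; rewrite -setI_bigcupl; exact: setSI.
move=> C; rewrite mul1e.
have [CA|CA] := pselect (C `&` A = set0).
  rewrite /Phi CA method1_0// add0e; apply: le_trans (method1_gauge w0 _).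
  by apply: le_method1; exact: subIsetl.
have [CB|CB] := pselect (C `&` B = set0).
  rewrite /Phi CB method1_0// adde0; apply: le_trans (method1_gauge w0 _).
  by apply: le_method1; exact: subIsetl.
have [x [Cx Ax]] : C `&` A !=set0 by apply/set0P/eqP.
have [y [Cy By]] : C `&` B !=set0 by apply/set0P/eqP.
rewrite /gauge; case: ifPn => [/eqP C0|_]; first by rewrite C0 in Cx.
apply: le_ereal_inf_tmp => _ [r [/andP[_ rd] rC ->]].
have := coord_le_enorm (x - y) i; rewrite !mxE => h2.
have := le_lt_trans (le_trans (AB _ _ Ax By) (le_trans h2 (le_trans (rC _ _ Cx Cy) rd))) de.
by rewrite ltxx.
Qed.

Lemma hausdorff_metric (i : 'I_n) (A B : set E) (e : R) : 0 < e ->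
  (forall x y, A x -> B y -> e <= `|x 0 i - y 0 i|) ->
  (H A + H B <= H (A `|` B))%E.
Proof.
move=> e0 AB; have H0 C := outer_measure_ge0 H C.
have [->|Hoo] := eqVneq (H (A `|` B)) +oo%E; first by rewrite leey.
have Hfin : H (A `|` B) \is a fin_num by rewrite ge0_fin_numE// ltey.
have Afin : H A \is a fin_num.
  rewrite ge0_fin_numE//; apply: le_lt_trans (_ : H (A `|` B) < +oo)%E; last by rewrite ltey.
  by apply: le_outer_measure; exact: subsetUl.
have Bfin : H B \is a fin_num.
  rewrite ge0_fin_numE//; apply: le_lt_trans (_ : H (A `|` B) < +oo)%E; last by rewrite ltey.
  by apply: le_outer_measure; exact: subsetUr.
rewrite -leeBrDr//; apply: ge_ereal_sup => _ [d /= d0 <-].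
rewrite leeBrDr// addeC -leeBrDr; last first.
  rewrite ge0_fin_numE; last exact: method1_ge0 (@diam_weight_ge0 R n s d) _.
  apply: le_lt_trans (_ : H A < +oo)%E; first exact: method1_le_hausdorff.
  by rewrite ltey_eq Afin.
apply: ge_ereal_sup => _ [d' /= d'0 <-].
rewrite leeBrDr; last first.
  rewrite ge0_fin_numE; last exact: method1_ge0 (@diam_weight_ge0 R n s d) _.
  apply: le_lt_trans (_ : H A < +oo)%E; first exact: method1_le_hausdorff.
  by rewrite ltey_eq Afin.
(* One scale for both suprema: the pre-measures increase as the scale decreases, and below [e] they
   are additive on [A] and [B]. *)
pose r := Num.min (Num.min d d') (e / 2).
have r0 : 0 < r by rewrite !lt_min d0 d'0 divr_gt0.
have rd : r <= d by rewrite /r !ge_min lexx.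
have rd' : r <= d' by rewrite /r !ge_min lexx orbT.
have re : r < e by rewrite /r gt_min (_ : e / 2 < e) ?orbT//; lra.
rewrite addeC; apply: (@le_trans _ _ (method1 (w r) A + method1 (w r) B)%E).
  by apply: leeD; exact: method1_diam_mono.
by apply: le_trans (method1_metric re AB) _; exact: method1_le_hausdorff.
Qed.

Lemma hausdorff_halfspace (i : 'I_n) (c : R) :
  H.-caratheodory [set x : E | x 0 i <= c].
Proof. by apply: metric_halfspace => A B e; exact: hausdorff_metric. Qed.

End hausdorff_measurable.

(** * Volume of thickenings in a coordinate direction *)

Section thickening.
Context {R : realType} {n : nat}.
Hypothesis n_ge2 : (2 <= n)%N.
Local Notation E := 'rV[R]_n.
Local Notation lo := (@lebesgue_outer R n).

Definition thick (i : 'I_n) (t : R) (A : set E) : set E :=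
  [set x | exists2 u, 0 <= u <= t & A (x - u *: delta_mx 0 i)].

(** A set of diameter [r <= t] thickens into a box with [n - 1] sides [2 * r] and one side
    [2 * r + t <= 3 * t]. The constant is the ratio of [3 * t * (2 * r) ^ n.-1] to [t] times the
    Hausdorff weight [ball_vol * (r / 2) ^ n.-1]. *)
Definition thick_const : R := 3 * 4 ^+ n.-1 / ball_vol R n.-1.

Lemma thick_const_gt0 : 0 < thick_const.
Proof. by rewrite divr_gt0 ?ball_vol_gt0// mulr_gt0// exprn_gt0. Qed.

Lemma prod_except (i : 'I_n) (a b : R) :
  \prod_(j < n) (if j == i then b else a) = b * a ^+ n.-1.
Proof.
rewrite (bigD1 i)//= eqxx; congr (_ * _).
rewrite (eq_bigr (fun=> a)); last by move=> j /negbTE ->.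
by rewrite prodr_const cardC1 card_ord.
Qed.

Lemma thick_small i t r (A : set E) : 0 < r -> r <= t ->
  (forall x y, A x -> A y -> enorm (x - y) <= r) ->
  (lo (thick i t A) <= (3 * t * (2 * r) ^+ n.-1)%:E)%E.
Proof.
move=> r0 rt rA; have t0 : 0 < t := lt_le_trans r0 rt.
have [A0|/eqP/set0P[a Aa]] := pselect (A = set0).
  rewrite (_ : thick i t A = set0); last first.
    by apply/seteqP; split=> // x [u _]; rewrite A0.
  by rewrite (outer_measure0 (lebesgue_om R n)) lee_fin !mulr_ge0// ?exprn_ge0// ?mulr_ge0// ltW.
pose lft : E := a - const_mx r.
pose rgt : E := a + const_mx r + t *: delta_mx 0 i.
apply: (@le_trans _ _ (lo (cbox lft rgt))).
  apply: (le_outer_measure (lebesgue_om R n)) => x [u /andP[u0 ut] Ax] j.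
  have := le_trans (coord_le_enorm _ j) (rA _ _ Ax Aa).
  rewrite !mxE eqxx /= ler_norml; case: (j == i) => /=;
    rewrite ?mulr1 ?mulr0 => /andP[h1 h2]; apply/andP; split; lra.
apply: le_trans (lebesgue_box_le _) _.
  by move=> j; rewrite !mxE eqxx /=; case: (j == i) => /=; rewrite ?mulr1 ?mulr0; lra.
rewrite lee_fin (eq_bigr (fun j => if j == i then 2 * r + t else 2 * r)); last first.
  by move=> j _; rewrite !mxE eqxx /=; case: (j == i) => /=; rewrite ?mulr1 ?mulr0; ring.
rewrite prod_except ler_pM2r ?exprn_gt0 ?mulr_gt0//; lra.
Qed.

Lemma thick_gauge i t (A : set E) : 0 < t ->
  (lo (thick i t A) <= (thick_const * t)%:E * gauge (@diam_weight R n n.-1 t) A)%E.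
Proof.
move=> t0; have [->|/eqP A0] := pselect (A = set0).
  rewrite (_ : thick i t set0 = set0); last by apply/seteqP; split=> // x [].
  by rewrite (outer_measure0 (lebesgue_om R n)) gauge0 mule0.
have kt0 : 0 < thick_const * t by rewrite mulr_gt0// thick_const_gt0.
rewrite /gauge (negbTE A0) -lee_pdivrMl//; apply: le_ereal_inf_tmp.
move=> _ [r [/andP[r0 rt] rA ->]]; rewrite lee_pdivrMl// -EFinM.
have -> : thick_const * t * (ball_vol R n.-1 * (r / 2) ^+ n.-1) = 3 * t * (2 * r) ^+ n.-1.
  rewrite (_ : 2 * r = 4 * (r / 2)); last by lra.
  have b0 := lt0r_neq0 (@ball_vol_gt0 R n.-1).
  rewrite [(4 * _) ^+ _]exprMn /thick_const; move: (ball_vol _ _) b0 => b b0.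
  by move: (4 ^+ n.-1) ((r / 2) ^+ n.-1) => u v; field.
have [r00|r_neq0] := eqVneq r 0; last first.
  by apply: thick_small => //; rewrite lt_def r_neq0.
(* In diameter 0 the thickening is at most a segment, null because [n >= 2]. It is enclosed in the
   boxes for small [r']: [2 * r' <= 1] reduces the exponent [n - 1] to 1, and then
   [3 * t * (2 * r') <= e]. *)
have h0 : (lo (thick i t A) <= 0)%E.
  apply/lee_addgt0Pr => e e0; rewrite add0e.
  pose r' := Num.min (Num.min t (1 / 2)) (e / (3 * t * 2)).
  have r'0 : 0 < r' by rewrite !lt_min t0 !divr_gt0//= !mulr_gt0.
  have r't : r' <= t by rewrite /r' !ge_min lexx.
  have r'1 : r' <= 1 / 2 by rewrite /r' !ge_min lexx orbT.
  have r'e : r' <= e / (3 * t * 2) by rewrite /r' !ge_min lexx !orbT.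
  apply: le_trans (@thick_small i t r' A r'0 r't _) _.
    by move=> x y Ax Ay; rewrite (le_trans (rA _ _ Ax Ay))// r00 ltW.
  rewrite lee_fin; case: (n) n_ge2 => // -[//|m] _ /=.
  apply: (@le_trans _ _ (3 * t * (2 * r'))).
    have r'2 : 0 <= 2 * r' by rewrite mulr_ge0// ltW.
    by rewrite ler_pM2l ?mulr_gt0// exprS ler_piMr// exprn_ile1//; lra.
  by move: r'e; rewrite ler_pdivlMr ?mulr_gt0//; lra.
have t0' := ltW t0.
by apply: le_trans h0 _; rewrite lee_fin mulr_ge0 ?exprn_ge0 ?mulr_ge0.
Qed.

(** The scale of the pre-measure is taken equal to the width [t], so that each covering set is small
    compared with its displacement; the full Hausdorff measure only enters as an upper bound. *)
Lemma thick_hausdorff i t (A : set E) : 0 < t ->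
  (lo (thick i t A) <= (thick_const * t)%:E * @hausdorff_outer R n n.-1 A)%E.
Proof.
move=> t0; have w0 := @diam_weight_ge0 R n n.-1 t.
have kt0 : 0 < thick_const * t by rewrite mulr_gt0// thick_const_gt0.
apply: (@le_trans _ _ ((thick_const * t)%:E * method1 (diam_weight n.-1 t) A)%E); last first.
  by rewrite lee_pmul2l// ?lte_fin//; exact: (@method1_le_hausdorff R n n.-1).
apply: (@method1_greatest R _ (diam_weight n.-1 t) w0 (fun A => lo (thick i t A))) => //.
- by move=> B; exact: (outer_measure_ge0 (lebesgue_om R n)).
- move=> C F CF; apply: lebesgue_subset_sigma => x [u ut /CF[k _ Fk]].
  by exists k => //; exists u.
- by move=> B; exact: thick_gauge.
Qed.

End thickening.

(** * Hausdorff measure of Lipschitz graphs *)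

Section finite_families.
Local Open Scope ereal_scope.

Lemma disjoint_card_measure d (T : measurableType d) (R : realType)
    (mu : {measure set T -> \bar R}) (I : finType) (P : {set I})
    (F : I -> set T) (B : set T) (v : R) :
  (forall i, i \in P -> measurable (F i)) ->
  (forall i j, i \in P -> j \in P -> F i `&` F j !=set0 -> i = j) ->
  (forall i, i \in P -> F i `<=` B) -> measurable B ->
  (forall i, i \in P -> v%:E <= mu (F i)) -> ((v *+ #|P|)%R)%:E <= mu B.
Proof.
move=> mF dF FB mB vF.
pose G (j : nat) := if insub j is Some k then F (enum_val (k : 'I_#|P|)) else set0.
have GE (k : 'I_#|P|) : G k = F (enum_val k) by rewrite /G valK.
have mG j : measurable (G j).
  by rewrite /G; case: insubP => // k _ _; apply: mF; exact: enum_valP.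
have tG : trivIset setT G.
  move=> i j _ _; rewrite /G; case: insubP => [k _ <-|_ [x []//]].
  case: insubP => [l _ <-|_ [x []//]] /(dF _ _ (enum_valP _) (enum_valP _)).
  by move=> /enum_val_inj ->.
apply: (@le_trans _ _ (mu (\big[setU/set0]_(j < #|P|) G j))).
  rewrite measure_bigsetU// -[X in (_ *+ X)%R]card_ord -sumr_const -sumEFin.
  by apply: lee_sum => k _; rewrite GE; apply: vF; exact: enum_valP.
apply: le_measure; rewrite ?inE//; first by apply: bigsetU_measurable => k _; exact: mG.
move=> x; rewrite -bigcup_mkord => -[j /= jP].
rewrite (_ : j = Ordinal jP)// GE; apply: FB; exact: enum_valP.
Qed.

Lemma method1_card_le {R : realType} {T : pointedType} (w : set T -> \bar R)
    (I : finType) (P : {set I}) (F : I -> set T) (A : set T) (v : R) :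
  (forall A, 0 <= w A) ->
  (forall x, A x -> exists2 i, i \in P & F i x) ->
  (forall i, i \in P -> gauge w (F i) <= v%:E) -> method1 w A <= ((v *+ #|P|)%R)%:E.
Proof.
move=> w0 AF Fv.
pose G (j : nat) := if insub j is Some k then F (enum_val (k : 'I_#|P|)) else set0.
have GE (k : 'I_#|P|) : G k = F (enum_val k) by rewrite /G valK.
have g0 j : 0 <= gauge w (G j) by exact: gauge_ge0.
apply: le_trans (@method1_le R T w A G _) _.
  move=> x /AF[i iP Fi]; exists (enum_rank_in iP i) => //.
  by rewrite GE enum_rankK_in.
rewrite (nneseries_split 0%N #|P|)// add0n [X in _ + X]eseries0 ?adde0.
  rewrite big_mkord -[X in (_ *+ X)%R]card_ord -sumr_const -sumEFin.
  by apply: lee_sum => k _; rewrite GE; apply: Fv; exact: enum_valP.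
move=> j jP _; rewrite /G; case: insubP => [k|_]; last exact: gauge0.
by rewrite ltnNge jP.
Qed.

End finite_families.

Section graph_height.
Context {R : realType} {n : nat}.
Local Notation E := 'rV[R]_n.
Variables (nu : E) (phi : E -> R) (L : R).
Hypotheses (nu1 : enorm nu = 1) (L0 : 0 <= L)
  (phiL : forall x y, `|phi x - phi y| <= L * enorm (x - y)).

(* The graph is the zero set of the height. *)
Definition height (x : E) : R := dotp x nu - phi (x - dotp x nu *: nu).

Lemma dotp_nu : dotp nu nu = 1.
Proof. by rewrite -sqr_enorm nu1 expr1n. Qed.

(** The projection forgets the component along [nu], so the height moves at unit speed in that
    direction. This keeps stacked copies of a cube disjoint and gives the heights of the points
    [p + d *: nu] and [p - d *: nu]. *)
Lemma heightD x s : height (x + s *: nu) = height x + s.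
Proof.
rewrite /height dotpDl dotpZl dotp_nu mulr1.
rewrite (_ : x + s *: nu - (dotp x nu + s) *: nu = x - dotp x nu *: nu); last first.
  by apply/rowP => i; rewrite !mxE; ring.
by ring.
Qed.

Lemma heightB x s : height (x - s *: nu) = height x - s.
Proof. by rewrite -scaleNr heightD. Qed.

(** The component along [nu] contributes 1, and [phi] after the projection contributes [2 * L], the
    projection being bounded crudely by a factor 2. *)
Lemma height_lipschitz x y : `|height x - height y| <= (1 + 2 * L) * enorm (x - y).
Proof.
have h : `|dotp (x - y) nu| <= enorm (x - y).
  by rewrite (le_trans (abs_dotp_le _ _))// nu1 mulr1.
have h2 := phiL (x - dotp x nu *: nu) (y - dotp y nu *: nu).
have h3 : enorm (x - dotp x nu *: nu - (y - dotp y nu *: nu)) <= 2 * enorm (x - y).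
  rewrite (_ : _ - _ = (x - y) - dotp (x - y) nu *: nu); last first.
    by apply/rowP => i; rewrite dotpBl !mxE; ring.
  rewrite (le_trans (enormD _ _))// enormN enormZ nu1 mulr1; lra.
have h4 := ler_wpM2l L0 h3.
rewrite /height (_ : _ - _ - _ = dotp (x - y) nu - (phi (x - dotp x nu *: nu) -
  phi (y - dotp y nu *: nu))); last by rewrite dotpBl; ring.
rewrite (le_trans (ler_normB _ _))// (le_trans (lerD h (le_trans h2 h4)))//; lra.
Qed.

End graph_height.

Section separation.
Context {R : realType}.

Lemma nat_le_of_scaled (c : R) (a b : nat) : 0 < c -> c * a%:R < c * b%:R + c ->
  (a <= b)%N.
Proof.
by move=> c0; rewrite -[X in _ + X]mulr1 -mulrDr ltr_pM2l// natr1 ltr_nat ltnS.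
Qed.

Lemma separated_steps (c X : R) (a b : nat) : 0 < c ->
  `|X - 3 * c * a%:R| <= c -> `|X - 3 * c * b%:R| <= c -> a = b.
Proof.
rewrite !ler_norml => c0 /andP[h1 h2] /andP[h3 h4]; have c3 : 0 < 3 * c by lra.
by apply/eqP; rewrite eqn_leq; apply/andP; split; apply: (nat_le_of_scaled c3); lra.
Qed.

Lemma separated_grid (c X s : R) (a b : nat) : 0 < s ->
  c + s * a%:R <= X <= c + s * a%:R + s / 2 ->
  c + s * b%:R <= X <= c + s * b%:R + s / 2 -> a = b.
Proof.
move=> s0 /andP[h1 h2] /andP[h3 h4].
by apply/eqP; rewrite eqn_leq; apply/andP; split; apply: (nat_le_of_scaled s0); lra.
Qed.

End separation.

(** * Hausdorff measure of a graph by counting cubes *)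

Section graph_hausdorff.
Context {R : realType} {n' : nat}.
Local Notation n := n'.+1.
Local Notation E := 'rV[R]_n.
Local Notation lo := (@lebesgue_outer R n).
Variables (nu : E) (phi : E -> R) (L : R).
Hypotheses (nu1 : enorm nu = 1) (L0 : 0 <= L)
  (phiL : forall x y, `|phi x - phi y| <= L * enorm (x - y)).
Local Notation h := (height nu phi).

Lemma cara_measurable_cbox (a b : E) :
  measurable (cbox a b : set (caratheodory_type (@lebesgue_om R n))).
Proof.
have -> : cbox a b = [set y : E | forall i,
    ([set y : E | y 0 i <= b 0 i] `&` ~` [set y : E | y 0 i < a 0 i]) y].
  apply/seteqP; split => y /= H i; have := H i.
    by move=> /andP[h1 h2]; split=> //=; apply/negP; rewrite -leNgt.
  by move=> [/= -> /negP]; rewrite -leNgt => ->.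
apply: caratheodory_bigcap => i; apply: caratheodory_measurable_setI.
  exact: lebesgue_halfspace.
apply: caratheodory_measurable_setC; apply: caratheodory_ltr; exact: lebesgue_halfspace.
Qed.

(** [M * s] bounds the height on a cube of side [s] that meets the graph: the diameter is at most
    [n * s], and the height has Lipschitz constant [1 + 2 * L]. *)
Let M := (1 + 2 * L) * n%:R.

Let M_ge1 : 1 <= M.
Proof.
have n1 : 1 <= n%:R :> R by rewrite ler1n.
have L1 : 1 <= 1 + 2 * L by rewrite lerDl mulr_ge0.
by rewrite /M (le_trans L1)// ler_peMr// (le_trans _ L1).
Qed.

(** At most [6 * M * 4 ^ n * m ^ n'] cubes of the grid meet the graph, each of weight at most
    [ball_vol R n' * (n * rho / m) ^ n']; the mesh parameter [m] cancels. *)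
Definition graph_const : R := 6 * M * 4 ^+ n * ball_vol R n' * n%:R ^+ n'.

Section grid.
Variables (p : E) (rho : R) (rho0 : 0 < rho) (m : nat) (m0 : (0 < m)%N).
Variable A : set E.
Hypotheses (A0 : forall x, A x -> h x = 0)
  (Ap : A `<=` cbox (p - const_mx rho) (p + const_mx rho)).

Let s := 2 * rho / m%:R.
Let s0 : 0 < s. Proof. by rewrite divr_gt0 ?mulr_gt0// ltr0n. Qed.
Let idx := {ffun 'I_n -> 'I_m}.
Let corner (k : idx) : E := p - const_mx rho + s *: \row_i (k i)%:R.
Let Q (k : idx) := cbox (corner k) (corner k + const_mx s).
Let I : {set idx} := [set k | `[< Q k `&` A !=set0 >]].

Let cover x : A x -> exists2 k, k \in I & Q k x.
Proof.
move=> Ax; have /choice[k hk] : forall i : 'I_n, exists k : 'I_m,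
    p 0 i - rho + s * k%:R <= x 0 i <= p 0 i - rho + s * k%:R + s.
  move=> i; have := Ap Ax i; rewrite !mxE => /andP[x1 x2].
  have exk : exists k : nat, x 0 i <= p 0 i - rho + s * k%:R + s.
    exists m.-1; rewrite (le_trans x2)// -addrA -[_ + s](_ : s * m%:R = _); last first.
      by rewrite -{1}(prednK m0) -[m.-1.+1]addn1 natrD mulrDr mulr1.
    by rewrite /s divfK ?pnatr_eq0 -?lt0n//; lra.
  have [k hk kmin] := ex_minnP exk.
  have km : (k < m)%N.
    rewrite -(prednK m0) ltnS; apply: kmin.
    rewrite (le_trans x2)// -addrA -[_ + s](_ : s * m%:R = _); last first.
      by rewrite -{1}(prednK m0) -[m.-1.+1]addn1 natrD mulrDr mulr1.
    by rewrite /s divfK ?pnatr_eq0 -?lt0n//; lra.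
  exists (Ordinal km) => /=; rewrite hk andbT.
  case: k {km} hk kmin => [_ _|k hk kmin]; first by rewrite mulr0 addr0.
  rewrite leNgt; apply/negP => xk.
  have /kmin : x 0 i <= p 0 i - rho + s * k%:R + s.
    by move: xk; rewrite -natr1 mulrDr mulr1 addrA => /ltW.
  by rewrite ltnn.
have Qx : Q (finfun k) x.
  by move=> i; have := hk i; rewrite !mxE ffunE.
by exists (finfun k) => //; rewrite inE; apply/asboolP; exists x.
Qed.

Let diam_Q k x y : Q k x -> Q k y -> enorm (x - y) <= n%:R * s.
Proof.
move=> Qx Qy; apply: enorm_le_coord => [|i]; first exact: ltW.
have := Qx i; have := Qy i; rewrite !mxE ler_norml => /andP[? ?] /andP[? ?].
apply/andP; split; lra.
Qed.

Let height_Q k x : k \in I -> Q k x -> `|h x| <= M * s.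
Proof.
rewrite inE => /asboolP[a [Qa Aa]] Qx.
rewrite -[h x]subr0 -(A0 Aa) (le_trans (height_lipschitz nu1 L0 phiL _ _))//.
by rewrite /M -mulrA ler_wpM2l ?(diam_Q Qx)// addr_ge0// mulr_ge0.
Qed.

(** The heights in a cube that meets the graph lie within [M * s] of 0, so steps of [3 * (M * s)]
    along [nu] separate the copies. With [J + 1] copies the displacement stays at most [rho], and
    the copies remain in the cube of half-side [2 * rho]. *)
Let J := Num.truncn (rho / (3 * (M * s))).
Let pc (kj : idx * 'I_J.+1) : E := corner kj.1 + (3 * (M * s) * kj.2%:R) *: nu.
(** Half the side, because closed cubes of the grid share faces, whereas closed cubes of side
    [s / 2] at distinct corners are disjoint. *)
Let S kj := cbox (pc kj) (pc kj + const_mx (s / 2)).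

Let M0 : 0 < M. Proof. exact: lt_le_trans M_ge1. Qed.

Let S_Q kj x : S kj x -> Q kj.1 (x - (3 * (M * s) * kj.2%:R) *: nu).
Proof.
move=> Sx i; have := Sx i; rewrite /pc !mxE => /andP[? ?]; apply/andP; split; lra.
Qed.

Let S_disj kj kj' : kj.1 \in I -> kj'.1 \in I -> S kj `&` S kj' !=set0 -> kj = kj'.
Proof.
move=> kI k'I [x [Sx Sx']].
have h1 := height_Q kI (S_Q Sx); have h2 := height_Q k'I (S_Q Sx').
move: h1 h2; rewrite !(heightB phi nu1) => h1 h2.
have Ms0 : 0 < M * s by rewrite mulr_gt0.
have jj : kj.2 = kj'.2.
  by apply/val_inj; exact: (separated_steps Ms0 h1 h2).
have kk : kj.1 = kj'.1.
  apply/ffunP => i; apply/val_inj.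
  apply: (@separated_grid _ (p 0 i - rho + 3 * (M * s) * kj.2%:R * nu 0 i)
    (x 0 i) s _ _ s0).
    by have := Sx i; rewrite /pc !mxE => /andP[a1 a2]; apply/andP; split; lra.
  by have := Sx' i; rewrite /pc !mxE jj => /andP[a1 a2]; apply/andP; split; lra.
by move: kj kj' jj kk {kI k'I Sx Sx' h1 h2} => [k j] [k' j'] /= -> ->.
Qed.

Let J_gt : m%:R / (6 * M) < J.+1%:R.
Proof.
have -> : m%:R / (6 * M) = rho / (3 * (M * s)).
  by rewrite /s; field; rewrite !lt0r_neq0 ?ltr0n.
exact: truncnS_gt.
Qed.

Let J_le (j : 'I_J.+1) : 3 * (M * s) * j%:R <= rho.
Proof.
have c0 : 0 < 3 * (M * s) by apply: mulr_gt0 => //; exact: mulr_gt0.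
rewrite mulrC -ler_pdivlMr//.
have : j%:R <= J%:R :> R by rewrite ler_nat -ltnS ltn_ord.
have jp : 0 <= rho / (3 * (M * s)) by rewrite divr_ge0//; exact: ltW.
by move=> /le_trans; apply; rewrite truncn_le.
Qed.

(* The cubes with index in [I] meet the graph; translating them along [nu] by
   multiples of [3 M s] gives disjoint cubes, so their volumes add up. *)
Let card_I : #|I|%:R <= 6 * M * 4 ^+ n * m%:R ^+ n'.
Proof.
pose P : {set idx * 'I_J.+1} := finset.setX I [set: 'I_J.+1]%SET.
pose B := cbox (p - const_mx (2 * rho)) (p + const_mx (2 * rho)).
have vE : (s / 2) ^+ n = rho ^+ n / m%:R ^+ n.
  by rewrite -expr_div_n; congr (_ ^+ _); rewrite /s; field; rewrite lt0r_neq0 ?ltr0n.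
have := @disjoint_card_measure _ _ R (@lebesgue_rV R n) _ P S B ((s / 2) ^+ n).
have PI kj : kj \in P -> kj.1 \in I by rewrite inE => /andP[].
have h1 : forall i, i \in P -> measurable (S i : set (caratheodory_type (@lebesgue_om R n))).
  by move=> i _; exact: cara_measurable_cbox.
have h2 : forall i j, i \in P -> j \in P -> S i `&` S j !=set0 -> i = j.
  by move=> i j /PI iI /PI jI; exact: S_disj.
have h3 : forall i, i \in P -> S i `<=` B.
  move=> [k j] _ x Sx l; have := S_Q Sx l; rewrite !mxE /=.
  have := coord_le_enorm nu l; rewrite nu1.
  set t := 3 * (M * s) * _; have t0 : 0 <= t by apply: mulr_ge0 => //; apply: mulr_ge0 => //; apply: ltW; exact: mulr_gt0.
  have t1 : t <= rho := J_le j.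
  rewrite ler_norml => /andP[n1 n2] /andP[x1 x2].
  have sk : s * (k l)%:R + s <= 2 * rho.
    rewrite -[X in _ + X]mulr1 -mulrDr natr1 (_ : 2 * rho = s * m%:R).
      by rewrite ler_pM2l// ler_nat.
    by rewrite /s divfK// pnatr_eq0 -lt0n.
  have sk0 : 0 <= s * (k l)%:R by rewrite mulr_ge0// ltW.
  have tn1 : t * nu 0 l <= t by rewrite ler_piMr.
  have tn2 : - t <= t * nu 0 l by rewrite -mulrN1 ler_wpM2l.
  apply/andP; split; lra.
have h4 : measurable (B : set (caratheodory_type (@lebesgue_om R n))).
  exact: cara_measurable_cbox.
have h5 : forall i, i \in P -> (((s / 2) ^+ n)%:E <= @lebesgue_rV R n (S i))%E.
  move=> i _; rewrite [X in (_ <= X)%E]lebesgue_box; last first.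
    by move=> l; rewrite !mxE lerDl divr_ge0// ltW.
  rewrite lee_fin (eq_bigr (fun=> s / 2)) ?prodr_const ?card_ord//.
  by move=> l _; rewrite !mxE; ring.
move=> /(_ h1 h2 h3 h4 h5); rewrite [X in (_ <= X)%E]cbox_center_prod; last first.
  by rewrite mulr_ge0// ltW.
rewrite lee_fin cardsX cardsT card_ord vE => hh.
have r0 : 0 < rho ^+ n by rewrite exprn_gt0.
have mn0 : 0 < m%:R ^+ n :> R by rewrite exprn_gt0// ltr0n.
have hh2 : #|I|%:R * J.+1%:R <= 4 ^+ n * m%:R ^+ n :> R.
  rewrite -(@ler_pM2r _ (rho ^+ n / m%:R ^+ n)) ?divr_gt0// -natrM mulr_natl.
  apply: (le_trans hh).
  rewrite (_ : 2 * (2 * rho) = 4 * rho); last by ring.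
  by rewrite exprMn mulrACA divff ?mulr1 ?lt0r_neq0// mulrC.
(* The number of copies exceeds [m / (6 * M)]. This removes one factor from [m ^ n] and leaves the
   count expected of a hypersurface. *)
have hh3 : #|I|%:R * (m%:R / (6 * M)) <= 4 ^+ n * m%:R ^+ n :> R.
  by apply: le_trans hh2; rewrite ler_wpM2l// ltW// J_gt.
have M6 : 0 < 6 * M by exact: mulr_gt0.
move: hh3; rewrite mulrA ler_pdivrMr// (exprSr m%:R).
rewrite (_ : _ * (6 * M) = 6 * M * 4 ^+ n * m%:R ^+ n' * m%:R); last by ring.
by rewrite ler_pM2r ?ltr0n.
Qed.

Lemma graph_grid_le (d : R) : n%:R * s <= d ->
  (method1 (@diam_weight R n n' d) A <= (graph_const * rho ^+ n')%:E)%E.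
Proof.
move=> sd; have w0 := @diam_weight_ge0 R n n' d.
have ns0 : 0 <= n%:R * s by rewrite mulr_ge0// ltW.
apply: (@le_trans _ _ ((ball_vol R n' * (n%:R * s / 2) ^+ n') *+ #|I|)%:E).
  apply: (@method1_card_le R _ (diam_weight n' d) _ I Q) => //.
  move=> k _; rewrite /gauge; case: ifP => _.
    by rewrite lee_fin mulr_ge0 ?ball_vol_ge0// exprn_ge0// divr_ge0.
  by apply: diam_weight_le; [rewrite ns0|exact: diam_Q].
rewrite lee_fin -mulr_natl.
have -> : n%:R * s / 2 = n%:R * rho / m%:R.
  by rewrite /s; field; rewrite lt0r_neq0 ?ltr0n.
have mn0 : 0 < m%:R ^+ n' :> R by rewrite exprn_gt0// ltr0n.
rewrite expr_div_n exprMn.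
apply: (@le_trans _ _ (6 * M * 4 ^+ n * m%:R ^+ n' *
   (ball_vol R n' * (n%:R ^+ n' * rho ^+ n' / m%:R ^+ n')))).
  apply: ler_wpM2r; last exact: card_I.
  have r0 := ltW rho0.
  by rewrite mulr_ge0 ?ball_vol_ge0// divr_ge0 ?mulr_ge0 ?exprn_ge0.
rewrite le_eqVlt; apply/orP; left; apply/eqP; rewrite /graph_const.
move: (m%:R ^+ n') mn0 => u u0.
by field; rewrite lt0r_neq0.
Qed.

End grid.

Lemma graph_const_ge0 : 0 <= graph_const.
Proof.
have M0 : 0 <= M := le_trans ler01 M_ge1.
apply: mulr_ge0; last exact: exprn_ge0.
apply: mulr_ge0; last exact: ball_vol_ge0.
by apply: mulr_ge0; [exact: mulr_ge0|exact: exprn_ge0].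
Qed.

Lemma graph_hausdorff_le (p : E) (rho : R) (A : set E) : 0 < rho ->
  (forall x, A x -> h x = 0) ->
  A `<=` cbox (p - const_mx rho) (p + const_mx rho) ->
  (@hausdorff_outer R n n' A <= (graph_const * rho ^+ n')%:E)%E.
Proof.
move=> rho0 A0 Ap; apply: (@hausdorff_le_method1 R n n' A _ 1) => // d d0 _.
pose m := (Num.truncn (n%:R * (2 * rho) / d)).+1.
apply: (@graph_grid_le p rho rho0 m isT A A0 Ap).
rewrite mulrA ler_pdivrMr ?ltr0n// [leRHS]mulrC -ler_pdivrMr//.
by rewrite ltW// truncnS_gt.
Qed.

End graph_hausdorff.

(** * Real L2 spaces *)

(** Besides the Cauchy-Schwarz inequalities this yields an Euler-Lagrange equation: for [a = 0] a
    nonnegative quadratic polynomial has no linear term. *)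
Lemma quadratic_discr {R : realFieldType} (a b c : R) :
  (forall t, 0 <= a - 2 * t * b + t ^+ 2 * c) -> 0 <= c -> b ^+ 2 <= a * c.
Proof.
move=> q; rewrite le_eqVlt => /predU1P[c0|c0].
  subst c; rewrite mulr0; have [->|b0] := eqVneq b 0; first by rewrite expr0n.
  (* At this [t] the affine function takes the value -1. *)
  have := q ((a + 1) / (2 * b)); rewrite mulr0 addr0.
  have -> : 2 * ((a + 1) / (2 * b)) * b = a + 1 by field.
  lra.
have := q (b / c).
have -> : a - 2 * (b / c) * b + (b / c) ^+ 2 * c = (a * c - b ^+ 2) / c.
  by field; rewrite lt0r_neq0.
by rewrite pmulr_lge0 ?invr_gt0// subr_ge0.
Qed.

Lemma sqr_abs_le {R : realDomainType} (a b : R) : `|a| <= b -> a ^+ 2 <= b ^+ 2.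
Proof.
move=> ab; rewrite -(real_normK (num_real a)) ler_sqr ?nnegrE//.
exact: le_trans ab.
Qed.

Section real_L2.
Context d (T : measurableType d) (R : realType) (mu : {measure set T -> \bar R})
  (D : set T) (mD : measurable D).
Implicit Types f g h : T -> R.

(** Real counterpart of [inL2], for functions rather than classes. Complex functions are split into
    real and imaginary parts, and the analysis is done on these. *)
Definition l2 f := measurable_fun D f /\ (\int[mu]_(x in D) (f x ^+ 2)%:E < +oo)%E.

Definition ip f g : R := \int[mu]_(x in D) (f x * g x).

Lemma measurable_sqrE f : measurable_fun D f -> measurable_fun D (fun x => (f x ^+ 2)%:E).
Proof. by move=> mf; apply/measurable_EFinP; exact: measurable_funX. Qed.

Lemma integral_sqrZ f (k : R) : measurable_fun D f -> 0 <= k ->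
  (\int[mu]_(x in D) (k%:E * (f x ^+ 2)%:E) =
    k%:E * \int[mu]_(x in D) (f x ^+ 2)%:E)%E.
Proof.
move=> mf k0; apply: ge0_integralZl => //; first exact: measurable_sqrE.
by move=> x _; rewrite lee_fin sqr_ge0.
Qed.

Lemma l2_integrable f g : l2 f -> l2 g -> mu.-integrable D (EFin \o (fun x => f x * g x)).
Proof.
move=> [mf f2] [mg g2]; apply/integrableP; split.
  by apply/measurable_EFinP; exact: measurable_funM.
apply: (@le_lt_trans _ _ (\int[mu]_(x in D) ((f x ^+ 2)%:E + (g x ^+ 2)%:E))%E).
  apply: ge0_le_integral => //.
  - by apply/measurableT_comp => //; apply/measurable_EFinP; exact: measurable_funM.
  - by apply: emeasurable_funD; exact: measurable_sqrE.
  - move=> x _; rewrite /= lee_fin ler_norml; apply/andP; split.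
      by have := sqr_ge0 (f x + g x); have := sqr_ge0 (f x); have := sqr_ge0 (g x); lra.
    by have := sqr_ge0 (f x - g x); have := sqr_ge0 (f x); have := sqr_ge0 (g x); lra.
rewrite ge0_integralD//; try exact: measurable_sqrE.
- exact: lte_add_pinfty.
- by move=> x _; rewrite lee_fin sqr_ge0.
- by move=> x _; rewrite lee_fin sqr_ge0.
Qed.

Lemma ip_sqE f : l2 f -> (\int[mu]_(x in D) (f x ^+ 2)%:E = (ip f f)%:E)%E.
Proof.
move=> [mf f2]; rewrite /ip /Rintegral fineK.
  by apply: eq_integral => x _; rewrite expr2.
rewrite ge0_fin_numE; last by apply: integral_ge0 => x _; rewrite lee_fin -expr2 sqr_ge0.
by under eq_integral do rewrite -expr2.
Qed.

Lemma ip_ge0 f : 0 <= ip f f.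
Proof. by apply: Rintegral_ge0 => x _; rewrite -expr2 sqr_ge0. Qed.

Lemma ipC f g : ip f g = ip g f.
Proof. by rewrite /ip; congr fine; apply: eq_integral => x _; rewrite mulrC. Qed.

Lemma eq_ip f g f' g' : (forall x, D x -> f x = f' x) -> (forall x, D x -> g x = g' x) ->
  ip f g = ip f' g'.
Proof.
move=> ff gg; rewrite /ip; congr fine; apply: eq_integral => x.
by rewrite inE => Dx; rewrite ff// gg.
Qed.

Lemma l2_le f g (c : R) : measurable_fun D f -> l2 g ->
  (forall x, D x -> `|f x| <= c * `|g x|) -> l2 f.
Proof.
move=> mf [mg g2] fg; split=> //.
apply: (@le_lt_trans _ _ (\int[mu]_(x in D) ((c ^+ 2)%:E * (g x ^+ 2)%:E))%E).
  apply: ge0_le_integral => //.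
  - by move=> x _; rewrite lee_fin sqr_ge0.
  - exact: measurable_sqrE.
  - by apply: measurable_funeM; exact: measurable_sqrE.
  - move=> x Dx; rewrite -EFinM lee_fin -(real_normK (num_real (g x))) -exprMn.
    by apply: sqr_abs_le; exact: fg.
by rewrite integral_sqrZ ?sqr_ge0// lte_mul_pinfty// lee_fin sqr_ge0.
Qed.

Lemma l2Z f (c : R) : l2 f -> l2 (fun x => c * f x).
Proof.
move=> lf; apply: (l2_le (c := `|c|) _ lf) => [|x _]; last by rewrite normrM.
by apply: measurable_funM => //; exact: lf.1.
Qed.

Lemma l2M h f (c : R) : measurable_fun D h -> (forall x, D x -> `|h x| <= c) ->
  l2 f -> l2 (fun x => h x * f x).
Proof.
move=> mh hc lf; apply: (l2_le (c := c) _ lf) => [|x Dx].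
  by apply: measurable_funM => //; exact: lf.1.
by rewrite normrM ler_wpM2r// hc.
Qed.

Lemma l2D f g : l2 f -> l2 g -> l2 (fun x => f x + g x).
Proof.
move=> [mf f2] [mg g2]; split; first exact: measurable_funD.
apply: (@le_lt_trans _ _ (\int[mu]_(x in D) (2%:E * ((f x ^+ 2)%:E + (g x ^+ 2)%:E)))%E).
  apply: ge0_le_integral => //.
  - by move=> x _; rewrite lee_fin sqr_ge0.
  - by apply: measurable_sqrE; exact: measurable_funD.
  - by apply: measurable_funeM; apply: emeasurable_funD; exact: measurable_sqrE.
  - by move=> x _; rewrite -EFinD -EFinM lee_fin; have := sqr_ge0 (f x - g x); lra.
rewrite ge0_integralZl//; last 2 first.
- by apply: emeasurable_funD; exact: measurable_sqrE.
- by move=> x _; rewrite -EFinD lee_fin addr_ge0// sqr_ge0.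
rewrite ge0_integralD//; try exact: measurable_sqrE.
- by rewrite lte_mul_pinfty// lte_add_pinfty.
- by move=> x _; rewrite lee_fin sqr_ge0.
- by move=> x _; rewrite lee_fin sqr_ge0.
Qed.

Lemma l2N f : l2 f -> l2 (fun x => - f x).
Proof.
move=> lf; rewrite (_ : (fun x => - f x) = fun x => -1 * f x); first exact: l2Z.
by apply/funext => x; rewrite mulN1r.
Qed.

Lemma l2B f g : l2 f -> l2 g -> l2 (fun x => f x - g x).
Proof. by move=> lf lg; apply: l2D => //; exact: l2N. Qed.

Lemma l2_0 : l2 (fun=> 0).
Proof. by split=> //; under eq_integral do rewrite expr0n; rewrite integral0 ltry. Qed.

Lemma l2_sum (I : Type) (s : seq I) (F : I -> T -> R) :
  (forall i, l2 (F i)) -> l2 (fun x => \sum_(i <- s) F i x).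
Proof.
move=> lF; elim: s => [|i s IH].
  by rewrite (_ : (fun _ => _) = fun=> 0); [exact: l2_0|apply/funext => x; rewrite big_nil].
rewrite (_ : (fun _ => _) = fun x => F i x + \sum_(j <- s) F j x); first exact: l2D.
by apply/funext => x; rewrite big_cons.
Qed.

Lemma ipDl f g h : l2 f -> l2 g -> l2 h -> ip (fun x => f x + g x) h = ip f h + ip g h.
Proof.
move=> lf lg lh; rewrite /ip -RintegralD//; try exact: l2_integrable.
by congr fine; apply: eq_integral => x _; rewrite mulrDl.
Qed.

Lemma ipZl (c : R) f h : l2 f -> l2 h -> ip (fun x => c * f x) h = c * ip f h.
Proof.
move=> lf lh; rewrite /ip -RintegralZl//; last exact: l2_integrable.
by congr fine; apply: eq_integral => x _; rewrite mulrA.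
Qed.

Lemma ipBl f g h : l2 f -> l2 g -> l2 h -> ip (fun x => f x - g x) h = ip f h - ip g h.
Proof.
move=> lf lg lh; rewrite -[- ip g h]mulN1r -ipZl// -ipDl//; last exact: l2Z.
by apply: eq_ip => // x _; rewrite mulN1r.
Qed.

Lemma ipDr f g h : l2 f -> l2 g -> l2 h -> ip h (fun x => f x + g x) = ip h f + ip h g.
Proof. by move=> *; rewrite ipC ipDl// !(ipC h). Qed.

Lemma ipBr f g h : l2 f -> l2 g -> l2 h -> ip h (fun x => f x - g x) = ip h f - ip h g.
Proof. by move=> *; rewrite ipC ipBl// !(ipC h). Qed.

Lemma ipZr (c : R) f h : l2 f -> l2 h -> ip h (fun x => c * f x) = c * ip h f.
Proof. by move=> *; rewrite ipC ipZl// (ipC h). Qed.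

Lemma ip0l h : ip (fun=> 0) h = 0.
Proof.
by rewrite /ip /Rintegral; under eq_integral do rewrite mul0r; rewrite integral0.
Qed.

Lemma ip_suml (I : Type) (s : seq I) (F : I -> T -> R) h : (forall i, l2 (F i)) -> l2 h ->
  ip (fun x => \sum_(i <- s) F i x) h = \sum_(i <- s) ip (F i) h.
Proof.
move=> lF lh; elim: s => [|i s IH].
  transitivity (ip (fun=> 0) h); last by rewrite ip0l big_nil.
  by apply: eq_ip => // x _; rewrite big_nil.
rewrite big_cons -IH -ipDl//; last exact: l2_sum.
by apply: eq_ip => // x _; rewrite big_cons.
Qed.

Lemma ip_sqD f g : l2 f -> l2 g -> ip (fun x => f x + g x) (fun x => f x + g x) =
  ip f f + 2 * ip f g + ip g g.
Proof.
move=> lf lg; have lfg := l2D lf lg.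
rewrite ipDl// !ipDr// (ipC g f); ring.
Qed.

Lemma ip_sqB f g : l2 f -> l2 g -> ip (fun x => f x - g x) (fun x => f x - g x) =
  ip f f - 2 * ip f g + ip g g.
Proof.
move=> lf lg; have lfg := l2B lf lg.
rewrite ipBl// !ipBr// (ipC g f); ring.
Qed.

Lemma ip_sqD_le f g : l2 f -> l2 g -> ip (fun x => f x + g x) (fun x => f x + g x) <=
  2 * ip f f + 2 * ip g g.
Proof.
move=> lf lg; have := ip_ge0 (fun x => f x - g x); rewrite ip_sqB// ip_sqD//; lra.
Qed.

Lemma ip_sqB_le f g : l2 f -> l2 g -> ip (fun x => f x - g x) (fun x => f x - g x) <=
  2 * ip f f + 2 * ip g g.
Proof.
move=> lf lg; have := ip_ge0 (fun x => f x + g x); rewrite ip_sqB// ip_sqD//; lra.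
Qed.

Lemma ip_CS f g : l2 f -> l2 g -> ip f g ^+ 2 <= ip f f * ip g g.
Proof.
move=> lf lg; have q t : 0 <= ip f f - 2 * t * ip f g + t ^+ 2 * ip g g.
  have := ip_ge0 (fun x => f x - t * g x); rewrite ip_sqB//; last exact: l2Z.
  by rewrite ipZr// ipZr// ?ipZl//; [lra|exact: l2Z].
exact: quadratic_discr (ip_ge0 _).
Qed.

Lemma abs_ip_le f g : l2 f -> l2 g ->
  `|ip f g| <= Num.sqrt (ip f f) * Num.sqrt (ip g g).
Proof.
move=> lf lg; rewrite -sqrtrM ?ip_ge0// -sqrtr_sqr ler_wsqrtr//.
exact: ip_CS.
Qed.

Lemma ip_le f g (c : R) : 0 <= c -> l2 f -> l2 g -> (forall x, D x -> `|f x| <= c * `|g x|) ->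
  ip f f <= c ^+ 2 * ip g g.
Proof.
move=> c0 lf lg fg; rewrite -ipZl// (_ : ip (fun x => _ * g x) g =
   ip (fun x => c * g x) (fun x => c * g x)).
  apply: le_Rintegral => //; try exact: l2_integrable.
    by apply: l2_integrable; exact: l2Z.
  move=> x Dx; rewrite -!expr2 -(real_normK (num_real (c * _))) normrM (ger0_norm c0).
  by apply: sqr_abs_le; exact: fg.
rewrite ipZl// ipZl// ?ipZr//; last exact: l2Z.
by rewrite mulrA expr2.
Qed.

Definition l2cvg (u : nat -> T -> R) f :=
  ip (fun x => u k x - f x) (fun x => u k x - f x) @[k --> \oo] --> (0 : R).

End real_L2.

Lemma geometric_steps_cvg {R : realType} (v : nat -> R) (C : R) :
  (forall j, `|v j.+1 - v j| <= C / 2 ^+ j) -> cvgn (v : R^o^nat).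
Proof.
move=> vC.
have C0 : 0 <= C by have := vC 0%N; rewrite expr0 divr1; exact: le_trans.
have cs : cvgn (series (fun j => v j.+1 - v j)).
  apply: normed_cvg; apply: (@series_le_cvg _ _ (geometric C (1 / 2))) => //=.
  - by move=> j; rewrite mulr_ge0// exprn_ge0.
  - by move=> j; rewrite (le_trans (vC j))// expr_div_n expr1n div1r.
  - by apply: is_cvg_geometric_series; rewrite ger0_norm//; lra.
have -> : v = (fun j => v 0%N + series (fun j => v j.+1 - v j) j).
  apply/funext => j; rewrite seriesEnat /=; elim: j => [|j IH].
    by rewrite big_geq// addr0.
  by rewrite big_nat_recr//= addrA -IH; ring.
by apply: is_cvgD => //; exact: is_cvg_cst.
Qed.

Lemma ae_nneseries_fin d (T : measurableType d) (R : realType) (mu : {measure set T -> \bar R})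
    (D : set T) (mD : measurable D) (u : nat -> T -> \bar R) :
  (forall k, measurable_fun D (u k)) -> (forall k x, D x -> (0 <= u k x)%E) ->
  (\sum_(k <oo) \int[mu]_(x in D) u k x < +oo)%E ->
  {ae mu, forall x, D x -> (\sum_(k <oo) u k x)%E \is a fin_num}.
Proof.
move=> mu_ u0 fin; apply: (integrable_ae mD); apply/integrableP; split.
  by apply: (@ge0_emeasurable_sum _ _ _ _ u xpredT) => [k x Dx _|k _]; [exact: u0|exact: mu_].
have -> : (\int[mu]_(x in D) `|\sum_(k <oo) u k x| = \int[mu]_(x in D) \sum_(k <oo) u k x)%E.
  apply: eq_integral => x; rewrite inE => Dx.
  by rewrite gee0_abs//; apply: nneseries_ge0 => k _ _; exact: u0.
by rewrite integral_nneseries.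
Qed.

(** * Completeness of L2 *)

Section L2_complete.
Context d (T : measurableType d) (R : realType) (mu : {measure set T -> \bar R})
  (D : set T) (mD : measurable D).
Local Notation l2 := (l2 mu D).
Local Notation ip := (ip mu D).

(** Weighted by [4 ^ j], the squared steps have integrals at most [2 ^ - j]. Hence the weighted sum
    [S] is finite almost everywhere, and there the [j]-th step is at most [sqrt S / 2 ^ j]. *)
Lemma fast_cauchy_ae_cvg (v : nat -> T -> R) : (forall j, l2 (v j)) ->
  (forall j, ip (fun x => v j.+1 x - v j x) (fun x => v j.+1 x - v j x) <= 8^-1 ^+ j) ->
  {ae mu, forall x, D x -> cvgn (fun j => v j x : R^o)}.
Proof.
move=> lv vC.
pose w j x := v j.+1 x - v j x.
have lw j : l2 (w j) by exact: l2B.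
have w0 j x : D x -> (0 <= (4 ^+ j)%:E * (w j x ^+ 2)%:E)%E.
  by move=> _; rewrite -EFinM lee_fin mulr_ge0 ?sqr_ge0// exprn_ge0.
have mw j : measurable_fun D (fun x => (4 ^+ j)%:E * (w j x ^+ 2)%:E)%E.
  by apply: measurable_funeM; apply: measurable_sqrE; exact: (lw j).1.
pose S x := (\sum_(j <oo) (4 ^+ j)%:E * (w j x ^+ 2)%:E)%E.
have /(ae_nneseries_fin mD mw w0) : (\sum_(j <oo)
    \int[mu]_(x in D) ((4 ^+ j)%:E * (w j x ^+ 2)%:E) < +oo)%E.
  apply: (@le_lt_trans _ _ (\sum_(j <oo) (2 / (2 ^ (j + 0.+1))%:R)%:E)%E).
    apply: lee_nneseries => [j _ _|j _]; first by apply: integral_ge0 => x; exact: w0.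
    rewrite integral_sqrZ ?exprn_ge0//; last exact: (lw j).1.
    rewrite ip_sqE// -EFinM lee_fin.
    apply: (@le_trans _ _ (4 ^+ j * 8^-1 ^+ j)); first by rewrite ler_pM2l ?exprn_gt0//; exact: vC.
    rewrite -exprMn (_ : 4 / 8 = 2^-1); last by lra.
    by rewrite addn1 natrX exprS invfM mulrA divff// mul1r exprVn.
  by rewrite (cvg_lim _ (@cvg_geometric_eseries_half R 2 0))// ltry.
apply: filterS => x hx Dx; have Sfin : S x \is a fin_num := hx Dx.
apply: (@geometric_steps_cvg _ _ (Num.sqrt (fine (S x)))) => j.
rewrite ler_pdivlMr ?exprn_gt0// -[leLHS]ger0_norm ?mulr_ge0 ?exprn_ge0//.
rewrite -sqrtr_sqr ler_wsqrtr// -lee_fin fineK//.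
have -> : (`|v j.+1 x - v j x| * 2 ^+ j) ^+ 2 = 4 ^+ j * w j x ^+ 2.
  rewrite exprMn (real_normK (num_real _)) -exprM mulnC exprM mulrC.
  by congr (_ ^+ _ * _); ring.
rewrite EFinM.
apply: le_trans (nneseries_lim_ge j.+1 (fun i _ _ => w0 i x Dx)).
by rewrite big_nat_recr//= leeDr// sume_ge0// => i _; exact: w0.
Qed.

(** Riesz-Fischer: the limit is taken pointwise along a fast subsequence, and Fatou's lemma turns
    the Cauchy bound into a bound on the distance to this limit. *)
Lemma L2_complete (u : nat -> T -> R) : (forall k, l2 (u k)) ->
  (forall e : R, 0 < e -> exists N, forall k l, (N <= k)%N -> (N <= l)%N ->
    ip (fun x => u k x - u l x) (fun x => u k x - u l x) <= e) ->
  exists f, l2 f /\ l2cvg mu D u f.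
Proof.
move=> lu uC.
have /choice[M hM] : forall j : nat, exists N, forall k l, (N <= k)%N -> (N <= l)%N ->
    ip (fun x => u k x - u l x) (fun x => u k x - u l x) <= 8^-1 ^+ j.
  by move=> j; apply: uC; rewrite exprn_gt0// invr_gt0.
pose m j := (\sum_(i < j.+1) M i + j)%N.
have mM j : (M j <= m j)%N by rewrite /m big_ord_recr/= -addnA addnCA leq_addr.
have mj j : (j <= m j)%N by rewrite leq_addl.
have mS j : (m j <= m j.+1)%N by rewrite /m [in leqRHS]big_ord_recr/= -addnA leq_add// addnS ltnW// ltnS leq_addl.
pose v j := u (m j).
have cvgv := @fast_cauchy_ae_cvg v (fun j => lu (m j))
  (fun j => hM j _ _ (leq_trans (mM j) (mS j)) (mM j)).
(* The upper limit is measurable without any reference to the set of convergence; it is the true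
   limit almost everywhere. *)
pose f x : R := fine (limn_esup (fun j => (v j x)%:E)).
have mv j : measurable_fun D (fun x => (v j x)%:E).
  by apply/measurable_EFinP; exact: (lu _).1.
have mf : measurable_fun D f.
  by apply: (measurableT_comp (fine_measurable measurableT)); exact: measurable_fun_limn_esup.
have key N k (e : R) : (forall l, (N <= l)%N ->
    ip (fun x => u k x - u l x) (fun x => u k x - u l x) <= e) ->
    (\int[mu]_(x in D) ((u k x - f x) ^+ 2)%:E <= e%:E)%E.
  move=> kN; pose g j x := ((u k x - v j x) ^+ 2)%:E.
  have mg j : measurable_fun D (g j).
    by apply: measurable_sqrE; apply: measurable_funB; exact: (lu _).1.
  have g0 j x : D x -> (0 <= g j x)%E by move=> _; rewrite lee_fin sqr_ge0.
  apply: (@le_trans _ _ (\int[mu]_(x in D) limn_einf (g^~ x))%E).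
    apply: ae_ge0_le_integral => //.
    - by move=> x _; rewrite lee_fin sqr_ge0.
    - by apply: measurable_sqrE; apply: measurable_funB => //; exact: (lu _).1.
    - move=> x Dx; rewrite limn_einf_lim; apply: lime_ge; first exact: is_cvg_einfs.
      by apply: nearW => j; apply: le_ereal_inf_tmp => _ [i _ <-]; exact: g0.
    - rewrite (_ : (fun x => limn_einf _) =
          (fun x => - limn_esup (fun j => - g j x))%E); last first.
        by apply/funext => x; rewrite -limn_einfN; congr limn_einf;
          apply/funext => j; rewrite /comp oppeK.
      by apply: measurableT_comp => //; apply: measurable_fun_limn_esup => j;
        exact: measurableT_comp.
    - case: cvgv => A [mA A0 hA]; exists A; split=> // x nx; apply: hA => hx.
      apply: nx => Dx; have /cvg_ex[/= l cl] := hx Dx.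
      have el : (fun j => (v j x)%:E) @ \oo --> l%:E by apply: cvg_EFin => //; exact: nearW.
      rewrite /f (cvg_limn_einf_sup el).2 /= (_ : limn_einf _ = ((u k x - l) ^+ 2)%:E)//.
      have gl : (fun j => g j x) @ \oo --> ((u k x - l) ^+ 2)%:E.
        apply: cvg_EFin; first exact: nearW.
        have cs : (u k x - v j x : R^o) @[j --> \oo] --> (u k x - l : R^o).
          by apply: cvgB => //; exact: cvg_cst.
        rewrite (_ : fine \o _ = (fun j => (u k x - v j x) * (u k x - v j x) : R^o)).
          by rewrite expr2; exact: cvgM.
        by apply/funext => j; rewrite /= expr2.
      by rewrite (cvg_limn_einf_sup gl).1.
  apply: le_trans (fatou mu mD mg g0) _.
  rewrite limn_einf_lim; apply: lime_le; first exact: is_cvg_einfs.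
  apply: nearW => j; pose i := maxn j N.
  apply: (@le_trans _ _ (\int[mu]_(x in D) g i x)%E).
    by apply: ereal_inf_lbound; exists i => //=; rewrite leq_maxl.
  rewrite /g ip_sqE//; last exact: (l2B mD (lu _) (lu _)).
  by rewrite lee_fin kN// (leq_trans _ (mj i))// leq_maxr.
have lf : l2 f.
  have [N hN] := uC 1 ltr01; have := key N N 1 (fun l Nl => hN N l (leqnn _) Nl).
  move=> h; have luf : l2 (fun x => u N x - f x).
    split; last by apply: le_lt_trans h _; rewrite ltry.
    by apply: measurable_funB => //; exact: (lu _).1.
  rewrite (_ : f = fun x => u N x - (u N x - f x)); first exact: l2B.
  by apply/funext => x; ring.
exists f; split=> //; apply/cvgrPdist_le => e e0; have [N hN] := uC e e0.
exists N => // k /= Nk; rewrite sub0r normrN ger0_norm ?ip_ge0//.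
rewrite -lee_fin -ip_sqE//; last exact: l2B.
by apply: (@key N) => l Nl; exact: hN.
Qed.

End L2_complete.

(** * Smooth functions *)

Section directional_derivatives.
Context {R : realType} {V : normedModType R}.
Implicit Types (f g : V -> R) (x v : V).

(** Restriction to a line reduces directional derivatives to functions of one variable, for which
    the chain rule is available. *)
Lemma is_derive_line f x v d :
  is_derive x v f d <-> is_derive (0 : R) (1 : R) (fun t : R => f (t *: v + x)) d.
Proof.
have E : (fun h : R => h^-1 *: ((f \o shift x) (h *: v) - f x)) =
    (fun h : R => h^-1 *: (((fun t : R => f (t *: v + x)) \o shift 0) (h *: (1 : R)) -
      (fun t : R => f (t *: v + x)) 0)).
  apply/funext => h; rewrite /= addr0 scale0r add0r; congr (_ *: (f (_ *: _ + _) - _)).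
  by rewrite /GRing.scale/= mulr1.
split=> -[df vf]; split.
- by rewrite /derivable -E.
- by rewrite /derive -E.
- by rewrite /derivable E.
- by rewrite /derive E.
Qed.

Lemma is_derive_comp (theta : R -> R) f x v dtheta df :
  is_derive (f x) 1 theta dtheta -> is_derive x v f df ->
  is_derive x v (fun y => theta (f y)) (dtheta * df).
Proof.
move=> dt /is_derive_line df'; apply/is_derive_line.
apply: (@is_derive1_comp R theta (fun t => f (t *: v + x)) 0 dtheta df) => //.
by rewrite scale0r add0r.
Qed.

Lemma is_derive_mul f g x v df dg : is_derive x v f df -> is_derive x v g dg ->
  is_derive x v (fun y => f y * g y) (df * g x + f x * dg).
Proof.
move=> hf hg; have := is_deriveM hf hg; congr is_derive.
by rewrite /GRing.scale /= addrC [X in X + _]mulrC.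
Qed.

Lemma is_derive_add f g x v df dg : is_derive x v f df -> is_derive x v g dg ->
  is_derive x v (fun y => f y + g y) (df + dg).
Proof. exact: is_deriveD. Qed.

Lemma is_derive_inv f x v df : f x != 0 -> is_derive x v f df ->
  is_derive x v (fun y => (f y)^-1) (- (f x)^-1 ^+ 2 * df).
Proof.
move=> fx hf; apply: (@is_derive_comp (fun y => y^-1)) => //.
have := @is_deriveV R id (f x) 1 1 fx (is_derive_id _ _); congr is_derive.
by rewrite /GRing.scale /= mulr1 exprVn.
Qed.

Lemma is_derive_pow f x v df k : is_derive x v f df ->
  is_derive x v (fun y => f y ^+ k) (k%:R * f x ^+ k.-1 * df).
Proof.
move=> hf; elim: k => [|k IH].
  rewrite !mul0r (_ : (fun _ => _) = cst 1); first exact: is_derive_cst.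
  by apply/funext => y; rewrite expr0.
have := is_derive_mul hf IH; congr is_derive; first by apply/funext => y; rewrite exprS.
by case: (k) => [|m] /=; rewrite ?exprS -?natr1; ring.
Qed.

End directional_derivatives.

Section smooth_functions.
Context {R : realType} {n : nat}.
Local Notation E := 'rV[R]_n.
Implicit Types h f g : E -> R.
Local Notation dx i := (delta_mx 0 i : E).

(** [smooth] speaks of iterated values of [partial], which are awkward to compute. Here some
    formulas for the first derivatives suffice, provided that they are again of class [Ck], so
    closure under products, inverses and compositions goes by induction on [k]. *)
Fixpoint Ck (k : nat) h : Prop := match k with
  | 0%N => continuous h
  | k'.+1 => continuous h /\ exists dh : 'I_n -> E -> R,
      (forall x i, is_derive x (dx i) h (dh i x)) /\ forall i, Ck k' (dh i)
  end.

Lemma CkW k h : Ck k.+1 h -> Ck k h.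
Proof.
elim: k h => [|k IH] h [ch [dh [hdh cdh]]] //; split=> //.
by exists dh; split=> // i; exact: IH.
Qed.

Lemma is_derive_partial h i x d : is_derive x (dx i) h d -> partial i h x = d.
Proof. by move=> [_ <-]. Qed.

Lemma Ck_partial k h i : Ck k.+1 h -> Ck k (partial i h).
Proof.
move=> [_ [dh [hdh cdh]]]; rewrite (_ : partial i h = dh i); first exact: cdh.
by apply/funext => x; exact: is_derive_partial.
Qed.

Lemma Ck_smooth h : (forall k, Ck k h) -> smooth h.
Proof.
move=> ch s; have hs : forall k, Ck k (foldr partial h s).
  elim: s => [|i s IH] //= k; exact: Ck_partial.
split; first exact: (hs 0%N).
move=> x i; have [_ [dh [hdh _]]] := hs 1%N.
by have [] := hdh x i.
Qed.

Lemma smooth_partial h i : smooth h -> smooth (partial i h).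
Proof. by move=> sh s; rewrite -foldr_rcons; exact: sh. Qed.

Lemma smooth_is_derive h x i : smooth h -> is_derive x (dx i) h (partial i h x).
Proof. by move=> sh; apply: derivableP; exact: (sh [::]).2. Qed.

Lemma smooth_continuous h : smooth h -> continuous h.
Proof. by move=> sh; exact: (sh [::]).1. Qed.

Lemma smooth_Ck k h : smooth h -> Ck k h.
Proof.
elim: k h => [|k IH] h sh; first exact: smooth_continuous.
split; first exact: smooth_continuous.
exists (fun i => partial i h); split; first by move=> x i; exact: smooth_is_derive.
by move=> i; apply: IH; exact: smooth_partial.
Qed.

Lemma Ck_cst k (c : R) : Ck k (fun=> c).
Proof.
elim: k c => [|k IH] c; first exact: cst_continuous.
split; first exact: cst_continuous.
by exists (fun _ _ => 0); split=> [x i|i]; [exact: is_derive_cst|exact: IH].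
Qed.

Lemma Ck_add k f g : Ck k f -> Ck k g -> Ck k (fun x => f x + g x).
Proof.
elim: k f g => [|k IH] f g; first by move=> cf cg x; exact: (continuousD (cf x) (cg x)).
move=> [cf [df [hf cdf]]] [cg [dg [hg cdg]]]; split.
  by move=> x; exact: (continuousD (cf x) (cg x)).
exists (fun i x => df i x + dg i x); split; last by move=> i; apply: IH; [exact: cdf|exact: cdg].
by move=> x i; exact: is_derive_add.
Qed.

Lemma Ck_mul k f g : Ck k f -> Ck k g -> Ck k (fun x => f x * g x).
Proof.
elim: k f g => [|k IH] f g; first by move=> cf cg x; exact: (continuousM (cf x) (cg x)).
move=> cfk cgk; have [cf [df [hf cdf]]] := cfk; have [cg [dg [hg cdg]]] := cgk; split.
  by move=> x; exact: (continuousM (cf x) (cg x)).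
exists (fun i x => df i x * g x + f x * dg i x); split.
  by move=> x i; exact: is_derive_mul.
by move=> i; apply: Ck_add; apply: IH; first [exact: cdf|exact: cdg|exact: CkW].
Qed.

Lemma Ck_inv k f : (forall x, 0 < f x) -> Ck k f -> Ck k (fun x => (f x)^-1).
Proof.
move=> f0; have ci : continuous f -> continuous (fun x => (f x)^-1).
  by move=> cf x; apply: (@continuousV _ _ f x _ (cf x)); exact: lt0r_neq0.
elim: k => [|k IH] cfk; first exact: ci.
have [cf [df [hf cdf]]] := cfk; split; first exact: ci.
exists (fun i x => - (f x)^-1 ^+ 2 * df i x); split.
  by move=> x i; apply: is_derive_inv => //; exact: lt0r_neq0.
have cv := IH (CkW cfk).
move=> i; rewrite (_ : (fun _ => _) = fun x => (-1 * ((f x)^-1 * (f x)^-1)) * df i x).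
  by apply: Ck_mul; [apply: Ck_mul; [exact: Ck_cst|exact: Ck_mul]|exact: cdf].
by apply/funext => x; rewrite mulN1r expr2.
Qed.

Lemma Ck_expR k f : Ck k f -> Ck k (fun x => expR (f x)).
Proof.
have ce : continuous f -> continuous (fun x => expR (f x)).
  by move=> cf x; apply: (@cvg_comp _ _ _ f expR _ (nbhs (f x))); [exact: cf|exact: continuous_expR].
elim: k => [|k IH] cfk; first exact: ce.
have [cf [df [hf cdf]]] := cfk; split; first exact: ce.
exists (fun i x => expR (f x) * df i x); split.
  by move=> x i; apply: is_derive_comp.
by move=> i; apply: Ck_mul; [exact: IH (CkW cfk)|exact: cdf].
Qed.

Lemma Ck_ln k f : (forall x, 0 < f x) -> Ck k f -> Ck k (fun x => ln (f x)).
Proof.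
move=> f0; have ce : continuous f -> continuous (fun x => ln (f x)).
  move=> cf x; apply: (@cvg_comp _ _ _ f (@ln R) _ (nbhs (f x))); first exact: cf.
  exact: continuous_ln.
case: k => [|k] cfk; first exact: ce.
have [cf [df [hf cdf]]] := cfk; split; first exact: ce.
exists (fun i x => (f x)^-1 * df i x); split.
  by move=> x i; apply: is_derive_comp => //; exact: is_derive1_ln.
by move=> i; apply: Ck_mul; [apply: Ck_inv => //; exact: CkW|exact: cdf].
Qed.

Lemma is_derive_coord (j i : 'I_n) (x : E) :
  is_derive x (dx i) (fun y : E => y 0 j) (i == j)%:R.
Proof.
apply/is_derive_line.
have -> : (fun t : R => (t *: dx i + x) 0 j) = (fun t => (i == j)%:R * t + x 0 j).
  by apply/funext => t; rewrite !mxE eqxx /= eq_sym mulrC.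
set c : R := (i == j)%:R.
have h1 : is_derive (0 : R) (1 : R) (fun t : R => c * t) c.
  have := @is_derive_mul R R (cst c) id 0 1 0 1 (is_derive_cst _ _ _) (is_derive_id _ _).
  by rewrite mul0r add0r mulr1.
have h2 := is_derive_add h1 (is_derive_cst (x 0 j) (0 : R) (1 : R)).
by move: h2; rewrite addr0.
Qed.

Lemma Ck_coord k (j : 'I_n) : Ck k (fun x : E => x 0 j).
Proof.
have cc : continuous (fun x : E => x 0 j) by exact: coord_continuous.
case: k => [|k] //; split=> //.
exists (fun i _ => (i == j)%:R); split; last by move=> i; exact: Ck_cst.
by move=> x i; exact: is_derive_coord.
Qed.

Lemma Ck_sum k (I : Type) (s : seq I) (F : I -> E -> R) : (forall i, Ck k (F i)) ->
  Ck k (fun x => \sum_(i <- s) F i x).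
Proof.
move=> cF; elim: s => [|i s IH].
  rewrite (_ : (fun _ => _) = fun=> 0); first exact: Ck_cst.
  by apply/funext => x; rewrite big_nil.
rewrite (_ : (fun _ => _) = fun x => F i x + \sum_(j <- s) F j x); first exact: Ck_add.
by apply/funext => x; rewrite big_cons.
Qed.

End smooth_functions.

Section flat_function.
Context {R : realType}.

(* The smooth functions t^-k exp(-1/t), extended by 0 to t <= 0; they are closed
   under differentiation. *)
Definition flat (k : nat) (t : R) : R := if 0 < t then t^-1 ^+ k * expR (- t^-1) else 0.

Lemma flat_ge0 k t : 0 <= flat k t.
Proof.
rewrite /flat; case: ifPn => // t0.
by rewrite mulr_ge0 ?expR_ge0// exprn_ge0// invr_ge0 ltW.
Qed.

(** The Taylor term of order [k + 2] of [exp (1 / t)] beats [t ^ - k] by [t ^ 2]; hence the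
    difference quotients at 0 tend to 0. *)
Lemma flat_le k t : 0 < t -> flat k t <= (k.+2)`!%:R * t ^+ 2.
Proof.
move=> t0; rewrite /flat t0 expRN.
have ti : 0 < t^-1 by rewrite invr_gt0.
have := @expR_ge1Dxn R t^-1 k.+1 (ltW ti).
set F := (k.+2)`!%:R => h; have F0 : 0 < F :> R by rewrite ltr0n fact_gt0.
rewrite ler_pdivrMr ?expR_gt0//.
apply: (@le_trans _ _ (F * t ^+ 2 * (t^-1 ^+ k.+2 / F))); last first.
  rewrite ler_pM2l ?mulr_gt0 ?exprn_gt0// (le_trans _ h)// lerDr//.
rewrite (_ : F * _ * _ = t ^+ 2 * t^-1 ^+ k.+2); last by field; exact: lt0r_neq0.
rewrite -[k.+2]addn2 exprD mulrCA -exprMn divff ?expr1n ?mulr1//; exact: lt0r_neq0.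
Qed.

Lemma flat_derive k (t : R) : is_derive t (1 : R) (flat k) (flat k.+2 t - k%:R * flat k.+1 t).
Proof.
have [t0|t0|->] := ltgtP t 0.
- rewrite /flat !ltNge (ltW t0) /= mulr0 subr0.
  apply: (@near_eq_is_derive _ _ _ (cst 0)).
  near=> y; rewrite ifF//; apply/negbTE; rewrite -leNgt ltW//; near: y.
  exact: lt_nbhsl.
- suff h : is_derive t (1 : R) (fun y : R => y^-1 ^+ k * expR (- y^-1))
      (flat k.+2 t - k%:R * flat k.+1 t).
    apply: near_eq_is_derive h.
    by near=> y; rewrite /flat ifT//; near: y; exact: lt_nbhsr.
  rewrite /flat t0.
  have tn0 : t != 0 by rewrite gt_eqF.
  have di : is_derive t 1 (fun y : R => y^-1) (- t^-1 ^+ 2).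
    have := is_derive_inv tn0 (is_derive_id t (1 : R)); by rewrite mulr1.
  have dX : is_derive t 1 (fun y : R => y^-1 ^+ k) (k%:R * t^-1 ^+ k.-1 * - t^-1 ^+ 2).
    exact: is_derive_pow.
  have dN : is_derive t 1 (fun y : R => - y^-1) (t^-1 ^+ 2).
    by have := is_deriveN di; rewrite opprK.
  have dE := @is_derive_comp R R expR (fun y => - y^-1) _ _ _ _ (is_derive_expR (- t^-1)) dN.
  have := is_derive_mul dX dE; congr is_derive.
  rewrite -[k.+2]addn2 exprD mulrN mulNr addrC [in LHS]mulrA -mulrA.
  case: (k) => [|m] /=; first by rewrite !mul0r; ring.
  rewrite !exprS; ring.
rewrite /flat ltxx mulr0 subr0.
have cq : (fun h : R => h^-1 *: ((flat k \o shift 0) (h *: (1 : R)) - flat k 0)) @ 0^' --> (0 : R).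
  pose F := (k.+2)`!%:R : R.
  have F0 : 0 < F by rewrite ltr0n fact_gt0.
  apply/cvgr0Pnorm_le => e e0.
  have eF : 0 < e / F by rewrite divr_gt0.
  apply: filterS (dnbhs0_le eF) => h; rewrite ler_pdivlMr// mulrC.
  apply: le_trans; rewrite /= /flat ltxx subr0 addr0 /GRing.scale /= mulr1.
  case: ifPn => [h0|_]; last by rewrite mulr0 normr0 mulr_ge0// ltW.
  rewrite ger0_norm; last first.
    by rewrite mulr_ge0 ?invr_ge0 ?(ltW h0)// mulr_ge0 ?expR_ge0// exprn_ge0 ?invr_ge0 ?(ltW h0).
  have := flat_le k h0; rewrite /flat h0 -/F => hh.
  by rewrite ler_pdivrMl// (le_trans hh)// gtr0_norm// [leRHS]mulrCA -expr2.
split; first by apply/cvg_ex; exists 0.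
exact: cvg_lim.
Unshelve. all: by end_near. Qed.

Lemma flat_continuous k : continuous (flat k).
Proof.
move=> t; apply: differentiable_continuous; apply/derivable1_diffP.
by have [] := flat_derive k t.
Qed.

Lemma Ck_flat {n : nat} m k (f : 'rV[R]_n -> R) : Ck k f -> Ck k (fun x => flat m (f x)).
Proof.
have ce j : continuous f -> continuous (fun x => flat j (f x)).
  move=> cf x; apply: (@cvg_comp _ _ _ f (flat j) _ (nbhs (f x))); first exact: cf.
  exact: flat_continuous.
elim: k m => [|k IH] m cfk; first exact: ce.
have [cf [df [hf cdf]]] := cfk; split; first exact: ce.
exists (fun i x => (flat m.+2 (f x) + - m%:R * flat m.+1 (f x)) * df i x); split.
  move=> x i; apply: is_derive_comp => //.
  by rewrite mulNr; exact: flat_derive.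
move=> i; apply: Ck_mul; last exact: cdf.
apply: Ck_add; first by apply: IH; exact: CkW.
by apply: Ck_mul; [exact: Ck_cst|apply: IH; exact: CkW].
Qed.

End flat_function.

(** * Integrals of derivatives and the boundary *)

Section counting_levels.
Context {R : realType}.

Lemma level_sum_ge (e y : R) (J : nat) : 0 < e -> 0 <= y ->
  Num.min y (J%:R * e) <= \sum_(j < J) (if j%:R * e <= y then e else 0).
Proof.
move=> e0 y0; elim: J => [|J IH]; first by rewrite big_ord0 mul0r ge_min lexx orbT.
rewrite big_ord_recr /= -natr1 mulrDl mul1r.
case: ifPn => Jy; last first.
  move: Jy; rewrite -ltNge addr0 => yJ; apply: le_trans IH.
  by rewrite (min_l (ltW yJ)) ge_min lexx.
by move: IH; rewrite (min_r Jy) => IH; rewrite ge_min (lerD IH (lexx e)) orbT.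
Qed.

Lemma level_sum_le (e y : R) (J : nat) : 0 < e -> 0 <= y ->
  \sum_(j < J) (if j%:R * e - e <= y then e else 0) <= y + 2 * e.
Proof.
move=> e0 y0; suff : \sum_(j < J) (if j%:R * e - e <= y then e else 0)
    <= Num.min (J%:R * e) (y + 2 * e) by rewrite le_min => /andP[].
elim: J => [|J IH]; first by rewrite big_ord0 mul0r le_min lexx/=; lra.
rewrite big_ord_recr /= -natr1 mulrDl mul1r; move: IH; rewrite !le_min => /andP[h1 h2].
by case: ifPn => Jy; apply/andP; split; lra.
Qed.

End counting_levels.

(** * Segments that leave an open set *)

Section boundary_crossing.
Context {R : realType} {n : nat}.
Local Notation E := 'rV[R]_n.

Lemma ocube_nbhs (x : E) (r : R) : 0 < r -> nbhs x (ocube x r).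
Proof.
move=> r0; apply/nbhs_ballP; exists r => // y [_ xy] i.
exact: xy.
Qed.

Lemma nbhs_ocube (x : E) (U : set E) : nbhs x U -> exists r, 0 < r /\ ocube x r `<=` U.
Proof.
move=> /nbhs_ballP[r /= r0 rU]; exists r; split=> // y h; apply: rU; split=> // i j.
by rewrite (ord1 i); exact: h.
Qed.

(** The infimum of the parameters outside [D] works: the point there is outside because [D] is open,
    and it is a limit of earlier points, which are in [D]. *)
Lemma segment_bdry (D : set E) (y v : E) (t : R) : open D -> 0 <= t -> D y ->
  ~ D (y + t *: v) -> exists2 u, 0 <= u <= t & bdry D (y + u *: v).
Proof.
move=> oD t0 Dy nDt; pose A := [set u | 0 <= u <= t /\ ~ D (y + u *: v)].
have At : A t by rewrite /A /= t0 lexx.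
have Al : has_lbound A by exists 0 => u [/andP[]].
have Ai : has_inf A by split=> //; exists t.
pose u0 := inf A.
have u00 : 0 <= u0 by apply: lb_le_inf; [exists t|move=> u [/andP[]]].
have u0t : u0 <= t by exact: ge_inf.
pose w := enorm v + 1; have w0 : 0 < w by rewrite ltr_wpDl// enorm_ge0.
have near u u' r : 0 < r -> `|u - u'| < r / w -> ocube (y + u *: v) r (y + u' *: v).
  move=> r0 uu i; rewrite !mxE opprD addrACA subrr add0r -mulrBl normrM.
  apply: (@le_lt_trans _ _ (`|u - u'| * w)); last by rewrite -ltr_pdivlMr.
  by rewrite ler_wpM2l// (le_trans (coord_le_enorm v i))// lerDl.
have nD0 : ~ D (y + u0 *: v).
  move=> Du0; have [r [r0 rD]] := open_ocube oD Du0.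
  have rw : 0 < r / w by rewrite divr_gt0.
  have [u [/andP[ua ub] nDu] uu0] := inf_adherent rw Ai.
  apply: (nDu); apply: rD; apply: near => //.
  have u0u : u0 <= u by apply: ge_inf => //; split=> //; apply/andP.
  by rewrite distrC ger0_norm ?subr_ge0// ltrBlDl.
exists u0; first by rewrite u00.
split; last by move=> /interior_subset.
move=> U /nbhs_ocube[r [r0 rU]].
have [u00'|u0_neq0] := eqVneq u0 0.
  by case: nD0; rewrite u00' scale0r addr0.
have u0_gt0 : 0 < u0 by rewrite lt_def u0_neq0.
have rw : 0 < r / w by rewrite divr_gt0.
pose u := Num.max 0 (u0 - r / w / 2).
have uu : u < u0 by rewrite gt_max u0_gt0/=; lra.
have u_ge : u0 - r / w / 2 <= u by rewrite le_max lexx orbT.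
exists (y + u *: v); split.
  apply: contrapT => nDu; suff : u0 <= u by rewrite leNgt uu.
  apply: ge_inf => //; split=> //; rewrite le_max lexx /=.
  by rewrite (le_trans (ltW uu)).
apply: rU; apply: near => //; rewrite ger0_norm ?subr_ge0 ?(ltW uu)//.
have := u_ge; lra.
Qed.

End boundary_crossing.

Section lebesgue_rV_integral.
Context {R : realType} {n : nat}.
Local Notation E := 'rV[R]_n.
Local Notation leb := (@lebesgue_rV R n).
Local Notation LT := (caratheodory_type (@lebesgue_om R n)).

Lemma leb_measurable_open (U : set E) : open U -> measurable (U : set LT).
Proof. exact: (cara_measurable_open (@lebesgue_halfspace R n)). Qed.

Lemma leb_measurable_continuous (D : set LT) (f : E -> R) : measurable D ->
  continuous f -> measurable_fun D (f : LT -> R).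
Proof. exact: (cara_measurable_continuous (@lebesgue_halfspace R n)). Qed.

Lemma leb_shift (v : E) (A : set E) : leb (translate v A) = leb A.
Proof. exact: lebesgue_shift. Qed.

Lemma caratheodory_translate (v : E) (A : set E) :
  (lebesgue_om R n).-caratheodory A -> (lebesgue_om R n).-caratheodory (translate v A).
Proof.
move=> mA Y.
have h B : lebesgue_om R n B = lebesgue_om R n (translate (- v) B).
  by symmetry; exact: lebesgue_shift.
rewrite (h Y) (h (Y `&` _)) (h (Y `&` ~` _)) (mA (translate (- v) Y)).
by congr (_ + _)%E; congr (lebesgue_om R n _); apply/seteqP; split => x;
  rewrite /translate /= opprK addrK.
Qed.

Lemma measurable_shift (v : E) (A : set LT) : measurable A -> measurable (translate v A : set LT).
Proof. exact: caratheodory_translate. Qed.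

Lemma measurable_fun_translation (v : E) :
  measurable_fun setT ((fun x => x + v) : LT -> LT).
Proof.
move=> _ Y mY; rewrite setTI (_ : _ @^-1` _ = translate (- v) Y); first exact: measurable_shift.
by apply/seteqP; split=> x; rewrite /translate /= opprK.
Qed.

Lemma Rintegral_shift (v : E) (D : set E) (f : E -> R) :
  measurable (D : set LT) -> continuous f ->
  leb.-integrable (D : set LT) (EFin \o (fun x => f (x + v))) ->
  \int[leb]_(x in D) f (x + v) = \int[leb]_(x in translate v D) f x.
Proof.
move=> mD cf idf; rewrite /Rintegral; congr fine.
pose phi : LT -> LT := fun x => x + v.
have DE : phi @^-1` (translate v D) = D.
  by apply/seteqP; split=> x; rewrite /translate /phi /= addrK.
pose F : LT -> \bar R := EFin \o f.
have mf : measurable_fun [set: LT] F.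
  by apply/measurable_EFinP; exact: leb_measurable_continuous.
transitivity (\int[pushforward leb phi]_(y in (translate v D : set LT)) F y)%E.
  rewrite integral_pushforward ?DE//; first exact: measurable_fun_translation.
  exact: measurable_shift.
apply: eq_measure_integral => [|mphi A mA _ /=]; first exact: measurable_fun_translation.
rewrite /pushforward.
have -> : phi @^-1` A = translate (- v) A by apply/seteqP; split=> x; rewrite /translate /phi /= opprK.
exact: leb_shift.
Qed.

End lebesgue_rV_integral.

Section layer_cake.
Context {R : realType} d1 (T1 : measurableType d1) d2 (T2 : measurableType d2)
  (mu1 : {measure set T1 -> \bar R}) (mu2 : {measure set T2 -> \bar R}).

Let level_indic T (f : T -> R) (c e : R) (x : T) :
  (e%:E * (\1_[set y | c <= f y] x)%:E)%E = (if c <= f x then e else 0)%:E.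
Proof.
rewrite -EFinM indicE; congr EFin.
rewrite (_ : (x \in _) = (c <= f x)); first by case: ifP => _; rewrite ?mulr1 ?mulr0.
by apply/idP/idP; rewrite inE.
Qed.

(* The layer cake formula with the levels [j e]; the two errors [e] come from
   rounding to these levels and from the shift in the hypothesis. *)
Lemma layer_cake_le (A : set T1) (B : set T2) (f1 : T1 -> R) (f2 : T2 -> R)
    (c e M : R) : measurable A -> measurable B -> measurable_fun setT f1 ->
  measurable_fun setT f2 -> (forall x, 0 <= f1 x) -> (forall x, 0 <= f2 x) ->
  0 <= c -> 0 < e -> (forall x, A x -> f1 x <= M) ->
  (forall r : R, mu1 ([set x | r <= f1 x]%R `&` A) <=
    c%:E * mu2 ([set x | r - e <= f2 x]%R `&` B))%E ->
  (\int[mu1]_(x in A) (f1 x)%:E <= c%:E * \int[mu2]_(x in B) (f2 x + 2 * e)%:E)%E.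
Proof.
move=> mA mB mf1 mf2 f10 f20 c0 e0 f1M lev.
(* Since [f1 <= M] on [A], the levels up to [J * e] exhaust [f1] and the sums are finite. *)
pose J := (Num.truncn (M / e)).+1.
have MJ : M <= J%:R * e by rewrite -ler_pdivrMr// ltW// truncnS_gt.
pose L (j : nat) : set T1 := [set x | j%:R * e <= f1 x].
pose N (j : nat) : set T2 := [set x | j%:R * e - e <= f2 x].
have mL j : measurable (L j).
  have -> : L j = setT `&` f1 @^-1` [set` `[j%:R * e, +oo[].
    by rewrite setTI; apply/seteqP; split=> x; rewrite /L /= in_itv/= andbT.
  by apply: mf1 => //; exact: measurable_itv.
have mN j : measurable (N j).
  have -> : N j = setT `&` f2 @^-1` [set` `[j%:R * e - e, +oo[].
    by rewrite setTI; apply/seteqP; split=> x; rewrite /N /= in_itv/= andbT.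
  by apply: mf2 => //; exact: measurable_itv.
have m1 j : measurable_fun A (fun x => e%:E * (\1_(L j) x)%:E)%E.
  by apply: measurable_funeM; apply/measurable_EFinP; exact: measurable_indic.
have m2 j : measurable_fun B (fun x => e%:E * (\1_(N j) x)%:E)%E.
  by apply: measurable_funeM; apply/measurable_EFinP; exact: measurable_indic.
have p1 j x : A x -> (0 <= e%:E * (\1_(L j) x)%:E)%E.
  by move=> _; rewrite -EFinM lee_fin mulr_ge0// ltW.
have p2 j x : B x -> (0 <= e%:E * (\1_(N j) x)%:E)%E.
  by move=> _; rewrite -EFinM lee_fin mulr_ge0// ltW.
apply: (@le_trans _ _ (\int[mu1]_(x in A) \sum_(j < J) (e%:E * (\1_(L j) x)%:E))%E).
  apply: ge0_le_integral => //.
  - by move=> x _; rewrite lee_fin.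
  - by apply/measurable_EFinP; exact: measurable_funTS.
  - by apply: emeasurable_sum => j; exact: m1.
  move=> x Ax; under eq_bigr do rewrite level_indic//.
  rewrite sumEFin lee_fin; apply: le_trans (level_sum_ge J e0 (f10 x)).
  by rewrite le_min lexx (le_trans (f1M x Ax) MJ).
rewrite ge0_integral_sum//; last by move=> j x; exact: p1.
apply: (@le_trans _ _ (\sum_(j < J) (c%:E * \int[mu2]_(x in B) (e%:E * (\1_(N j) x)%:E)))%E).
  apply: lee_sum => j _.
  rewrite ge0_integralZl ?lee_fin ?(ltW e0)//; last first.
    by apply/measurable_EFinP; exact: measurable_indic.
  rewrite ge0_integralZl ?lee_fin ?(ltW e0)//; last first.
    by apply/measurable_EFinP; exact: measurable_indic.
  rewrite muleCA; apply: lee_wpmul2l; first by rewrite lee_fin ltW.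
  rewrite !integral_indic//; exact: lev.
rewrite -ge0_sume_distrr; last by move=> j _; apply: integral_ge0 => x; exact: p2.
apply: lee_wpmul2l => //; rewrite -ge0_integral_sum//; last by move=> j x; exact: p2.
apply: ge0_le_integral => //.
- by move=> x Bx; apply: sume_ge0 => j _; exact: p2.
- by apply: emeasurable_sum => j; exact: m2.
- by apply/measurable_EFinP; apply: measurable_funD => //; exact: measurable_funTS.
move=> x _; under eq_bigr do rewrite level_indic//.
by rewrite sumEFin lee_fin; exact: level_sum_le.
Qed.

End layer_cake.

(** * Integrals of derivatives bounded by boundary integrals *)

Section divergence.
Context {R : realType} {n : nat}.
Hypothesis n_ge2 : (2 <= n)%N.
Local Notation E := 'rV[R]_n.
Local Notation leb := (@lebesgue_rV R n).
Local Notation LT := (caratheodory_type (@lebesgue_om R n)).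
Local Notation surf := (@hausdorff R n n.-1).
Local Notation HT := (caratheodory_type (@hausdorff_om R n n.-1)).
Local Notation K := (@thick_const R n).

Lemma surf_measurable_closed (F : set E) : closed F -> measurable (F : set HT).
Proof. exact: (cara_measurable_closed (@hausdorff_halfspace R n n.-1)). Qed.

Lemma surf_measurable_continuous (D : set HT) (f : E -> R) : measurable D ->
  continuous f -> measurable_fun D (f : HT -> R).
Proof. exact: (cara_measurable_continuous (@hausdorff_halfspace R n n.-1)). Qed.

Lemma bdry_closed (D : set E) : closed (bdry D).
Proof.
rewrite /bdry setDE; apply: closedI; first exact: closed_closure.
by apply: open_closedC; exact: open_interior.
Qed.

Lemma surf_measurable_bdry (D : set E) : measurable (bdry D : set HT).
Proof. by apply: surf_measurable_closed; exact: bdry_closed. Qed.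

Lemma continuous_norm_comp (psi : E -> R) : continuous psi ->
  continuous (fun x => `|psi x|).
Proof.
move=> cp x; apply: (@cvg_comp _ _ _ psi Num.norm _ (nbhs (psi x))); first exact: cp.
exact: norm_continuous.
Qed.

Lemma cbox_compact (a b : E) : compact (cbox a b).
Proof.
have -> : cbox a b = [set v : E | forall i, [set` `[a 0 i, b 0 i]] (v ord0 i)].
  by apply/seteqP; split => x /= h i; have := h i; rewrite ?in_itv.
exact: (@rV_compact R n (fun i => [set` `[a 0 i, b 0 i]]) (fun i => @segment_compact R _ _)).
Qed.

Lemma cbox_closed (a b : E) : closed (cbox a b).
Proof. by apply: compact_closed; [exact: norm_hausdorff|exact: cbox_compact]. Qed.

Lemma continuous_bounded_cbox (psi : E -> R) (a b : E) : continuous psi ->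
  exists C, 0 <= C /\ forall x, cbox a b x -> `|psi x| <= C.
Proof.
move=> cp; have [->|/set0P b0] := eqVneq (cbox a b) set0.
  by exists 0; split.
have [||c _ h] := @EVT_max_rV R n (fun x => `|psi x|) (cbox a b) b0.
- exact: cbox_compact.
- by apply: continuous_subspaceT; exact: continuous_norm_comp.
by exists `|psi c|; split=> // x xb; apply: h; rewrite inE.
Qed.

Lemma leb_bounded_lty (A : set LT) (a b : E) : measurable A -> A `<=` cbox a b ->
  (leb A < +oo)%E.
Proof.
move=> mA Aab.
apply: (@le_lt_trans _ _ (leb (cbox (\row_i Num.min (a 0 i) (b 0 i)) b))).
  apply: (le_outer_measure (lebesgue_om R n)) => x /Aab h i.
  by have := h i; rewrite mxE ge_min => /andP[-> ->].
apply: le_lt_trans (lebesgue_box_le _) _; last exact: ltry.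
by move=> i; rewrite mxE ge_min lexx orbT.
Qed.

Lemma integrable_bounded_leb (A : set LT) (a b : E) (psi : E -> R) : measurable A ->
  A `<=` cbox a b -> continuous psi -> leb.-integrable A (EFin \o (psi : LT -> R)).
Proof.
move=> mA Aab cp; apply: measurable_bounded_integrable => //.
- exact: leb_bounded_lty Aab.
- exact: leb_measurable_continuous.
have [C [C0 hC]] := continuous_bounded_cbox a b cp.
exists C; split; first exact: num_real.
by move=> y Cy x Ax; exact: (le_trans (hC x (Aab _ Ax)) (ltW Cy)).
Qed.

Section layer.
Variables (D : set E) (i : 'I_n).

(** The part of the layer where [|psi| >= r] lies in the thickening of the part of the boundary
    where [|psi| >= r - e]. [thick_hausdorff] compares the measures of these sets, and integration
    over [r] compares the integrals. *)
Lemma layer_bound (S : set E) (t e B : R) (psi : E -> R) : 0 < t -> 0 < e ->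
  measurable (S : set LT) -> continuous psi ->
  (forall x, S x -> exists2 u, 0 <= u <= t &
    bdry D (x - u *: delta_mx 0 i) /\ `|psi x| <= `|psi (x - u *: delta_mx 0 i)| + e) ->
  (forall x, S x -> `|psi x| <= B) ->
  (\int[leb]_(x in (S : set LT)) (`|psi x|)%:E <=
   (K * t)%:E * \int[surf]_(x in (bdry D : set HT)) (`|psi x| + 2 * e)%:E)%E.
Proof.
move=> t0 e0 mS cp Sb SB.
have K0 : 0 <= K * t by rewrite mulr_ge0// ltW// thick_const_gt0.
have cn := continuous_norm_comp cp.
apply: (@layer_cake_le R _ LT _ HT leb surf S (bdry D) (fun x => `|psi x|)
  (fun x => `|psi x|) (K * t) e B mS (surf_measurable_bdry D)
  (leb_measurable_continuous measurableT cn) (surf_measurable_continuous measurableT cn)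
  _ _ K0 e0 SB _) => [x|x|r].
- exact: normr_ge0.
- exact: normr_ge0.
apply: le_trans (thick_hausdorff n_ge2 i _ t0).
apply: (le_outer_measure (lebesgue_om R n)) => x [Lx Sx].
have [u ut [bu pu]] := Sb x Sx; exists u => //; split=> //.
by rewrite /= lerBlDr (le_trans Lx).
Qed.

End layer.

Lemma is_derive_along (psi dpsi : E -> R) (x v : E) (s : R) :
  (forall y, is_derive y v psi (dpsi y)) ->
  is_derive s (1 : R) (fun h : R => psi (x + h *: v)) (dpsi (x + s *: v)).
Proof.
move=> hd; have /is_derive_line h0 := hd (x + s *: v).
have hs : is_derive s (1 : R) (fun h : R => h + - s) 1.
  by have := is_derive_add (is_derive_id s (1 : R)) (is_derive_cst (- s) s (1 : R));
    rewrite addr0.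
have := @is_derive_comp R R (fun t => psi (t *: v + (x + s *: v))) (fun h => h + - s) s 1
  (dpsi (x + s *: v)) 1; rewrite subrr => /(_ h0 hs); rewrite mulr1; congr is_derive.
by apply/funext => h; congr psi; apply/rowP => l; rewrite !mxE; ring.
Qed.

Lemma line_lipschitz (psi dpsi : E -> R) (x v : E) (C t : R) :
  (forall y, is_derive y v psi (dpsi y)) -> 0 <= t ->
  (forall s, 0 <= s <= t -> `|dpsi (x + s *: v)| <= C) ->
  `|psi (x + t *: v) - psi x| <= C * t.
Proof.
move=> hd t0 hC.
have := @MVT_segment R (fun h => psi (x + h *: v)) (fun h => dpsi (x + h *: v)) 0 t t0.
case=> [s _||c]; first exact: is_derive_along.
  apply: derivable_within_continuous => s _.
  by have [] := is_derive_along x s hd.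
rewrite in_itv /= => ct; rewrite scale0r addr0 subr0 => ->.
by rewrite normrM (ger0_norm t0) ler_wpM2r// hC.
Qed.

Lemma continuous_translate (f : E -> R) (v : E) : continuous f ->
  continuous (fun x : E => f (x + v)).
Proof.
move=> cf x U /= /(cf (x + v)) /nbhs_ocube[r [r0 rU]].
apply: filterS (ocube_nbhs x r0) => y xy; apply: rU => i.
by have := xy i; rewrite !mxE opprD addrACA subrr addr0.
Qed.

Section divergence_bound.
Variables (D : set E) (i : 'I_n) (M : R).
Hypotheses (oD : open D) (DM : D `<=` cbox (- const_mx M) (const_mx M))
  (Hfin : (@hausdorff_outer R n n.-1 (bdry D) < +oo)%E).
Variables psi dpsi : E -> R.
Hypotheses (hd : forall x, is_derive x (delta_mx 0 i) psi (dpsi x))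
  (cpsi : continuous psi) (cdpsi : continuous dpsi).
Local Notation e_i := (delta_mx 0 i : E).
Let Q : set E := cbox (- const_mx (M + 1)) (const_mx (M + 1)).

Let closure_DM : closure D `<=` cbox (- const_mx M) (const_mx M).
Proof.
by rewrite (closure_id (cbox _ _)).1; [exact: closureS|exact: cbox_closed].
Qed.

Lemma integrable_surf : surf.-integrable (bdry D) (EFin \o (psi : HT -> R)).
Proof.
apply: measurable_bounded_integrable => //.
- exact: surf_measurable_bdry.
- exact: surf_measurable_continuous (surf_measurable_bdry D) cpsi.
have [C [C0 hC]] := continuous_bounded_cbox (- const_mx M) (const_mx M) cpsi.
exists C; split; first exact: num_real.
by move=> y Cy x [/closure_DM Ax _]; exact: (le_trans (hC x Ax) (ltW Cy)).
Qed.

Let mD : measurable (D : set LT). Proof. exact: leb_measurable_open. Qed.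

Let in_Q (x y : E) (u : R) : 0 <= u <= 1 -> cbox (- const_mx M) (const_mx M) x ->
  y = x + u *: e_i \/ y = x - u *: e_i -> Q y.
Proof.
move=> /andP[u0 u1] Mx [->|->] j; have := Mx j; rewrite !mxE eqxx /=;
  case: (j == i) => /=; rewrite ?mulr1 ?mulr0 => /andP[? ?]; apply/andP; split; lra.
Qed.

Let bint : R := \int[surf]_(x in bdry D) `|psi x|.
Let hD : R := fine (surf (bdry D)).

Let surf_int (e : R) : 0 <= e ->
  (\int[surf]_(x in (bdry D : set HT)) (`|psi x| + 2 * e)%:E = (bint + 2 * e * hD)%:E)%E.
Proof.
move=> e0.
have mB := surf_measurable_bdry D.
have mp : measurable_fun (bdry D : set HT) (fun x : HT => (`|psi x|)%:E).
  apply/measurable_EFinP; apply: measurableT_comp => //.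
  exact: surf_measurable_continuous.
under eq_integral do rewrite EFinD.
rewrite ge0_integralD//; last by move=> x _; rewrite lee_fin mulr_ge0.
rewrite integral_cst// [RHS]EFinD [X in _ = (_ + X)%E]EFinM; congr (_ + _)%E.
  rewrite /bint /Rintegral fineK//.
  have := integrable_surf => /integrableP[_].
  rewrite ge0_fin_numE//; first by apply: integral_ge0 => x _; rewrite lee_fin.
by congr (_ * _)%E; rewrite /hD fineK// ge0_fin_numE.
Qed.

(** After the change of variables the contributions of the intersection of [D] with its translate
    cancel. The condition [C * t <= e] says that [psi] varies by at most [e] across a layer of width
    [t]; the larger box [Q] contains all translates by at most 1. *)
Lemma int_increment_le (t e C : R) : 0 < t -> t <= 1 -> 0 < e -> 0 <= C ->
  (forall x, Q x -> `|dpsi x| <= C) -> C * t <= e ->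
  `|\int[leb]_(x in D) (psi (x + t *: e_i) - psi x)| <= 2 * K * t * (bint + 2 * e * hD).
Proof.
move=> t0 t1 e0 C0 hC Cte; have t0' := ltW t0; have e0' := ltW e0.
have K0 : 0 <= K * t by rewrite mulr_ge0// ltW// thick_const_gt0.
pose T := translate (t *: e_i) D.
have mT : measurable (T : set LT) by exact: measurable_shift.
have TQ : T `<=` Q.
  move=> x Tx; apply: (@in_Q (x - t *: e_i) x t).
  - by rewrite t0'.
  - exact: DM.
  - by left; rewrite subrK.
have DQ : D `<=` Q.
  move=> x Dx; apply: (@in_Q x x 0).
  - by rewrite lexx ler01.
  - exact: DM.
  - by left; rewrite scale0r addr0.
have intQ (A : set LT) : measurable A -> A `<=` Q -> leb.-integrable A (EFin \o (psi : LT -> R)).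
  by move=> mA AQ; exact: integrable_bounded_leb mA AQ cpsi.
have cpt : continuous (fun x : E => psi (x + t *: e_i)) by exact: continuous_translate.
have intt : leb.-integrable (D : set LT) (EFin \o (fun x => psi (x + t *: e_i))).
  exact: integrable_bounded_leb mD DM cpt.
have [B [B0 hB]] := continuous_bounded_cbox (- const_mx (M + 1)) (const_mx (M + 1)) cpsi.
have piece (S : set LT) : measurable S -> S `<=` Q ->
    (forall x, S x -> exists2 u, 0 <= u <= t & bdry D (x - u *: e_i)) ->
    `|\int[leb]_(x in S) psi x| <= K * t * (bint + 2 * e * hD).
  move=> mS SQ Sb.
  have iS := intQ _ mS SQ.
  have mS1 : measurable_fun S (fun x => (psi x)%:E) by have [] := integrableP _ _ _ iS.
  apply: (le_trans (le_normr_Rintegral mS iS)).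
  rewrite -lee_fin /Rintegral fineK; last first.
    apply: integrable_fin_num => //.
    have := integrable_norm iS; congr (integrable _ _ _).
  rewrite EFinM -surf_int//.
  apply: (@layer_bound D i S t e B psi t0 e0 mS cpsi) => [x Sx|x Sx]; last exact: hB _ (SQ _ Sx).
  have [u /andP[u0 ut] bu] := Sb x Sx; exists u; first by rewrite u0.
  split=> //.
  have hl := @line_lipschitz psi dpsi (x - u *: e_i) e_i C u hd u0 _.
  have : `|psi (x - u *: e_i + u *: e_i) - psi (x - u *: e_i)| <= C * u.
    apply: hl => s /andP[s0 su]; apply: hC.
    apply: (@in_Q (x - u *: e_i) _ s).
    - by rewrite s0 (le_trans su)// (le_trans ut).
    - by apply: closure_DM; case: bu.
    - by left.
  rewrite subrK => h.
  rewrite -lerBlDl (le_trans (lerB_dist _ _))// (le_trans h)// (le_trans _ Cte)//.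
  exact: ler_wpM2l.
have mDT : measurable (D `&` T : set LT) by exact: measurableI.
have mD1 : measurable (D `\` T : set LT) by exact: measurableD.
have mT1 : measurable (T `\` D : set LT) by exact: measurableD.
rewrite RintegralB//; last exact: intQ.
rewrite Rintegral_shift// -/T.
have ED : \int[leb]_(x in D) psi x =
    \int[leb]_(x in D `&` T) psi x + \int[leb]_(x in D `\` T) psi x.
  rewrite -{1}(setUIDK D T) Rintegral_setU//; first by rewrite setUIDK; exact: intQ.
  by apply/eqP/seteqP; split=> // x [[_ Tx] [_ nTx]].
have ET : \int[leb]_(x in T) psi x =
    \int[leb]_(x in D `&` T) psi x + \int[leb]_(x in T `\` D) psi x.
  rewrite -{1}(setUIDK T D) Rintegral_setU//; last first.
  - by apply/eqP/seteqP; split=> // x [[_ Tx] [_ nTx]].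
  - by rewrite setUIDK; exact: intQ.
  - exact: measurableI.
  by rewrite setIC.
have h1 : `|\int[leb]_(x in T `\` D) psi x| <= K * t * (bint + 2 * e * hD).
  apply: piece => //; first by move=> x [/TQ].
  move=> x [Tx nDx]; have [|u /andP[u0 ut] bu] := segment_bdry oD t0' Tx (v := e_i).
    by rewrite subrK.
  exists (t - u); first by rewrite subr_ge0 ut lerBlDr lerDl.
  by rewrite scalerBl opprB addrA addrAC.
have h2 : `|\int[leb]_(x in D `\` T) psi x| <= K * t * (bint + 2 * e * hD).
  apply: piece => //; first by move=> x [/DQ].
  move=> x [Dx nTx]; have [|u ut bu] := segment_bdry oD t0' Dx (v := - e_i).
    by rewrite scalerN.
  by exists u; [exact: ut|rewrite -scalerN].
rewrite ED ET opprD addrACA subrr add0r (le_trans (ler_normB _ _))//.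
by rewrite (le_trans (lerD h1 h2))//; lra.
Qed.

(** The difference quotients are dominated by a bound on [dpsi] and converge to it. Each of the two
    layers costs [K * t], and the division by [t] leaves [2 * K]. *)
Theorem divergence_bound :
  `|\int[leb]_(x in D) dpsi x| <= 2 * K * \int[surf]_(x in bdry D) `|psi x|.
Proof.
rewrite -/bint.
have [C [C0 hC]] := continuous_bounded_cbox (- const_mx (M + 1)) (const_mx (M + 1)) cdpsi.
have hD0 : 0 <= hD by apply: fine_ge0.
have Kp : 0 < K := thick_const_gt0.
pose t (k : nat) : R := k.+1%:R^-1.
have t0 k : 0 < t k by rewrite invr_gt0.
have t1 k : t k <= 1 by rewrite invf_le1// ler1n.
pose f k (x : LT) : R := (t k)^-1 * (psi (x + t k *: e_i) - psi x).
have cf k : continuous (f k : E -> R).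
  move=> x; have c1 := continuous_translate (v := t k *: e_i) cpsi (x := x).
  have c2 := continuousB c1 (@cpsi x).
  exact: (continuousM (@cst_continuous E R (t k)^-1 x) c2).
have fC k x : D x -> `|f k x| <= C.
  move=> Dx; rewrite /f normrM ger0_norm ?invr_ge0 ?(ltW (t0 k))// ler_pdivrMl//.
  rewrite mulrC; apply: (@line_lipschitz psi dpsi x e_i C (t k) hd (ltW (t0 k))) => s /andP[s0 st].
  apply: hC; apply: (@in_Q x _ s).
  - by rewrite s0 (le_trans st).
  - exact: DM.
  - by left.
have flim x : D x -> (f k x)%:E @[k --> \oo] --> (dpsi x)%:E.
  move=> _; have [dx vx] := hd x; apply: cvg_EFin; first exact: nearW.
  move: dx => /cvg_ex[l hl]; have lE : l = dpsi x by rewrite -vx; apply/esym; exact: cvg_lim.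
  move: hl; rewrite lE => /cvgr_dnbhsP /(_ t) h.
  have tn0 : (forall k, t k != 0) /\ (t k @[k --> \oo] --> (0 : R)).
    split; first by move=> k; exact: lt0r_neq0.
    exact: cvg_harmonic.
  have := h tn0; apply: cvg_trans; apply: near_eq_cvg; apply: nearW => k /=.
  by rewrite /f /GRing.scale /= [x + _]addrC.
have int_k : (\int[leb]_(x in D) (f k x)%:E)%E @[k --> \oo] -->
    (\int[leb]_(x in D) (dpsi x)%:E)%E.
  apply: (@dominated_cvg _ _ _ leb (D : set LT) mD (fun k x => (f k x)%:E)
     (fun x => (dpsi x)%:E) (fun=> C%:E)).
  - by move=> k; apply/measurable_EFinP; exact: leb_measurable_continuous.
  - exact: flim.
  - by [].
  - exact: (integrable_bounded_leb mD DM (@cst_continuous _ _ C)).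
  - by move=> k x Dx; rewrite lee_fin; exact: fC.
pose J k := \int[leb]_(x in D) f k x; pose J0 := \int[leb]_(x in D) dpsi x.
have Jcvg : J k @[k --> \oo] --> J0.
  apply: fine_cvg; rewrite /J0 /Rintegral fineK//.
  apply: integrable_fin_num => //.
  exact: integrable_bounded_leb mD DM cdpsi.
have Jle (k : nat) (e : R) : 0 < e -> C * t k <= e -> `|J k| <= 2 * K * (bint + 2 * e * hD).
  move=> e0 Ce; rewrite /J.
  have intd : leb.-integrable (D : set LT) (EFin \o (fun x : E => psi (x + t k *: e_i) - psi x)).
    apply: (integrable_bounded_leb mD DM) => x.
    have c1 := continuous_translate (v := t k *: e_i) cpsi (x := x).
    exact: (continuousB c1 (@cpsi x)).
  rewrite RintegralZl// normrM gtr0_norm ?invr_gt0// ler_pdivrMl//.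
  apply: (le_trans (int_increment_le (t0 k) (t1 k) e0 C0 hC Ce)).
  by rewrite le_eqVlt; apply/orP; left; apply/eqP; ring.
apply/ler_addgt0Pr => eta eta0.
have KhD : 0 <= 4 * K * hD by rewrite mulr_ge0// mulr_ge0// ltW.
(* This makes the error [2 * K * (2 * e * hD)] at most [eta / 2], also when [hD] is 0. *)
pose e := eta / 2 / (4 * K * hD + 1).
have e0 : 0 < e by rewrite !divr_gt0// ltr_wpDl.
have ee : 2 * K * (2 * e * hD) <= eta / 2.
  have -> : 2 * K * (2 * e * hD) = e * (4 * K * hD) by ring.
  move: KhD; rewrite /e; move: (4 * K * hD) => X X0.
  by rewrite mulrAC ler_pdivrMr ?ltr_wpDl//; lra.
have eC : 0 < e / (C + 1) by rewrite divr_gt0// ltr_wpDl.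
have nt : \forall k \near \oo, t k <= e / (C + 1).
  by apply: filterS (near_infty_natSinv_lt (PosNum eC)) => k /ltW.
have : \forall k \near \oo, `|J0 - J k| <= eta / 2 /\ C * t k <= e.
  near=> k; split.
    by near: k; move/cvgrPdist_le: Jcvg; apply; rewrite divr_gt0.
  apply: (@le_trans _ _ ((C + 1) * t k)); first by rewrite ler_wpM2r ?(ltW (t0 k))// lerDl.
  rewrite mulrC -ler_pdivlMr ?ltr_wpDl//.
  by near: k; exact: nt.
move=> [k _ /(_ k (leqnn k)) [h1 h2]].
rewrite -/J0 -[J0](subrK (J k)) (le_trans (ler_normD _ _))//.
by have := Jle k e e0 h2; lra.
Unshelve. all: by end_near. Qed.

End divergence_bound.

End divergence.

(** * Traces and weak solutions *)

Section l2_convergence.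
Context d (T : measurableType d) (R : realType) (mu : {measure set T -> \bar R})
  (D : set T) (mD : measurable D).
Implicit Types (f g : T -> R) (u : nat -> T -> R).
Local Notation l2 := (l2 mu D).
Local Notation ip := (ip mu D).
Local Notation l2cvg := (l2cvg mu D).

Lemma l2cvgP u f : l2cvg u f <-> forall e : R, 0 < e -> exists N, forall k, (N <= k)%N ->
  ip (fun x => u k x - f x) (fun x => u k x - f x) <= e.
Proof.
split=> [h e e0|h].
  have /cvgr0Pnorm_le /(_ e e0)[N _ hN] := h; exists N => k Nk.
  by have := hN k Nk; rewrite /= ger0_norm// ip_ge0.
apply/cvgr0Pnorm_le => e e0; have [N hN] := h e e0; exists N => // k /= Nk.
by rewrite ger0_norm ?ip_ge0// hN.
Qed.

Lemma l2cvg_cst f : l2cvg (fun=> f) f.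
Proof.
apply/l2cvgP => e e0; exists 0%N => k _.
rewrite (_ : ip _ _ = 0) ?ltW// -(ip0l mu D (fun=> 0)).
by apply: eq_ip => // x _; rewrite subrr.
Qed.

Lemma l2cvg_lin (a b : R) u f u' f' : (forall k, l2 (u k)) -> l2 f ->
  (forall k, l2 (u' k)) -> l2 f' -> l2cvg u f -> l2cvg u' f' ->
  l2cvg (fun k x => a * u k x + b * u' k x) (fun x => a * f x + b * f' x).
Proof.
move=> lu lf lu' lf' /l2cvgP cu /l2cvgP cu'; apply/l2cvgP => e e0.
pose c := 4 * (a ^+ 2 + b ^+ 2 + 1).
have a2 := sqr_ge0 a; have b2 := sqr_ge0 b.
have c0 : 0 < c by rewrite /c; lra.
have ec : 0 < e / c by rewrite divr_gt0.
have [N hN] := cu _ ec; have [N' hN'] := cu' _ ec; exists (maxn N N') => k.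
rewrite geq_max => /andP[/hN h /hN' h'].
have l1 : l2 (fun x => u k x - f x) by exact: l2B.
have l1' : l2 (fun x => u' k x - f' x) by exact: l2B.
rewrite (@eq_ip _ _ _ mu D _ _ (fun x => a * (u k x - f x) + b * (u' k x - f' x))
  (fun x => a * (u k x - f x) + b * (u' k x - f' x))); try by move=> x _; ring.
apply: le_trans (ip_sqD_le mD (l2Z mD a l1) (l2Z mD b l1')) _.
rewrite !(ipZl, ipZr)//; try exact: l2Z.
have ee : e / c * c = e by rewrite divfK// lt0r_neq0.
move: h h' ee a2 b2 e0; rewrite /c !expr2.
move: (ip _ _) (ip _ _) (e / _) => X Y q hX hY qe a2 b2 e0.
have := ler_wpM2l a2 hX; have := ler_wpM2l b2 hY; nra.
Qed.

Lemma l2cvg_ip u f g : (forall k, l2 (u k)) -> l2 f -> l2 g -> l2cvg u f ->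
  forall e : R, 0 < e -> exists N, forall k, (N <= k)%N -> `|ip (u k) g - ip f g| <= e.
Proof.
move=> lu lf lg /l2cvgP cu e e0.
have g1 : 0 < ip g g + 1 by have := ip_ge0 mu D g; lra.
have [N hN] := cu (e ^+ 2 / (ip g g + 1)) (divr_gt0 (exprn_gt0 2 e0) g1).
exists N => k /hN h; have lk : l2 (fun x => u k x - f x) by exact: l2B.
rewrite -ipBl// -(@ler_pXn2r _ 2)// ?nnegrE ?(ltW e0)//.
rewrite (real_normK (num_real _)); apply: le_trans (ip_CS mD lk lg) _.
apply: (@le_trans _ _ (e ^+ 2 / (ip g g + 1) * (ip g g + 1))).
  by apply: ler_pM => //; rewrite ?ip_ge0// lerDl.
by rewrite divfK// lt0r_neq0.
Qed.

Lemma l2cvg_near u f (lu : forall k, l2 (u k)) (lf : l2 f) : l2cvg u f ->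
  forall e : R, 0 < e -> exists N, forall k, (N <= k)%N ->
    ip f f <= 2 * ip (u k) (u k) + e /\ ip (u k) (u k) <= 2 * ip f f + e.
Proof.
move=> /l2cvgP cu e e0; have [N hN] := cu (e / 2) (divr_gt0 e0 (ltr0Sn _ 1)).
exists N => k /hN h; have lk : l2 (fun x => u k x - f x) by exact: l2B.
split.
  have := ip_sqB_le mD (lu k) lk.
  rewrite (@eq_ip _ _ _ mu D _ _ f f); [lra|by move=> x _; ring..].
have := ip_sqD_le mD lf lk.
rewrite (@eq_ip _ _ _ mu D _ _ (u k) (u k)); [lra|by move=> x _; ring..].
Qed.

Lemma l2cvg_cauchy u f (lu : forall k, l2 (u k)) (lf : l2 f) : l2cvg u f ->
  forall w : nat -> T -> R, (forall k, l2 (w k)) ->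
  (forall k, ip (fun x => w k x - u k x) (fun x => w k x - u k x) <= k.+1%:R^-1) ->
  l2cvg w f.
Proof.
move=> /l2cvgP cu w lw wu; apply/l2cvgP => e e0.
have e4 : 0 < e / 4 by rewrite divr_gt0.
have [N hN] := cu _ e4; have [M _ hM] := near_infty_natSinv_lt (PosNum e4).
exists (maxn N M) => k; rewrite geq_max => /andP[/hN h /hM /= h'].
have l1 : l2 (fun x => w k x - u k x) by exact: l2B.
have l1' : l2 (fun x => u k x - f x) by exact: l2B.
have := ip_sqD_le mD l1 l1'.
rewrite (@eq_ip _ _ _ mu D (fun x => w k x - u k x + (u k x - f x)) _
  (fun x => w k x - f x) (fun x => w k x - f x)); try by move=> x _; ring.
move/le_trans; apply; rewrite -mulrDr.
have hh := lerD (le_trans (wu k) (ltW h')) h.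
by apply: le_trans (ler_wpM2l _ hh) _ => //; rewrite /=; lra.
Qed.

Lemma ip_young f g : l2 f -> l2 g -> - (4 * ip g f) <= ip f f + 4 * ip g g.
Proof.
move=> lf lg; have := ip_ge0 mu D (fun x => f x + 2 * g x).
rewrite (ip_sqD mD lf (l2Z mD 2 lg)) (ipZr mD 2 lg lf) (ipZl mD 2 lg (l2Z mD 2 lg)).
rewrite (ipZr mD 2 lg lg) (ipC _ _ f); lra.
Qed.

End l2_convergence.

Section smooth_linear.
Context {R : realType} {n : nat}.
Local Notation E := 'rV[R]_n.
Implicit Types f g : E -> R.

Lemma smooth_lin (a b : R) f g : smooth f -> smooth g -> smooth (fun x => a * f x + b * g x).
Proof.
move=> sf sg; apply: Ck_smooth => k.
by apply: Ck_add; apply: Ck_mul; try exact: Ck_cst; exact: smooth_Ck.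
Qed.

Lemma smooth_mul f g : smooth f -> smooth g -> smooth (fun x => f x * g x).
Proof. by move=> sf sg; apply: Ck_smooth => k; apply: Ck_mul; exact: smooth_Ck. Qed.

Lemma partial_lin (a b : R) f g i : smooth f -> smooth g ->
  partial i (fun x => a * f x + b * g x) = (fun x => a * partial i f x + b * partial i g x).
Proof.
move=> sf sg; apply/funext => x; apply: is_derive_partial.
have h c h' : smooth h' -> is_derive x (delta_mx 0 i : E) (fun y => c * h' y) (c * partial i h' x).
  move=> sh; have := is_derive_mul (is_derive_cst c x (delta_mx 0 i : E)) (smooth_is_derive x i sh).
  by rewrite mul0r add0r.
by apply: is_derive_add; exact: h.
Qed.

Lemma partial_mul f g i : smooth f -> smooth g ->
  partial i (fun x => f x * g x) = (fun x => partial i f x * g x + f x * partial i g x).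
Proof.
move=> sf sg; apply/funext => x; apply: is_derive_partial.
by apply: is_derive_mul; exact: smooth_is_derive.
Qed.

Lemma smooth_cst (c : R) : smooth ((fun=> c) : E -> R).
Proof. by apply: Ck_smooth => k; exact: Ck_cst. Qed.

Lemma smooth_coord (j : 'I_n) : smooth (fun x : E => x 0 j).
Proof. by apply: Ck_smooth => k; exact: Ck_coord. Qed.

Lemma partial_coord (i j : 'I_n) : partial i (fun x : E => x 0 j) = (fun=> (i == j)%:R).
Proof. by apply/funext => x; apply: is_derive_partial; exact: is_derive_coord. Qed.

End smooth_linear.

(** * Traces, Green's formula and Poincare's inequality *)

Section traces.
Context {R : realType} {n : nat}.
Hypothesis n_ge2 : (2 <= n)%N.
Local Notation E := 'rV[R]_n.
Local Notation leb := (@lebesgue_rV R n).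
Local Notation LT := (caratheodory_type (@lebesgue_om R n)).
Local Notation surf := (@hausdorff R n n.-1).
Local Notation HT := (caratheodory_type (@hausdorff_om R n n.-1)).
Local Notation K := (@thick_const R n).
Variables (D : set E) (M : R).
Hypotheses (oD : open D) (DM : D `<=` cbox (- const_mx M) (const_mx M))
  (Hfin : (@hausdorff_outer R n n.-1 (bdry D) < +oo)%E).
Local Notation L2D := (@l2 _ LT R leb D).
Local Notation L2S := (@l2 _ HT R surf (bdry D)).
Local Notation ipD := (@ip _ LT R leb D).
Local Notation ipS := (@ip _ HT R surf (bdry D)).
Implicit Types (u v f g h w : E -> R) (G H : 'I_n -> E -> R).

(** Real counterpart of [has_trace]; the integration by parts demanded by [inH1] is recovered from
    the smooth approximations in [weak_derivative]. *)
Definition rtrace u G f :=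
  [/\ L2D u, forall i, L2D (G i), L2S f & exists w : nat -> E -> R,
    [/\ forall k, smooth (w k), l2cvg leb D (w : nat -> LT -> R) u,
      forall i, l2cvg leb D (fun k => partial i (w k) : LT -> R) (G i) &
      l2cvg surf (bdry D) (w : nat -> HT -> R) f]].

Let mD : measurable (D : set LT). Proof. exact: leb_measurable_open. Qed.
Let mB : measurable (bdry D : set HT). Proof. exact: surf_measurable_bdry. Qed.

Lemma closure_cbox : closure D `<=` cbox (- const_mx M) (const_mx M).
Proof.
by rewrite (closure_id (cbox _ _)).1; [exact: closureS|exact: cbox_closed].
Qed.

Lemma l2_bounded d (T : measurableType d) (mu : {measure set T -> \bar R}) (A : set T)
    (f : T -> R) (C : R) : measurable A -> (mu A < +oo)%E -> measurable_fun A f ->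
  (forall x, A x -> `|f x| <= C) -> l2 mu A f.
Proof.
move=> mA Afin mf fC; split=> //.
apply: (@le_lt_trans _ _ (\int[mu]_(x in A) (C ^+ 2)%:E)%E).
  apply: ge0_le_integral => //.
  - by move=> x _; rewrite lee_fin sqr_ge0.
  - exact: measurable_sqrE.
  - by move=> x Ax; rewrite lee_fin; apply: sqr_abs_le; exact: fC.
by rewrite integral_cst// lte_mul_pinfty// lee_fin sqr_ge0.
Qed.

Lemma l2D_continuous f : continuous f -> L2D f.
Proof.
move=> cf; have [C [C0 hC]] := continuous_bounded_cbox (- const_mx M) (const_mx M) cf.
apply: (@l2_bounded _ _ _ _ _ C mD).
- exact: leb_bounded_lty mD DM.
- exact: leb_measurable_continuous.
- by move=> x Dx; apply: hC; exact: DM.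
Qed.

Lemma l2S_continuous f : continuous f -> L2S f.
Proof.
move=> cf; have [C [C0 hC]] := continuous_bounded_cbox (- const_mx M) (const_mx M) cf.
apply: (@l2_bounded _ HT surf (bdry D) f C mB Hfin).
- exact: surf_measurable_continuous.
- by move=> x [Dx _]; apply: hC; exact: closure_cbox.
Qed.

Let sD f : smooth f -> L2D f. Proof. by move=> /smooth_continuous; exact: l2D_continuous. Qed.
Let sS f : smooth f -> L2S f. Proof. by move=> /smooth_continuous; exact: l2S_continuous. Qed.
Let spD f i : smooth f -> L2D (partial i f).
Proof. by move=> sf; apply: sD; exact: smooth_partial. Qed.

Lemma rtrace_smooth g : smooth g -> rtrace g (fun i => partial i g) g.
Proof.
move=> sg; split; [exact: sD|by move=> i; exact: spD|exact: sS|].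
exists (fun=> g); split=> [//||i|]; exact: l2cvg_cst.
Qed.

Lemma rtrace_lin (a b : R) u G f v H g : rtrace u G f -> rtrace v H g ->
  rtrace (fun x => a * u x + b * v x) (fun i x => a * G i x + b * H i x)
    (fun x => a * f x + b * g x).
Proof.
move=> [lu lG lf [w [sw cu cG cf]]] [lv lH lg [w' [sw' cv cH cg]]].
split.
- by apply: (l2D mD); exact: l2Z.
- by move=> i; apply: (l2D mD); exact: l2Z.
- by apply: (l2D mB); exact: l2Z.
exists (fun k x => a * w k x + b * w' k x); split.
- by move=> k; exact: smooth_lin.
- apply: (l2cvg_lin mD); [by move=> k; exact: sD|exact: lu|by move=> k; exact: sD|exact: lv|exact: cu|exact: cv].
- move=> i; rewrite (_ : (fun k => _) =
    (fun k x => a * partial i (w k) x + b * partial i (w' k) x)); last first.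
    by apply/funext => k; rewrite partial_lin.
  apply: (l2cvg_lin mD); [by move=> k; exact: spD|exact: lG|by move=> k; exact: spD|exact: lH|exact: cG|exact: cH].
- apply: (l2cvg_lin mB); [by move=> k; exact: sS|exact: lf|by move=> k; exact: sS|exact: lg|exact: cf|exact: cg].
Qed.

(** Diagonal argument: one smooth function within [1 / (k + 1)] of the [k]-th function, of its
    gradient and of the common trace at once. *)
Lemma rtrace_closed (u_ : nat -> E -> R) (G_ : nat -> 'I_n -> E -> R) u G f :
  (forall k, rtrace (u_ k) (G_ k) f) -> L2D u -> (forall i, L2D (G i)) ->
  l2cvg leb D (u_ : nat -> LT -> R) u ->
  (forall i, l2cvg leb D (fun k => G_ k i : LT -> R) (G i)) -> rtrace u G f.
Proof.
move=> tr lu lG cu cG; have lf : L2S f by case: (tr 0%N).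
have /choice[w hw] : forall k, exists w : E -> R, [/\ smooth w,
    ipD (fun x => w x - u_ k x) (fun x => w x - u_ k x) <= k.+1%:R^-1,
    forall i, ipD (fun x => partial i w x - G_ k i x) (fun x => partial i w x - G_ k i x)
      <= k.+1%:R^-1 &
    ipS (fun x => w x - f x) (fun x => w x - f x) <= k.+1%:R^-1].
  move=> k; have [_ _ _ [w [sw /l2cvgP c1 c2 /l2cvgP c3]]] := tr k.
  have k0 : 0 < k.+1%:R^-1 :> R by rewrite invr_gt0.
  have [N1 h1] := c1 _ k0; have [N3 h3] := c3 _ k0.
  have /choice[N2 h2] : forall i, exists N, forall m, (N <= m)%N ->
      ipD (fun x => partial i (w m) x - G_ k i x)
          (fun x => partial i (w m) x - G_ k i x) <= k.+1%:R^-1.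
    by move=> i; have /l2cvgP := c2 i; apply.
  pose N := (maxn (maxn N1 N3) (\max_(i < n) N2 i))%N.
  exists (w N); split => //.
  - by apply: h1; rewrite !leq_max leqnn.
  - by move=> i; apply: h2; rewrite leq_max (leq_bigmax i) orbT.
  - by apply: h3; rewrite !leq_max leqnn orbT.
split=> //; exists w; split.
- by move=> k; have [] := hw k.
- apply: (l2cvg_cauchy mD _ lu cu) => k; have [sw h _ _] := hw k => //; first by case: (tr k).
  exact: sD.
- move=> i; apply: (l2cvg_cauchy mD _ (lG i) (cG i)) => k; have [sw _ h _] := hw k => //.
    by case: (tr k).
  exact: spD.
- apply: (l2cvg_cauchy mB (fun=> lf) lf (l2cvg_cst _ _ _)) => k; have [sw _ _ h] := hw k => //.
  exact: sS.
Qed.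

(** The boundary term is controlled as soon as one factor is: [w] tends to 0 on the boundary in
    [green_zero_trace], and [h] vanishes there in [weak_derivative]. *)
Lemma green_bound w h i : smooth w -> smooth h ->
  `|ipD (partial i w) h + ipD w (partial i h)| <=
    2 * K * \int[surf]_(x in bdry D) `|w x * h x|.
Proof.
move=> sw sh; have swh := smooth_mul sw sh.
have := @divergence_bound R n n_ge2 D i M oD DM Hfin (fun x => w x * h x)
  (partial i (fun x => w x * h x)) (fun x => smooth_is_derive x i swh)
  (smooth_continuous swh) (smooth_continuous (smooth_partial i swh)).
rewrite partial_mul//; congr (`| _ | <= _).
rewrite /ip -RintegralD//.
- by apply: (l2_integrable mD); [exact: spD|exact: sD].
- by apply: (l2_integrable mD); [exact: sD|exact: spD].
Qed.

Lemma Rintegral_abs_mul_le w h : smooth w -> smooth h ->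
  \int[surf]_(x in bdry D) `|w x * h x| <= Num.sqrt (ipS w w) * Num.sqrt (ipS h h).
Proof.
move=> sw sh.
have l1 : L2S (fun x => `|w x|) by apply: l2S_continuous; exact: continuous_norm_comp (smooth_continuous sw).
have l2' : L2S (fun x => `|h x|) by apply: l2S_continuous; exact: continuous_norm_comp (smooth_continuous sh).
have sq f : ipS (fun x => `|f x|) (fun x => `|f x|) = ipS f f.
  rewrite /ip; congr fine; apply: eq_integral => x _.
  by rewrite -!expr2 (real_normK (num_real _)).
have := abs_ip_le mB l1 l2'; rewrite !sq; apply: le_trans.
apply: le_trans (ler_norm _); rewrite le_eqVlt; apply/orP; left; apply/eqP.
by rewrite /ip; congr fine; apply: eq_integral => x _; rewrite normrM.
Qed.

(** The zero trace takes over the role of compact support: [h] is any smooth function, in particular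
    a derivative of a dipole. *)
Lemma green_zero_trace v H h i : rtrace v H (fun=> 0) -> smooth h ->
  ipD (H i) h = - ipD v (partial i h).
Proof.
move=> [lv lH l0 [w [sw cv cH c0]]] sh; apply/eqP; rewrite -subr_eq0 opprK -normr_le0.
apply/ler_addgt0Pr => e e0; rewrite add0r.
have e3 : 0 < e / 3 by rewrite divr_gt0.
have [N1 h1] := l2cvg_ip mD (fun k => spD i (sw k)) (lH i) (sD sh) (cH i) e3.
have [N2 h2] := l2cvg_ip mD (fun k => sD (sw k)) lv (spD i sh) cv e3.
have Kp : 0 < K := thick_const_gt0.
pose q := Num.sqrt (ipS h h) + 1; have q0 : 0 < q by rewrite ltr_wpDl// sqrtr_ge0.
pose r := e / 3 / (2 * K * q); have r0 : 0 < r.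
  by rewrite /r; apply: divr_gt0 => //; apply: mulr_gt0 => //; apply: mulr_gt0.
have /l2cvgP /(_ _ (exprn_gt0 2 r0)) [N3 h3] := c0.
pose k := maxn N1 (maxn N2 N3).
have {}h1 := h1 k (leq_maxl _ _).
have {}h2 := h2 k (leq_trans (leq_maxl _ _) (leq_maxr _ _)).
have {h3} := h3 k (leq_trans (leq_maxr _ _) (leq_maxr _ _)).
rewrite (@eq_ip _ _ _ surf (bdry D) _ _ (w k) (w k)); try by move=> x _; rewrite subr0.
move=> h3; have h3' : Num.sqrt (ipS (w k) (w k)) <= r.
  by rewrite -[r]ger0_norm ?(ltW r0)// -sqrtr_sqr ler_wsqrtr.
have K2 : 0 <= 2 * K by apply: mulr_ge0 => //; exact: ltW.
have h4 := le_trans (green_bound i (sw k) sh) (ler_wpM2l K2 (Rintegral_abs_mul_le (sw k) sh)).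
have h5 : `|ipD (partial i (w k)) h + ipD (w k) (partial i h)| <= e / 3.
  apply: (le_trans h4).
  have -> : e / 3 = 2 * K * (r * q) by rewrite /r; field; rewrite !lt0r_neq0.
  rewrite ler_pM2l; last by apply: mulr_gt0.
  by apply: ler_pM; rewrite ?sqrtr_ge0// lerDl.
move: h1 h2 h5.
move: (ipD (partial i (w k)) h) (ipD (w k) (partial i h)) (ipD (H i) h) (ipD v _) => a b c d.
rewrite !ler_norml => /andP[? ?] /andP[? ?] /andP[? ?]; apply/andP; split; lra.
Qed.

Lemma weak_derivative u G f h i : rtrace u G f -> smooth h ->
  (forall x, bdry D x -> h x = 0) -> ipD u (partial i h) = - ipD (G i) h.
Proof.
move=> [lu lG lf [w [sw cu cG cf]]] sh hb; apply/eqP; rewrite -subr_eq0 opprK -normr_le0.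
apply/ler_addgt0Pr => e e0; rewrite add0r.
have e2 : 0 < e / 2 by rewrite divr_gt0.
have [N1 h1] := l2cvg_ip mD (fun k => spD i (sw k)) (lG i) (sD sh) (cG i) e2.
have [N2 h2] := l2cvg_ip mD (fun k => sD (sw k)) lu (spD i sh) cu e2.
pose k := maxn N1 N2.
have {}h1 := h1 k (leq_maxl _ _).
have {}h2 := h2 k (leq_maxr _ _).
have := green_bound i (sw k) sh.
rewrite (_ : \int[surf]_(x in bdry D) `|w k x * h x| = 0); last first.
  rewrite /Rintegral (integral0_eq)// => x Bx.
  by rewrite hb// mulr0 normr0.
rewrite mulr0 => h5; move: h1 h2 h5.
move: (ipD (partial i (w k)) h) (ipD (w k) (partial i h)) (ipD (G i) h) (ipD u _) => a b c d.
rewrite !ler_norml => /andP[? ?] /andP[? ?] /andP[? ?]; apply/andP; split; lra.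
Qed.

(* Green's formula for [w] and [x_j w]. *)
Lemma poincare_smooth w j : smooth w ->
  ipD w w <= 4 * (M ^+ 2 * ipD (partial j w) (partial j w)) + 4 * (K * `|M| * ipS w w).
Proof.
move=> sw.
have sx := smooth_coord (R := R) j; have sxw := smooth_mul sx sw.
have xM (x : E) : cbox (- const_mx M) (const_mx M) x -> `|x 0 j| <= `|M|.
  by move=> /(_ j); rewrite !mxE -ler_norml => /le_trans; apply; exact: ler_norm.
have := green_bound j sw sxw.
have -> : ipD w (partial j (fun x => x 0 j * w x)) =
    ipD w w + ipD (partial j w) (fun x => x 0 j * w x).
  rewrite partial_mul// partial_coord eqxx.
  rewrite ipDr; [|exact: mD|by apply: sD; exact: smooth_mul (smooth_cst _) sw|
    by apply: sD; exact: smooth_mul sx (smooth_partial j sw)|exact: sD].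
  congr (_ + _); first by apply: eq_ip => // x _; rewrite mul1r.
  by rewrite /ip; congr fine; apply: eq_integral => x _; congr EFin; ring.
set A := ipD w w; set P := ipD (partial j w) _; set S := \int[_]_(_ in _) _ => h.
have SB : S <= `|M| * ipS w w.
  rewrite /S -ipZl; [|exact: mB|exact: sS|exact: sS].
  apply: le_Rintegral => //.
  - have := integrable_surf DM Hfin (smooth_continuous (smooth_mul sw sxw)).
    exact: integrable_norm.
  - by apply: (l2_integrable mB); [apply: (l2Z mB); exact: sS|exact: sS].
  move=> x [Dx _]; rewrite normrM normrM mulrCA -mulrA.
  apply: ler_pM => //; first exact: xM (closure_cbox Dx).
  by rewrite -normrM -expr2 ger0_norm ?sqr_ge0// expr2.
have lpw := spD j sw; have lw := sD sw; have lxw := sD sxw.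
have lxp : L2D (fun x => x 0 j * partial j w x) by apply: sD; exact: smooth_mul sx (smooth_partial j sw).
have PE : P = ipD (fun x => x 0 j * partial j w x) w.
  by rewrite /P /ip; congr fine; apply: eq_integral => x _; congr EFin; ring.
have XB : ipD (fun x => x 0 j * partial j w x) (fun x => x 0 j * partial j w x) <=
    M ^+ 2 * ipD (partial j w) (partial j w).
  rewrite -(real_normK (num_real M)); apply: (ip_le mD) => //.
  by move=> x Dx; rewrite normrM ler_wpM2r// xM//; exact: DM.
(* Green's formula gives [A + 2 * P <= 2 * K * S]; Young's inequality bounds [- 2 * P] by half of
   [A], which is absorbed, plus a gradient term. *)
have PB : - (4 * P) <= A + 4 * ipD (fun x => x 0 j * partial j w x) (fun x => x 0 j * partial j w x).
  by rewrite PE; exact: (ip_young mD lw lxp).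
have Kp : 0 < K := thick_const_gt0.
have SB' := ler_wpM2l (ltW Kp) SB.
move: h; rewrite ler_norml => /andP[_ h].
rewrite -[K * `|M| * _]mulrA.
move: h SB' PB XB; rewrite -[2 * K * S]mulrA {PE}.
move: A P (K * S) (K * (_ * _)) (M ^+ 2 * _) (ipD _ _) => A P a b c d.
by lra.
Qed.

(** Applied to differences of a minimising sequence, it controls the functions by their gradients.
    The factor 16 is the 4 of the smooth case times 2 for each of the two passages to the limit. *)
Lemma poincare v H j : rtrace v H (fun=> 0) -> ipD v v <= 16 * M ^+ 2 * ipD (H j) (H j).
Proof.
move=> [lv lH l0 [w [sw cv cH c0]]]; apply/ler_addgt0Pr => e e0.
have Kp : 0 < K := thick_const_gt0.
pose q := 8 * M ^+ 2 + 8 * (K * `|M|) + 1.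
have M2 := sqr_ge0 M.
have KM : 0 <= K * `|M| by rewrite mulr_ge0// ltW.
have q0 : 0 < q by rewrite /q; lra.
have eq0 : 0 < e / 2 / q by rewrite divr_gt0// divr_gt0.
have [N1 h1] := l2cvg_near mD (fun k => sD (sw k)) lv cv eq0.
have [N2 h2] := l2cvg_near mD (fun k => spD j (sw k)) (lH j) (cH j) eq0.
have /l2cvgP /(_ _ eq0) [N3 h3] := c0.
pose k := maxn N1 (maxn N2 N3).
have [{}h1 _] := h1 k (leq_maxl _ _).
have [_ {}h2] := h2 k (leq_trans (leq_maxl _ _) (leq_maxr _ _)).
have {h3} := h3 k (leq_trans (leq_maxr _ _) (leq_maxr _ _)).
rewrite (@eq_ip _ _ _ surf (bdry D) _ _ (w k) (w k)); try by move=> x _; rewrite subr0.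
move=> h3; have := poincare_smooth j (sw k).
have qe : e / 2 / q * q = e / 2 by rewrite divfK// lt0r_neq0.
move: h1 h2 h3 qe; rewrite /q; move: M2 KM e0; clear.
move: (ipD v v) (ipD (w k) (w k)) (ipD (H j) (H j)) (ipD _ _) (ipS _ _) (e / 2 / _).
move: (M ^+ 2) (K * `|M|) => m p a b c d s r m0 p0 e0 h1 h2 h3 qe h4.
have h5 := ler_wpM2l m0 h2.
have h6 := ler_wpM2l p0 h3.
lra.
Qed.

End traces.

(** * Vector fields with a weighted inner product *)

Section vector_fields.
Context d (T : measurableType d) (R : realType) (mu : {measure set T -> \bar R})
  (D : set T) (mD : measurable D) (n : nat).
Local Notation l2 := (l2 mu D).
Local Notation ip := (ip mu D).
Implicit Types (G H V W : 'I_n -> T -> R).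

Definition vl2 G := forall i, l2 (G i).
(** Apart from gradients, with [n = 2] it also pairs real and imaginary parts in
    [sum_coefficients_le]. *)
Definition vip G H : R := \sum_(i < n) ip (G i) (H i).

Lemma vl2Z (a : R) G : vl2 G -> vl2 (fun i x => a * G i x).
Proof. by move=> lG i; exact: l2Z. Qed.

Lemma vl2B G H : vl2 G -> vl2 H -> vl2 (fun i x => G i x - H i x).
Proof. by move=> lG lH i; exact: l2B. Qed.

Lemma vipC G H : vip G H = vip H G.
Proof. by apply: eq_bigr => i _; rewrite ipC. Qed.

Lemma vip_ge0 G : 0 <= vip G G.
Proof. by apply: sumr_ge0 => i _; exact: ip_ge0. Qed.

Lemma eq_vip G H G' H' : (forall i x, D x -> G i x = G' i x) ->
  (forall i x, D x -> H i x = H' i x) -> vip G H = vip G' H'.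
Proof. by move=> eG eH; apply: eq_bigr => i _; apply: eq_ip; auto. Qed.

Lemma vip_comp_le G i : ip (G i) (G i) <= vip G G.
Proof.
by rewrite /vip (bigD1 i)//= lerDl; apply: sumr_ge0 => j _; exact: ip_ge0.
Qed.

Lemma vipDl G V H : vl2 G -> vl2 V -> vl2 H ->
  vip (fun i x => G i x + V i x) H = vip G H + vip V H.
Proof. by move=> lG lV lH; rewrite /vip -big_split; apply: eq_bigr => i _; exact: ipDl. Qed.

Lemma vipBl G V H : vl2 G -> vl2 V -> vl2 H ->
  vip (fun i x => G i x - V i x) H = vip G H - vip V H.
Proof. by move=> lG lV lH; rewrite /vip -sumrB; apply: eq_bigr => i _; exact: ipBl. Qed.

Lemma vipZl (a : R) G H : vl2 G -> vl2 H -> vip (fun i x => a * G i x) H = a * vip G H.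
Proof. by move=> lG lH; rewrite /vip mulr_sumr; apply: eq_bigr => i _; exact: ipZl. Qed.

Lemma vip_sqB (t : R) G H : vl2 G -> vl2 H ->
  vip (fun i x => G i x - t * H i x) (fun i x => G i x - t * H i x) =
  vip G G - 2 * t * vip G H + t ^+ 2 * vip H H.
Proof.
move=> lG lH; have ltH := vl2Z t lH; have lGH := vl2B lG ltH.
have e V : vl2 V -> vip (fun i x => G i x - t * H i x) V = vip G V - t * vip H V.
  by move=> lV; rewrite -vipZl// -vipBl.
by rewrite e// vipC e// [X in _ - _ * X]vipC e// (vipC H G); ring.
Qed.

Lemma vip_CS G H : vl2 G -> vl2 H -> vip G H ^+ 2 <= vip G G * vip H H.
Proof.
move=> lG lH; apply: quadratic_discr; last exact: vip_ge0.
by move=> t; rewrite -vip_sqB//; exact: vip_ge0.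
Qed.

Lemma abs_vip_le G H : vl2 G -> vl2 H ->
  `|vip G H| <= Num.sqrt (vip G G) * Num.sqrt (vip H H).
Proof.
by move=> lG lH; rewrite -sqrtrM ?vip_ge0// -sqrtr_sqr ler_wsqrtr//; exact: vip_CS.
Qed.

Section weighted.
Variables (gamma : T -> R) (g0 g1 : R).
Hypotheses (mg : measurable_fun D gamma) (g0_gt0 : 0 < g0)
  (g0_le : forall x, D x -> g0 <= gamma x) (g1_ge : forall x, D x -> gamma x <= g1).
Local Notation wt := (fun G i x => gamma x * G i x).

Lemma vl2_weight G : vl2 G -> vl2 (wt G).
Proof.
move=> lG i; apply: (l2M mD (c := g1)) => // x Dx.
by rewrite ger0_norm ?g1_ge//; apply: le_trans (g0_le Dx); exact: ltW.
Qed.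

Lemma vip_weightC G H : vip (wt G) H = vip (wt H) G.
Proof.
by apply: eq_bigr => i _; rewrite /ip; congr fine; apply: eq_integral => x _; congr EFin; ring.
Qed.

Lemma vip_weight_ge G : vl2 G -> g0 * vip G G <= vip (wt G) G.
Proof.
move=> lG; rewrite -vipZl//; apply: ler_sum => i _.
apply: le_Rintegral => //; [apply: l2_integrable => //; exact: l2Z|
  by apply: l2_integrable => //; exact: vl2_weight|].
by move=> x Dx; rewrite -!mulrA ler_wpM2r ?g0_le// -expr2 sqr_ge0.
Qed.

Lemma vip_weight_sqB (t : R) G H : vl2 G -> vl2 H ->
  vip (wt (fun i x => G i x - t * H i x)) (fun i x => G i x - t * H i x) =
  vip (wt G) G - 2 * t * vip (wt G) H + t ^+ 2 * vip (wt H) H.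
Proof.
move=> lG lH; have ltH := vl2Z t lH; have lGH := vl2B lG ltH.
have wG := vl2_weight lG; have wH := vl2_weight lH.
have e V : vl2 V -> vip (wt (fun i x => G i x - t * H i x)) V = vip (wt G) V - t * vip (wt H) V.
  move=> lV; rewrite -vipZl// -vipBl//; last exact: vl2Z.
  by apply: eq_vip => // i x _; ring.
rewrite e// vip_weightC e// [X in _ - _ * X]vip_weightC e// (vip_weightC H G); ring.
Qed.

(* [V] is a trial field of unit norm, [c] the value of the weight at the point
   where [V] concentrates, [G] the field of least energy. *)
Lemma energy_concentration (c t : R) G V : vl2 G -> vl2 V -> 0 <= t -> vip V V = 1 ->
  vip V (fun i x => G i x - V i x) = 0 -> vip (wt G) (fun i x => G i x - V i x) = 0 ->
  vip (fun i x => (gamma x - c) * V i x) (fun i x => (gamma x - c) * V i x) <= t ^+ 2 ->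
  `|vip (wt G) G - c| <= t + t ^+ 2 / g0.
Proof.
move=> lG lV t0 V1 VW GW tV; pose W := fun i x => G i x - V i x.
have lW : vl2 W by exact: vl2B.
pose F := fun i x => (gamma x - c) * V i x.
have lF : vl2 F.
  rewrite (_ : F = fun i x => gamma x * V i x - c * V i x).
    by apply: vl2B; [exact: vl2_weight|exact: vl2Z].
  by apply/funext => i; apply/funext => x; rewrite /F mulrBl.
have FH H : vl2 H -> vip F H = vip (wt V) H - c * vip V H.
  move=> lH; rewrite -vipZl// -vipBl//; [|exact: vl2_weight|exact: vl2Z].
  by apply: eq_vip => // i x _; rewrite /F; ring.
have sF : Num.sqrt (vip F F) <= t by rewrite -[t]ger0_norm// -sqrtr_sqr ler_wsqrtr.
have FV : `|vip F V| <= t.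
  by apply: le_trans (abs_vip_le lF lV) _; rewrite V1 sqrtr1 mulr1.
pose s := Num.sqrt (vip W W); have s0 : 0 <= s by exact: sqrtr_ge0.
have FW : `|vip F W| <= t * s.
  by apply: le_trans (abs_vip_le lF lW) _; apply: ler_wpM2r.
have FWe : vip F W = vip (wt V) W by rewrite FH// VW mulr0 subr0.
have GVW : vip (wt G) W = vip (wt V) W + vip (wt W) W.
  rewrite -vipDl//; [|exact: vl2_weight..].
  by apply: eq_vip => // i x _; rewrite /W; ring.
(* Coercivity: orthogonality of [W] to [gamma G] turns the weighted energy of [W] into minus the
   pairing of [gamma V] with [W], and orthogonality to [V] replaces [gamma] by [gamma - c] there. *)
have sW : g0 * s ^+ 2 <= t * s.
  rewrite sqr_sqrtr ?vip_ge0//; apply: le_trans (vip_weight_ge lW) _.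
  apply: le_trans FW; rewrite FWe; move: GVW; rewrite GW => /esym/eqP.
  by rewrite addr_eq0 => /eqP->; rewrite normrN ler_norm.
have st : s <= t / g0.
  rewrite ler_pdivlMr// mulrC; have [s_gt0|] := ltP 0 s.
    by move: sW; rewrite expr2 mulrA ler_pM2r.
  by move=> s_le0; apply: le_trans t0; rewrite pmulr_rle0.
(* [G] may be replaced by [V] in one argument because [gamma G] is orthogonal to [W]; the other [G]
   is then split as [V + W], and [c] is absorbed by the unit norm of [V]. *)
have -> : vip (wt G) G - c = vip F V + vip F W.
  have -> : vip (wt G) G = vip (wt G) V.
    move: GW; rewrite vipC vipBl//; last exact: vl2_weight.
    by rewrite vipC => /eqP; rewrite subr_eq0 => /eqP->; exact: vipC.
  rewrite FWe FH// V1 mulr1 -addrA [_ + vip _ W]addrC addrA; congr (_ - _).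
  rewrite vip_weightC (vipC _ W) vipBl//; last exact: vl2_weight.
  by rewrite vipC (vipC V); ring.
apply: le_trans (ler_normD _ _) _; apply: lerD => //.
apply: le_trans FW _; rewrite expr2 -mulrA; exact: ler_wpM2l.
Qed.

End weighted.
End vector_fields.

Lemma l2cvg_vip d (T : measurableType d) (R : realType) (mu : {measure set T -> \bar R})
    (D : set T) (mD : measurable D) n (G_ : nat -> 'I_n -> T -> R) (G H : 'I_n -> T -> R) :
  (forall k, vl2 mu D (G_ k)) -> vl2 mu D G -> vl2 mu D H ->
  (forall i, l2cvg mu D (fun k => G_ k i) (G i)) ->
  forall e : R, 0 < e -> exists N, forall k, (N <= k)%N ->
    `|vip mu D (G_ k) H - vip mu D G H| <= e.
Proof.
move=> lG_ lG lH cG e e0; have n1 : 0 < n.+1%:R :> R by rewrite ltr0n.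
have /choice[N hN] : forall i, exists N, forall k, (N <= k)%N ->
    `|ip mu D (G_ k i) (H i) - ip mu D (G i) (H i)| <= e / n.+1%:R.
  by move=> i; exact: (l2cvg_ip mD (fun k => lG_ k i) (lG i) (lH i) (cG i) (divr_gt0 e0 n1)).
exists (\max_(i < n) N i)%N => k Nk; rewrite /vip -sumrB.
apply: le_trans (ler_norm_sum _ _ _) _.
apply: (@le_trans _ _ (\sum_(i < n) e / n.+1%:R)).
  by apply: ler_sum => i _; apply: hN; apply: leq_trans Nk; exact: leq_bigmax.
rewrite sumr_const card_ord -[_ *+ n]mulr_natr mulrAC ler_pdivrMr//.
by rewrite ler_wpM2l ?(ltW e0)// ler_nat.
Qed.

(** * Existence of weak solutions *)

Section existence.
Context {R : realType} {n : nat}.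
Hypothesis n_ge2 : (2 <= n)%N.
Local Notation E := 'rV[R]_n.
Local Notation leb := (@lebesgue_rV R n).
Local Notation LT := (caratheodory_type (@lebesgue_om R n)).
Local Notation surf := (@hausdorff R n n.-1).
Local Notation HT := (caratheodory_type (@hausdorff_om R n n.-1)).
Variables (D : set E) (M : R) (gamma : E -> R) (g0 g1 : R).
Hypotheses (oD : open D) (DM : D `<=` cbox (- const_mx M) (const_mx M))
  (Hfin : (@hausdorff_outer R n n.-1 (bdry D) < +oo)%E)
  (mg : measurable_fun (D : set LT) (gamma : LT -> R)) (g0_gt0 : 0 < g0)
  (g0_le : forall x, D x -> g0 <= gamma x) (g1_ge : forall x, D x -> gamma x <= g1).
Local Notation L2D := (@l2 _ LT R leb D).
Local Notation ipD := (@ip _ LT R leb D).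
Local Notation vipD := (@vip _ LT R leb D n).
Local Notation wt := (fun (G : 'I_n -> E -> R) i x => gamma x * G i x).
Implicit Types (u v f : E -> R) (G H : 'I_n -> E -> R).

Let mD : measurable (D : set LT). Proof. exact: leb_measurable_open. Qed.

Lemma weak_solution u1 G1 f : rtrace D u1 G1 f -> exists u G, rtrace D u G f /\
  forall v H, rtrace D v H (fun=> 0) -> vipD (wt G) H = 0.
Proof.
move=> tr1.
pose S := [set z | exists u G, rtrace D u G f /\ z = vipD (wt G) G].
have S0 : S !=set0 by exists (vipD (wt G1) G1), u1, G1.
have wge G : vl2 leb D G -> g0 * vipD G G <= vipD (wt G) G.
  by move=> lG; exact: (vip_weight_ge mD mg g0_gt0 g0_le g1_ge lG).
have lS u G h : rtrace D u G h -> vl2 leb D (G : 'I_n -> LT -> R) by case.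
have Slb : lbound S 0.
  move=> _ [u [G [tr ->]]]; apply: le_trans (wge _ (lS _ _ _ tr)).
  by apply: mulr_ge0; [exact: ltW|exact: vip_ge0].
have infS : has_inf S by split => //; exists 0.
pose m := inf S.
have mle u G : rtrace D u G f -> m <= vipD (wt G) G.
  by move=> tr; apply: ge_inf; [exists 0|exists u, G].
have /choice[w_ hw] : forall k, exists w : (E -> R) * ('I_n -> E -> R),
    rtrace D w.1 w.2 f /\ vipD (wt w.2) w.2 <= m + k.+1%:R^-1.
  move=> k; have k0 : 0 < k.+1%:R^-1 :> R by rewrite invr_gt0.
  have [_ [u [G [tr ->]]] /ltW h] := inf_adherent k0 infS.
  by exists (u, G).
pose u_ k := (w_ k).1; pose G_ k := (w_ k).2.
have tr_ k : rtrace D (u_ k) (G_ k) f by case: (hw k).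
have J_ k : vipD (wt (G_ k)) (G_ k) <= m + k.+1%:R^-1 by case: (hw k).
have lG_ k : vl2 leb D (G_ k : 'I_n -> LT -> R) := lS _ _ _ (tr_ k).
have sqB t (G H : 'I_n -> LT -> R) : vl2 leb D G -> vl2 leb D H ->
    vipD (wt (fun i x => G i x - t * H i x)) (fun i x => G i x - t * H i x) =
    vipD (wt G) G - 2 * t * vipD (wt G) H + t ^+ 2 * vipD (wt H) H.
  by move=> lG lH; exact: (vip_weight_sqB mD mg g0_gt0 g0_le g1_ge t lG lH).
(* Parallelogram identity: the midpoint of two near-minimisers has the same trace, hence energy at
   least [m], so their difference has small energy. *)
have GC k l : g0 * vipD (fun i x => G_ k i x - G_ l i x) (fun i x => G_ k i x - G_ l i x)
    <= 2 * (k.+1%:R^-1 + l.+1%:R^-1).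
  have lGkl : vl2 leb D (fun i (x : LT) => G_ k i x - G_ l i x) by exact: vl2B.
  apply: le_trans (wge _ lGkl) _.
  have h1 := sqB 1 _ _ (lG_ k) (lG_ l).
  have h2 := sqB (-1) _ _ (lG_ k) (lG_ l).
  have trm := rtrace_lin oD DM Hfin 2^-1 2^-1 (tr_ k) (tr_ l).
  have h3 : m <= 4^-1 * vipD (wt (fun i x => G_ k i x - -1 * G_ l i x))
                             (fun i x => G_ k i x - -1 * G_ l i x).
    rewrite -[X in _ <= X](_ : vipD (wt (fun i x => 2^-1 * G_ k i x + 2^-1 * G_ l i x))
      (fun i x => 2^-1 * G_ k i x + 2^-1 * G_ l i x) = _).
      apply: (mle (fun x => 2^-1 * u_ k x + 2^-1 * u_ l x)).
      by move: trm; congr (rtrace D _ _ _); apply/funext => x; field.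
    have lsum : vl2 leb D (fun i (x : LT) => G_ k i x - -1 * G_ l i x).
      have lZ := vl2Z mD (-1) (lG_ l).
      by have := vl2B mD (lG_ k) lZ.
    have lw := vl2_weight mD mg g0_gt0 g0_le g1_ge lsum.
    rewrite -(vipZl mD 4^-1 lw lsum).
    by rewrite /vip; apply: eq_bigr => i _; rewrite /ip; congr fine;
      apply: eq_integral => x _; congr EFin; field.
  have -> : vipD (wt (fun i x => G_ k i x - G_ l i x)) (fun i x => G_ k i x - G_ l i x) =
      vipD (wt (fun i x => G_ k i x - 1 * G_ l i x)) (fun i x => G_ k i x - 1 * G_ l i x).
    by apply: eq_vip => i x _; rewrite mul1r.
  have := J_ k; have := J_ l; move: h1 h2 h3; clear.
  move: (vipD _ _) (vipD _ _) (vipD _ _) (vipD _ _) (vipD _ _) (k.+1%:R^-1) (l.+1%:R^-1) => *; lra.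
have tr0 k l : rtrace D (fun x => u_ k x - u_ l x) (fun i x => G_ k i x - G_ l i x) (fun=> 0).
  have := rtrace_lin oD DM Hfin 1 (-1) (tr_ k) (tr_ l).
  by congr (rtrace D _ _ _); apply/funext => x; [|apply/funext => y|]; ring.
pose j0 : 'I_n := Ordinal (ltnW n_ge2).
have small (c e : R) : 0 <= c -> 0 < e -> exists N, forall k l, (N <= k)%N -> (N <= l)%N ->
    c * (2 * (k.+1%:R^-1 + l.+1%:R^-1)) <= e.
  move=> c0 e0; have e1 : 0 < e / (4 * (c + 1)).
    by apply: divr_gt0 => //; apply: mulr_gt0 => //; rewrite ltr_wpDl.
  have [N _ hN] := near_infty_natSinv_lt (PosNum e1).
  exists N => k l Nk Nl; have hk := ltW (hN k Nk); have hl := ltW (hN l Nl).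
  apply: (@le_trans _ _ ((c + 1) * (2 * (e / (4 * (c + 1)) + e / (4 * (c + 1)))))).
    apply: ler_pM; [exact: c0| |by rewrite lerDl|by apply: ler_wpM2l => //; exact: lerD].
    by apply: mulr_ge0 => //; apply: addr_ge0; rewrite invr_ge0.
  rewrite le_eqVlt; apply/orP; left; apply/eqP; field.
  by rewrite lt0r_neq0// ltr_wpDl.
have GC' i k l : ipD (fun x => G_ k i x - G_ l i x) (fun x => G_ k i x - G_ l i x) <=
    g0^-1 * (2 * (k.+1%:R^-1 + l.+1%:R^-1)).
  rewrite ler_pdivlMl//; apply: le_trans (GC k l).
  by apply: ler_wpM2l; [exact: ltW|exact: (vip_comp_le leb D (fun i (x : LT) => G_ k i x - G_ l i x))].
have g0V : 0 <= g0^-1 by rewrite invr_ge0 ltW.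
have lu k : L2D (u_ k) by case: (tr_ k).
(* The energy only controls gradients; the functions themselves are Cauchy by Poincare's inequality,
   in an arbitrary direction [j0]. *)
have [u [lu' cu]] : exists u, L2D u /\ l2cvg leb D (u_ : nat -> LT -> R) u.
  apply: (L2_complete mD) => // e e0.
  have M2 : 0 <= 16 * M ^+ 2 * g0^-1.
    by apply: mulr_ge0 => //; apply: mulr_ge0 => //; exact: sqr_ge0.
  have [N hN] := small _ e M2 e0; exists N => k l Nk Nl.
  apply: le_trans (poincare n_ge2 oD DM Hfin j0 (tr0 k l)) _.
  apply: le_trans (hN k l Nk Nl); rewrite -[_ * g0^-1 * _]mulrA.
  by apply: ler_wpM2l; [by apply: mulr_ge0 => //; exact: sqr_ge0|exact: GC'].
have /choice[G hG] : forall i, exists Gi, L2D Gi /\ l2cvg leb D (fun k => G_ k i : LT -> R) Gi.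
  move=> i; apply: (L2_complete mD) => [k|e e0]; first exact: lG_.
  have [N hN] := small _ e g0V e0; exists N => k l Nk Nl.
  exact: le_trans (GC' i k l) (hN k l Nk Nl).
have lG : vl2 leb D (G : 'I_n -> LT -> R) by move=> i; case: (hG i).
exists u, G; split.
  by apply: (rtrace_closed oD DM Hfin tr_ lu' lG cu) => i; case: (hG i).
move=> v H tv; have lH : vl2 leb D (H : 'I_n -> LT -> R) := lS _ _ _ tv.
have lwH := vl2_weight mD mg g0_gt0 g0_le g1_ge lH.
have cB e : 0 < e -> exists N, forall k, (N <= k)%N ->
    `|vipD (wt (G_ k)) H - vipD (wt G) H| <= e.
  move=> e0; have [N hN] := l2cvg_vip mD lG_ lG lwH (fun i => (hG i).2) e0.
  by exists N => k /hN; rewrite !(vip_weightC leb D gamma _ H) !(vipC leb D (wt H)).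
have wH0 : 0 <= vipD (wt H) H.
  by apply: le_trans (wge _ lH); apply: mulr_ge0; [exact: ltW|exact: vip_ge0].
(* Comparing the energy of [G_ k] with that of [G_ k - t H] gives, in the limit,
   [0 <= - 2 * t * b + t ^ 2 * c] for all [t], where [b] is the pairing to be shown zero. This is
   [quadratic_discr] with [a = 0]. *)
apply/eqP; rewrite -sqrf_eq0 eq_le sqr_ge0 andbT -(mul0r (vipD (wt H) H)).
apply: quadratic_discr => // t; apply/ler_addgt0Pr => e e0; rewrite sub0r.
have e2 : 0 < e / 2 by rewrite divr_gt0.
have t1 : 0 < `|2 * t| + 1 by rewrite ltr_wpDl.
have [N1 hN1] := small 2^-1 _ (ltac:(by rewrite invr_ge0)) e2.
have [N2 hN2] := cB _ (divr_gt0 e2 t1).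
pose k := maxn N1 N2.
have h1 := hN1 k k (leq_maxl _ _) (leq_maxl _ _).
have h2 := hN2 k (leq_maxr _ _).
have h3 : m <= vipD (wt (fun i x => G_ k i x - t * H i x)) (fun i x => G_ k i x - t * H i x).
  apply: (mle (fun x => u_ k x - t * v x)).
  have := rtrace_lin oD DM Hfin 1 (- t) (tr_ k) tv.
  by congr (rtrace D _ _ _); apply/funext => x; [|apply/funext => y|]; ring.
rewrite sqB// in h3.
have h4 : `|2 * t * (vipD (wt (G_ k)) H - vipD (wt G) H)| <= e / 2.
  rewrite normrM; apply: le_trans (ler_wpM2l (normr_ge0 _) h2) _.
  apply: (@le_trans _ _ ((`|2 * t| + 1) * (e / 2 / (`|2 * t| + 1)))).
    by apply: ler_wpM2r; [rewrite ltW// divr_gt0|rewrite lerDl].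
  by rewrite mulrC divfK// lt0r_neq0.
have := J_ k; move: h1 h3 h4; rewrite ler_norml => h1 h3 /andP[h4 h5] h6.
move: h1 h3 h4 h5 h6; clear.
move: (vipD _ _) (vipD _ _) (vipD _ _) (vipD _ _) (k.+1%:R^-1) => *; lra.
Qed.

End existence.

(** * Lipschitz charts *)

Section enorm_topology.
Context {R : realType} {n : nat}.
Local Notation E := 'rV[R]_n.
Implicit Types (x y : E) (D : set E).

Lemma enorm_ocube x y (r : R) : 0 < r -> ocube x r y -> enorm (y - x) <= n%:R * r.
Proof.
move=> r0 xy; apply: enorm_le_coord; first exact: ltW.
by move=> i; rewrite !mxE distrC ltW.
Qed.

Lemma enorm_nbhs x (e : R) : 0 < e -> nbhs x [set y | enorm (y - x) < e].
Proof.
move=> e0; have n1 : 0 < n.+1%:R :> R by rewrite ltr0n.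
have r0 : 0 < e / n.+1%:R by rewrite divr_gt0.
apply: filterS (ocube_nbhs x r0) => y /(enorm_ocube r0) /le_lt_trans; apply.
by rewrite mulrCA gtr_pMr// ltr_pdivrMr// mul1r ltr_nat.
Qed.

Lemma bounded_cbox D : bounded_set D ->
  exists M : R, 0 < M /\ D `<=` cbox (- const_mx M) (const_mx M).
Proof.
move=> [M [_ hM]]; exists (`|M| + 1); split; first by rewrite ltr_wpDl.
have MM : M < `|M| + 1 by rewrite (le_lt_trans (ler_norm M))// ltrDl.
move=> x Dx i; rewrite !mxE -ler_norml.
apply: le_trans (hM _ MM x Dx); rewrite /Num.norm/= mx_normrE.
by apply: le_trans (le_bigmax _ (fun ij => `|x ij.1 ij.2|) (0, i)).
Qed.

End enorm_topology.

Section lipschitz_chart.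
Context {R : realType} {n' : nat}.
Local Notation n := n'.+1.
Local Notation E := 'rV[R]_n.
Local Notation leb := (@lebesgue_rV R n).
Local Notation surf := (@hausdorff R n n').
Variables (D : set E) (p nu : E) (phi : E -> R) (L r : R).
Hypotheses (oD : open D) (Dp : bdry D p) (nu1 : enorm nu = 1) (L0 : 0 <= L)
  (phiL : forall x y, `|phi x - phi y| <= L * enorm (x - y)) (r0 : 0 < r)
  (chart : forall x, enorm (x - p) < r ->
     (D x <-> phi (x - dotp x nu *: nu) < dotp x nu)).
Local Notation h := (height nu phi).
Local Notation Lam := (1 + 2 * L).

Let Lam_ge1 : 1 <= Lam. Proof. by rewrite lerDl mulr_ge0. Qed.
Let Lam_gt0 : 0 < Lam. Proof. exact: lt_le_trans Lam_ge1. Qed.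

Let hL x y : `|h x - h y| <= Lam * enorm (x - y).
Proof. exact: height_lipschitz. Qed.

Lemma chartE x : enorm (x - p) < r -> (D x <-> 0 < h x).
Proof. by move=> /chart; rewrite /height subr_gt0. Qed.

Lemma closure_height_ge0 x : closure D x -> enorm (x - p) < r -> 0 <= h x.
Proof.
move=> Dx xp; rewrite leNgt; apply/negP => hx.
pose e := Num.min (r - enorm (x - p)) (- h x / Lam).
have e0 : 0 < e by rewrite lt_min subr_gt0 xp divr_gt0// oppr_gt0.
have [y [Dy /= yx]] := Dx _ (enorm_nbhs x e0).
have yp : enorm (y - p) < r.
  rewrite (_ : y - p = y - x + (x - p)); last by rewrite addrA subrK.
  apply: le_lt_trans (enormD _ _) _; rewrite -ltrBrDr.
  by apply: (lt_le_trans yx); rewrite ge_min lexx.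
have /(chartE yp) := Dy; apply/negP; rewrite -leNgt.
have : enorm (y - x) <= - h x / Lam.
  by apply: ltW; apply: (lt_le_trans yx); rewrite ge_min lexx orbT.
rewrite ler_pdivlMr// mulrC => /(le_trans (hL y x)); rewrite ler_norml => /andP[_].
by rewrite lerBlDr addNr.
Qed.

Lemma bdry_height0 x : bdry D x -> enorm (x - p) < r -> h x = 0.
Proof.
move=> [cx ix] xp; apply/eqP; rewrite eq_le closure_height_ge0// andbT leNgt.
by apply/negP => /(chartE xp) Dx; apply: ix; move: oD; rewrite openE => /(_ x Dx).
Qed.

Lemma center_height0 : h p = 0.
Proof. by apply: bdry_height0 => //; rewrite subrr enorm0. Qed.

Lemma enorm_normal (d : R) : 0 <= d -> enorm (d *: nu) = d.
Proof. by move=> d0; rewrite enormZ nu1 mulr1 ger0_norm. Qed.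

(** The pole has height [- d] while the closure of [D] has nonnegative height in the chart, so the
    Lipschitz bound separates them. Outside the chart the distance to the pole is at least
    [r - d >= d]. *)
Lemma pole_depth (d : R) x : 0 < d -> 2 * d <= r -> closure D x ->
  d <= Lam * enorm (x - (p - d *: nu)).
Proof.
move=> d0 dr Dx; have [xp|xp] := ltP (enorm (x - p)) r.
  have h1 := closure_height_ge0 Dx xp.
  have := hL x (p - d *: nu); rewrite heightB// center_height0 sub0r opprK.
  by apply: le_trans; apply: le_trans (ler_norm _); rewrite lerDr.
apply: le_trans (_ : enorm (x - (p - d *: nu)) <= _); last first.
  by rewrite ler_peMl ?enorm_ge0.
have : enorm (x - p) <= enorm (x - (p - d *: nu)) + d.
  rewrite -{2}(enorm_normal (ltW d0)) -(enormN (d *: nu)).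
  apply: le_trans (enormD _ _); rewrite le_eqVlt; apply/orP; left; apply/eqP; congr enorm.
  by apply/rowP => i; rewrite !mxE; ring.
lra.
Qed.

(** Distances to the boundary point are controlled by distances to the pole, in which the dipole is
    explicit. *)
Lemma pole_dist (d : R) x : 0 < d -> 2 * d <= r -> closure D x ->
  enorm (x - p) <= (1 + Lam) * enorm (x - (p - d *: nu)).
Proof.
move=> d0 dr Dx; have := pole_depth d0 dr Dx.
have : enorm (x - p) <= enorm (x - (p - d *: nu)) + d.
  rewrite -{2}(enorm_normal (ltW d0)) -(enormN (d *: nu)).
  apply: le_trans (enormD _ _); rewrite le_eqVlt; apply/orP; left; apply/eqP; congr enorm.
  by apply/rowP => i; rewrite !mxE; ring.
by rewrite mulrDl mul1r; lra.
Qed.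

(** The centre has height [d], and the side is chosen so that the height drops by at most [d / 2] in
    the cube. This piece of [D], comparable in size to [d] and close to the pole, carries the lower
    bound on the energy. *)
Lemma inner_cube (d : R) x : 0 < d -> 2 * d < r ->
  cbox (p + d *: nu - const_mx (d / (2 * n%:R * Lam))) (p + d *: nu + const_mx (d / (2 * n%:R * Lam))) x ->
  D x /\ enorm (x - (p - d *: nu)) <= 3 * d.
Proof.
move=> d0 dr xQ; set s := d / _ in xQ.
have n0 : 0 < n%:R :> R by rewrite ltr0n.
have s0 : 0 < s by rewrite /s; apply: divr_gt0 => //; apply: mulr_gt0 => //; exact: mulr_gt0.
have xa : enorm (x - (p + d *: nu)) <= d / (2 * Lam).
  apply: (@le_trans _ _ (n%:R * s)).
    apply: enorm_le_coord; first exact: ltW.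
    by move=> i; have /andP[] := xQ i; rewrite !mxE ler_norml; lra.
  rewrite le_eqVlt; apply/orP; left; apply/eqP; rewrite /s; field.
  by rewrite !lt0r_neq0.
have dL : d / (2 * Lam) <= d / 2.
  by rewrite ler_pM2l// lef_pV2 ?posrE ?mulr_gt0// ler_pMr.
have xp : enorm (x - p) <= 3 / 2 * d.
  rewrite (_ : x - p = (x - (p + d *: nu)) + d *: nu); last first.
    by apply/rowP => i; rewrite !mxE; ring.
  by apply: le_trans (enormD _ _) _; rewrite (enorm_normal (ltW d0)); lra.
split; last first.
  rewrite (_ : x - (p - d *: nu) = (x - p) + d *: nu); last first.
    by apply/rowP => i; rewrite !mxE; ring.
  by apply: le_trans (enormD _ _) _; rewrite (enorm_normal (ltW d0)); lra.
have xr : enorm (x - p) < r by lra.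
apply/(chartE xr); have := hL x (p + d *: nu); rewrite heightD// center_height0 add0r.
have := ler_wpM2l (ltW Lam_gt0) xa.
rewrite (_ : Lam * (d / (2 * Lam)) = d / 2); last by field; rewrite !lt0r_neq0.
by rewrite ler_norml => h1 /andP[h2 _]; lra.
Qed.

Lemma chart_hausdorff (rho : R) : 0 < rho -> n%:R * rho < r ->
  (@hausdorff_outer R n n' (bdry D `&` cbox (p - const_mx rho)%R (p + const_mx rho)%R) <=
     (@graph_const R n' L * rho ^+ n')%:E)%E.
Proof.
move=> rho0 rhor; apply: (graph_hausdorff_le nu1 L0 phiL (p := p) rho0); last by move=> x [].
move=> x [Bx xQ]; apply: bdry_height0 => //.
apply: le_lt_trans rhor; apply: enorm_le_coord; first exact: ltW.
by move=> i; have /andP[] := xQ i; rewrite !mxE ler_norml; lra.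
Qed.

(** Beyond the chart, [n * rho / r >= 1], and the finite measure of the whole boundary is absorbed
    in the constant. *)
Lemma local_hausdorff : (@hausdorff_outer R n n' (bdry D) < +oo)%E ->
  exists C : R, 0 <= C /\ forall rho : R, 0 < rho ->
  (@hausdorff_outer R n n' (bdry D `&` cbox (p - const_mx rho)%R (p + const_mx rho)%R) <=
     (C * rho ^+ n')%:E)%E.
Proof.
move=> Hfin; have H0 := hausdorff_outer_ge0 n' (bdry D).
pose H : R := fine (@hausdorff_outer R n n' (bdry D)).
have HE : @hausdorff_outer R n n' (bdry D) = H%:E by rewrite /H fineK// ge0_fin_numE.
have H0' : 0 <= H by rewrite -lee_fin -HE.
have G0 : 0 <= @graph_const R n' L by exact: graph_const_ge0.
have n0 : 0 < n%:R :> R by rewrite ltr0n.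
exists (@graph_const R n' L + H * (n%:R / r) ^+ n'); split.
  by apply: addr_ge0 => //; apply: mulr_ge0 => //; apply: exprn_ge0; apply: divr_ge0; exact: ltW.
move=> rho rho0; have rn0 : 0 <= rho ^+ n' by rewrite exprn_ge0// ltW.
have q0 : 0 <= (n%:R / r) ^+ n' by apply: exprn_ge0; apply: divr_ge0; exact: ltW.
have [rhor|rhor] := ltP (n%:R * rho) r.
  apply: le_trans (chart_hausdorff rho0 rhor) _; rewrite lee_fin mulrDl lerDl.
  by apply: mulr_ge0 => //; exact: mulr_ge0.
apply: (@le_trans _ _ H%:E).
  by rewrite -HE; apply: le_hausdorff_outer => x [].
rewrite lee_fin mulrDl; apply: ler_wpDl; first exact: mulr_ge0.
rewrite -mulrA -exprMn ler_peMr// exprn_ege1//.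
by rewrite mulrAC ler_pdivlMr// mul1r.
Qed.

End lipschitz_chart.

Lemma lipschitz_boundary_chart {R : realType} {n : nat} (D : set 'rV[R]_n) (p : 'rV[R]_n) :
  lipschitz_boundary D -> bdry D p -> exists nu phi (L r : R),
  [/\ enorm nu = 1, 0 <= L, forall x y, `|phi x - phi y| <= L * enorm (x - y), 0 < r &
      forall x, enorm (x - p) < r -> (D x <-> phi (x - dotp x nu *: nu) < dotp x nu)].
Proof.
move=> lip /lip[nu [phi [r [nu1 [L phiL] r0 chart]]]].
exists nu, phi, `|L|, r; split=> // x y.
apply: le_trans (phiL x y I I) _; apply: ler_wpM2r; [exact: enorm_ge0|exact: ler_norm].
Qed.

(** The boundary is compact, so it is covered by finitely many cubes, each contained in a chart. *)
Lemma hausdorff_bdry_lty {R : realType} {n' : nat} (D : set 'rV[R]_n'.+1) :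
  bounded_lipschitz_domain D -> (@hausdorff_outer R n'.+1 n' (bdry D) < +oo)%E.
Proof.
move=> [oD _ _ /bounded_cbox[M [_ DM]] lip].
have cB : compact (bdry D).
  apply: (@subclosed_compact _ (bdry D) (cbox (- const_mx M) (const_mx M))); [exact: bdry_closed|exact: cbox_compact|].
  by move=> x [Dx _]; exact: (closure_cbox DM).
have n0 : 0 < n'.+1%:R :> R by rewrite ltr0n.
have /choice[s hs] : forall p, exists s : R, bdry D p -> 0 < s /\
    (@hausdorff_outer R n'.+1 n' (bdry D `&` ocube p s) < +oo)%E.
  move=> p; have [Bp|nBp] := pselect (bdry D p); last by exists 0.
  have [nu [phi [L [r [nu1 L0 phiL r0 chart]]]]] := lipschitz_boundary_chart lip Bp.
  have s0 : 0 < r / (2 * n'.+1%:R) by apply: divr_gt0 => //; exact: mulr_gt0.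
  exists (r / (2 * n'.+1%:R)) => _; split=> //.
  apply: le_lt_trans (ltry _); apply: le_trans (chart_hausdorff oD nu1 L0 phiL chart s0 _); last first.
    rewrite (_ : _ * (r / _) = r / 2); last by field; rewrite lt0r_neq0.
    by rewrite ltr_pdivrMr// ltr_pMr// ltr1n.
  apply: le_hausdorff_outer => x [Bx xs]; split=> // i.
  by have := xs i; rewrite !mxE ltr_norml; move: (r / _) => t /andP[]; lra.
pose f p := if asbool (bdry D p) then interior (ocube p (s p)) else set0.
have of_ p : open (f p) by rewrite /f; case: ifP => _; [exact: open_interior|exact: open0].
move: cB; rewrite compact_cover => /(_ _ setT f (fun p _ => of_ p)) [].
  move=> p Bp; exists p => //; rewrite /f asboolT//.
  by apply: ocube_nbhs; case: (hs p Bp).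
move=> J _ cov; apply: (@le_lt_trans _ _ (@hausdorff_outer R n'.+1 n'
    (bdry D `&` [set x | exists2 p, p \in enum_fset J & f p x]))).
  by apply: le_hausdorff_outer => x Bx; split=> //; have [p pJ fp] := cov x Bx; exists p.
elim: (enum_fset J) => [|p l IH].
  rewrite (_ : _ `&` _ = set0) ?hausdorff_outer0//.
  by apply/seteqP; split=> x // [_ [q]]; rewrite in_nil.
apply: (@le_lt_trans _ _ (@hausdorff_outer R n'.+1 n' (bdry D `&` f p) +
  @hausdorff_outer R n'.+1 n' (bdry D `&` [set x | exists2 p, p \in l & f p x]))%E).
  apply: le_trans (outer_measureU2 (@hausdorff_om R n'.+1 n') _ _).
  apply: le_hausdorff_outer => x [Bx [q]]; rewrite in_cons => /orP[/eqP-> fp|ql fq].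
    by left.
  by right; split=> //; exists q.
apply: lte_add_pinfty => //; rewrite /f; case: asboolP => [Bp|_].
  have [_] := hs p Bp; apply: le_lt_trans; apply: le_hausdorff_outer.
  by apply: setIS; exact: interior_subset.
by rewrite setI0 hausdorff_outer0.
Qed.

(** * Dipoles *)

Section dipole.
Context {R : realType} {n : nat}.
Local Notation E := 'rV[R]_n.
Local Notation dx i := (delta_mx 0 i : E).
Variables (q : E) (eps : R) (i0 : 'I_n).
Hypothesis eps0 : 0 < eps.

Definition sqdist (x : E) : R := dotp (x - q) (x - q).

(* A smooth positive function that agrees with [sqdist] where [eps <= sqdist]. *)
Definition regdist (x : E) : R := sqdist x + flat 0 (eps - sqdist x).

(** A real power: the exponent [- n / 2] of the squared distance need not be an integer. The
    logarithm is smooth because [regdist] is positive everywhere. *)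
Definition regpow (a : R) (x : E) : R := expR (a * ln (regdist x)).

(** Away from the ball of radius [sqrt eps] about the pole [q] this is [y_1 |y| ^ - n] with
    [y = x - q]. *)
Definition dipole (x : E) : R := (x - q) 0 i0 * regpow (- (n%:R / 2)) x.

Let y i (x : E) : R := (x - q) 0 i.
(** The factor by which the regularisation changes the gradient of [sqdist]; it is 1, with zero
    derivatives, where [eps <= sqdist x], including equality. *)
Let m (x : E) : R := 1 - flat 2 (eps - sqdist x).

Lemma regdist_gt0 x : 0 < regdist x.
Proof.
have s0 : 0 <= sqdist x by exact: dotp_ge0.
rewrite /regdist; have [xe|xe] := ltP (sqdist x) eps.
  apply: ltr_wpDl => //; rewrite /flat subr_gt0 xe.
  by apply: mulr_gt0; [apply: exprn_gt0; rewrite invr_gt0 subr_gt0|exact: expR_gt0].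
by apply: ltr_pwDl; [exact: lt_le_trans xe|exact: flat_ge0].
Qed.

Let Ck_y k i : Ck k (y i).
Proof.
rewrite (_ : y i = fun x => x 0 i + - q 0 i); last by apply/funext => x; rewrite /y !mxE.
by apply: Ck_add; [exact: Ck_coord|exact: Ck_cst].
Qed.

Let Ck_sqdist k : Ck k sqdist.
Proof. by apply: Ck_sum => i; apply: Ck_mul; exact: Ck_y. Qed.

Let Ck_defect k : Ck k (fun x => eps - sqdist x).
Proof.
rewrite (_ : (fun x => _) = fun x => eps + -1 * sqdist x); last first.
  by apply/funext => x; rewrite mulN1r.
by apply: Ck_add; [exact: Ck_cst|apply: Ck_mul; [exact: Ck_cst|exact: Ck_sqdist]].
Qed.

Lemma smooth_regpow a : smooth (regpow a).
Proof.
apply: Ck_smooth => k; apply: Ck_expR; apply: Ck_mul; first exact: Ck_cst.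
by apply: Ck_ln; [exact: regdist_gt0|apply: Ck_add; [exact: Ck_sqdist|apply: Ck_flat; exact: Ck_defect]].
Qed.

Lemma smooth_dipole : smooth dipole.
Proof. by apply: smooth_mul; [apply: Ck_smooth => k; exact: Ck_y|exact: smooth_regpow]. Qed.

Let d_y (x : E) i j : is_derive x (dx j) (y i) (j == i)%:R.
Proof.
rewrite (_ : y i = fun x => x 0 i + - q 0 i); last by apply/funext => z; rewrite /y !mxE.
have := smooth_is_derive x j (smooth_coord (R := R) i); rewrite partial_coord => h.
by have := is_derive_add h (is_derive_cst (- q 0 i) x (dx j)); rewrite addr0.
Qed.

Let d_sqdist x i : is_derive x (dx i) sqdist (2 * y i x).
Proof.
have sk := Ck_smooth Ck_sqdist.
rewrite (_ : 2 * y i x = partial i sqdist x); first exact: smooth_is_derive.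
apply/esym; apply: is_derive_partial.
have := @is_derive_sum R E R n (fun j x => y j x * y j x) x (dx i)
  (fun j => (i == j)%:R * y j x + y j x * (i == j)%:R)
  (fun j => is_derive_mul (d_y x j i) (d_y x j i)).
rewrite (_ : \sum_(j < n) (fun x0 => _) = sqdist); last first.
  by apply/funext => z; rewrite /sqdist /dotp fct_sumE.
congr is_derive; rewrite (bigD1 i)//= eqxx big1 => [|j ji].
  by rewrite mul1r mulr1 addr0 mulr_natl mulr2n.
by rewrite eq_sym (negbTE ji) mul0r mulr0 addr0.
Qed.

Let d_defect x i : is_derive x (dx i) (fun z => eps - sqdist z) (- (2 * y i x)).
Proof.
rewrite (_ : (fun z => _) = fun z => eps + -1 * sqdist z); last first.
  by apply/funext => z; rewrite mulN1r.
have h := is_derive_mul (is_derive_cst (-1 : R) x (dx i)) (d_sqdist x i).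
have := is_derive_add (is_derive_cst eps x (dx i)) h.
by rewrite mul0r !add0r mulN1r.
Qed.

Let d_regdist x i : is_derive x (dx i) regdist (2 * y i x * m x).
Proof.
have h := is_derive_comp (f := fun z => eps - sqdist z) (flat_derive 0 _) (d_defect x i).
have := is_derive_add (d_sqdist x i) h.
by congr is_derive; rewrite /m mul0r subr0; ring.
Qed.

Let d_regpow a x i : is_derive x (dx i) (regpow a) (2 * a * regpow (a - 1) x * y i x * m x).
Proof.
have h1 := is_derive_comp (is_derive1_ln (regdist_gt0 x)) (d_regdist x i).
have h2 := is_derive_mul (is_derive_cst a x (dx i)) h1.
have := is_derive_comp (is_derive_expR _) h2.
congr is_derive; rewrite /regpow mulrBl mul1r expRD expRN lnK ?posrE ?regdist_gt0//.
by rewrite mul0r add0r /cst; ring.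
Qed.

Let d_m x i : eps <= sqdist x -> is_derive x (dx i) m 0.
Proof.
move=> xe; have h := is_derive_comp (f := fun z => eps - sqdist z) (flat_derive 2 _) (d_defect x i).
rewrite (_ : m = fun z => 1 + -1 * flat 2 (eps - sqdist z)); last first.
  by apply/funext => z; rewrite /m mulN1r.
have h2 := is_derive_mul (is_derive_cst (-1 : R) x (dx i)) h.
have := is_derive_add (is_derive_cst (1 : R) x (dx i)) h2.
have f0 k : flat k (eps - sqdist x) = 0 by rewrite /flat ltNge subr_le0 xe.
by rewrite !f0 !(mul0r, mulr0, subr0, add0r, oppr0, addr0).
Qed.

Let Efar x : eps <= sqdist x -> regdist x = sqdist x.
Proof. by move=> xe; rewrite /regdist /flat ltNge subr_le0 xe addr0. Qed.

Let mfar x : eps <= sqdist x -> m x = 1.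
Proof. by move=> xe; rewrite /m /flat ltNge subr_le0 xe subr0. Qed.

Let a : R := - (n%:R / 2).

Let partial_dipole i : partial i dipole =
  (fun x => (i == i0)%:R * regpow a x + y i0 x * (2 * a * regpow (a - 1) x * y i x * m x)).
Proof.
apply/funext => x; apply: is_derive_partial.
exact: is_derive_mul (d_y x i0 i) (d_regpow a x i).
Qed.

(** With exponent [a], the Laplacian of [y_1 rho ^ a] is [2 * a * (n + 2 * a) * y_1 * rho ^ (a -
    1)]; the choice [a = - n / 2] annihilates it. *)
Lemma dipole_harmonic x : eps <= sqdist x ->
  \sum_(i < n) partial i (partial i dipole) x = 0.
Proof.
move=> xe; have s0 : 0 < sqdist x by exact: lt_le_trans xe.
have m1 := mfar xe.
transitivity (\sum_(i < n) ((2 * a * regpow (a - 1) x * y i0 x) * (2 * (i == i0)%:R + 1) +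
   y i0 x * (4 * a * (a - 1) * regpow (a - 1 - 1) x) * (y i x * y i x))).
  apply: eq_bigr => i _; rewrite partial_dipole; apply: is_derive_partial.
  have h1 := is_derive_mul (is_derive_cst ((i == i0)%:R : R) x (dx i)) (d_regpow a x i).
  have h2 := is_derive_mul (is_derive_cst (2 * a : R) x (dx i)) (d_regpow (a - 1) x i).
  have h3 := is_derive_mul (is_derive_mul h2 (d_y x i i)) (d_m i xe).
  have := is_derive_add h1 (is_derive_mul (d_y x i0 i) h3).
  rewrite m1 eqxx; congr is_derive.
  have [->|_] := eqVneq i i0; rewrite /=; ring.
rewrite big_split -!mulr_sumr -/(dotp (x - q) (x - q)) -/(sqdist x).
rewrite big_split -mulr_sumr sumr_const card_ord (bigD1 i0)//= eqxx big1 => [|i ni]; last first.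
  by rewrite (negbTE ni).
have -> : regpow (a - 1) x = regpow (a - 1 - 1) x * sqdist x.
  rewrite /regpow [(a - 1 - 1) * _]mulrBl mul1r expRD expRN lnK ?posrE ?regdist_gt0//.
  by rewrite Efar// divfK// lt0r_neq0.
rewrite addr0 mulr1 (_ : n%:R = - (2 * a)); last by rewrite /a; field.
ring.
Qed.

Lemma regpow_sqr x : eps <= sqdist x -> regpow a x ^+ 2 = (sqdist x ^+ n)^-1.
Proof.
move=> xe; have s0 : 0 < sqdist x by exact: lt_le_trans xe.
rewrite /regpow Efar// -expRM_natl (_ : 2%:R * _ = - (n%:R * ln (sqdist x))); last first.
  by rewrite /a; field.
by rewrite expRN expRM_natl lnK.
Qed.

(** The coefficient [n * (n - 2)] arises as [4 * a ^ 2 + 4 * a] and is nonnegative for [n >= 2];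
    hence the lower bound in every direction. *)
Lemma dipole_gradient x : eps <= sqdist x ->
  \sum_(i < n) partial i dipole x ^+ 2 =
    (sqdist x ^+ n)^-1 * (1 + n%:R * (n%:R - 2) * ((x - q) 0 i0 ^+ 2 / sqdist x)).
Proof.
move=> xe; have s0 : 0 < sqdist x by exact: lt_le_trans xe.
rewrite -regpow_sqr//.
have E1 : regpow (a - 1) x = regpow a x / sqdist x.
  by rewrite /regpow mulrBl mul1r expRD expRN Efar// lnK.
transitivity (\sum_(i < n) (regpow a x ^+ 2 * (1 + 4 * a * y i0 x ^+ 2 / sqdist x) * (i == i0)%:R +
   regpow a x ^+ 2 * (2 * a * y i0 x / sqdist x) ^+ 2 * (y i x * y i x))).
  apply: eq_bigr => i _; rewrite partial_dipole mfar// E1.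
  have [->|_] := eqVneq i i0; rewrite /=; field; exact: lt0r_neq0.
rewrite big_split -!mulr_sumr -/(dotp (x - q) (x - q)) -/(sqdist x).
rewrite (bigD1 i0)//= eqxx big1 => [|i ni]; last by rewrite (negbTE ni).
rewrite addr0 mulr1 -/(y i0 x) /a; field; exact: lt0r_neq0.
Qed.

Lemma coord_sqdist x : (x - q) 0 i0 ^+ 2 <= sqdist x.
Proof.
rewrite /sqdist -sqr_enorm -(real_normK (num_real _)) ler_sqr ?nnegrE ?enorm_ge0//.
exact: coord_le_enorm.
Qed.

Lemma dipole_gradient_ge x : (2 <= n)%N -> eps <= sqdist x ->
  (sqdist x ^+ n)^-1 <= \sum_(i < n) partial i dipole x ^+ 2.
Proof.
move=> n2 xe; have s0 : 0 < sqdist x by exact: lt_le_trans xe.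
rewrite dipole_gradient// ler_peMr ?invr_ge0 ?exprn_ge0 ?(ltW s0)// lerDl.
apply: mulr_ge0; last by rewrite divr_ge0 ?sqr_ge0// ltW.
by rewrite mulr_ge0// subr_ge0 ler_nat.
Qed.

Lemma dipole_gradient_le x : (2 <= n)%N -> eps <= sqdist x ->
  \sum_(i < n) partial i dipole x ^+ 2 <= (1 + n%:R * (n%:R - 2)) * (sqdist x ^+ n)^-1.
Proof.
move=> n2 xe; have s0 : 0 < sqdist x by exact: lt_le_trans xe.
rewrite dipole_gradient// mulrC ler_wpM2r ?invr_ge0 ?exprn_ge0 ?(ltW s0)//.
rewrite lerD2l ler_piMr//; first by rewrite mulr_ge0// subr_ge0 ler_nat.
by rewrite ler_pdivrMr// mul1r; exact: coord_sqdist.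
Qed.

Lemma dipole_sqr_le x : (0 < n)%N -> eps <= sqdist x -> dipole x ^+ 2 <= (sqdist x ^+ n.-1)^-1.
Proof.
move=> n0 xe; have s0 : 0 < sqdist x by exact: lt_le_trans xe.
rewrite /dipole exprMn regpow_sqr//.
apply: (@le_trans _ _ (sqdist x * (sqdist x ^+ n)^-1)).
  by apply: ler_wpM2r; [rewrite invr_ge0 exprn_ge0// ltW|exact: coord_sqdist].
by rewrite -{1}(prednK n0) exprS invfM mulrA divff ?mul1r// lt0r_neq0.
Qed.

End dipole.

Lemma vip_sqE d (T : measurableType d) (R : realType) (mu : {measure set T -> \bar R})
    (D : set T) (mD : measurable D) n (G : 'I_n -> T -> R) : vl2 mu D G ->
  (\int[mu]_(x in D) (\sum_(i < n) G i x ^+ 2)%:E = (vip mu D G G)%:E)%E.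
Proof.
move=> lG; under eq_integral do rewrite -sumEFin.
rewrite ge0_integral_sum//; last 2 first.
- by move=> i; apply: measurable_sqrE; case: (lG i).
- by move=> i x _; rewrite lee_fin sqr_ge0.
rewrite /vip -sumEFin; apply: eq_bigr => i _; exact: ip_sqE.
Qed.

Lemma continuous_enormB {R : realType} {n : nat} (p : 'rV[R]_n) :
  continuous (fun x : 'rV[R]_n => enorm (x - p)).
Proof.
move=> x U /= /nbhs_ballP[e /= e0 eU].
apply: filterS (enorm_nbhs x e0) => y /= yx; apply: eU; apply: le_lt_trans yx.
have := enormD (x - y) (y - p); have := enormD (y - x) (x - p).
rewrite !addrA !subrK (enormB x y) ler_norml; lra.
Qed.

(** * Energy, second moment and boundary norm of a dipole *)

Section dipole_estimates.
Context {R : realType} {n' : nat}.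
Hypothesis n'_gt0 : (0 < n')%N.
Local Notation n := n'.+1.
Local Notation E := 'rV[R]_n.
Local Notation leb := (@lebesgue_rV R n).
Local Notation LT := (caratheodory_type (@lebesgue_om R n)).
Local Notation surf := (@hausdorff R n n').
Local Notation HT := (caratheodory_type (@hausdorff_om R n n')).
Local Notation vipD D := (@vip _ LT R leb D n).
Variables (D : set E) (p nu : E) (M d Lam : R).
Hypotheses (oD : open D) (M0 : 0 < M) (DM : D `<=` cbox (- const_mx M) (const_mx M))
  (Hfin : (@hausdorff_outer R n n' (bdry D) < +oo)%E)
  (Dp : bdry D p) (d0 : 0 < d) (Lam1 : 1 <= Lam).
Local Notation q := (p - d *: nu).
Hypotheses (depth : forall x, closure D x -> d <= Lam * enorm (x - q))
  (dist : forall x, closure D x -> enorm (x - p) <= (1 + Lam) * enorm (x - q)).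
Local Notation a := (p + d *: nu).
Local Notation s := (d / (2 * n%:R * Lam)).
Hypothesis inner : forall x, cbox (a - const_mx s) (a + const_mx s) x ->
  D x /\ enorm (x - q) <= 3 * d.
Local Notation eps := ((d / Lam) ^+ 2).
Local Notation g := (dipole q eps (ord0 : 'I_n)).
Local Notation dg := (fun i : 'I_n => partial i g).
Local Notation rho := (sqdist q).
Local Notation bigC := (1 + n%:R * (n%:R - 2) : R).

Let mD : measurable (D : set LT). Proof. exact: leb_measurable_open. Qed.
Let mB : measurable (bdry D : set HT). Proof. exact: surf_measurable_bdry. Qed.
Let Lam0 : 0 < Lam. Proof. exact: lt_le_trans Lam1. Qed.
Let n0 : 0 < n%:R :> R. Proof. by rewrite ltr0n. Qed.
Let n_ge2 : (2 <= n)%N. Proof. by rewrite ltnS. Qed.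

Let eps0 : 0 < eps. Proof. by rewrite exprn_gt0// divr_gt0. Qed.

Lemma sqdist_ge x : closure D x -> eps <= rho x.
Proof.
move=> /depth h; rewrite /sqdist -sqr_enorm ler_sqr ?nnegrE ?enorm_ge0//; last first.
  by rewrite divr_ge0// ltW.
by rewrite ler_pdivrMr// mulrC.
Qed.

Let rho0 x : closure D x -> 0 < rho x.
Proof. by move=> /sqdist_ge; exact: lt_le_trans. Qed.

Let sg : smooth g. Proof. exact: smooth_dipole. Qed.

Let lgrad : vl2 leb D (dg : 'I_n -> LT -> R).
Proof. by move=> i; apply: (l2D_continuous oD DM); apply: smooth_continuous; exact: smooth_partial. Qed.

Let subD x : D x -> closure D x. Proof. exact: subset_closure. Qed.

Let sumsq_measurable (A : set LT) : measurable A ->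
  measurable_fun A (fun x : LT => (\sum_(i < n) dg i x ^+ 2)%:E).
Proof.
move=> mA; apply/measurable_EFinP; apply: measurable_sum => i.
by apply: measurable_funX; apply: leb_measurable_continuous => //;
  apply: smooth_continuous; exact: smooth_partial.
Qed.

(** On the inner cube [|y| <= 3 * d], so the squared gradient is at least [(9 * d ^ 2) ^ - n]; the
    cube has side [d / (n * Lam)]. *)
Lemma dipole_energy_ge : ((9 * n%:R * Lam * d) ^+ n)^-1 <= vipD D dg dg.
Proof.
rewrite -lee_fin -(vip_sqE mD lgrad).
pose Q := cbox (a - const_mx s) (a + const_mx s).
have s0 : 0 < s by apply: divr_gt0 => //; apply: mulr_gt0 => //; exact: mulr_gt0.
have mQ : measurable (Q : set LT) by exact: cara_measurable_cbox.
have c0 : 0 <= ((9 * d ^+ 2) ^+ n)^-1.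
  by rewrite invr_ge0; apply: exprn_ge0; apply: mulr_ge0 => //; exact: sqr_ge0.
have vQ : (leb Q = ((2 * s) ^+ n)%:E)%E.
  rewrite /lebesgue_rV /= [LHS]lebesgue_box; last first.
    by move=> i; rewrite !mxE; move: (d / _) s0 => t t0; lra.
  congr EFin; rewrite (eq_bigr (fun=> 2 * s)) ?prodr_const ?card_ord// => i _.
  by rewrite !mxE; ring.
have -> : ((9 * n%:R * Lam * d) ^+ n)^-1 = ((9 * d ^+ 2) ^+ n)^-1 * (2 * s) ^+ n.
  rewrite -!exprVn -exprMn; congr (_ ^+ _); field.
  by rewrite !lt0r_neq0.
rewrite EFinM -vQ -(integral_cst leb mQ).
apply: (@le_trans _ _ (\int[leb]_(x in Q) (\sum_(i < n) dg i x ^+ 2)%:E)%E).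
  apply: (@ge0_le_integral _ LT R leb Q mQ (cst (((9 * d ^+ 2) ^+ n)^-1)%:E)
    (fun x => (\sum_(i < n) dg i x ^+ 2)%:E)).
  - by move=> x _; rewrite lee_fin.
  - exact: measurable_cst.
  - exact: sumsq_measurable.
  - move=> x Qx; have [Dx xq] := inner Qx; rewrite lee_fin.
    apply: le_trans (dipole_gradient_ge ord0 eps0 n_ge2 (sqdist_ge (subD Dx))).
    have rx := rho0 (subD Dx).
    have d9 : 0 < 9 * d ^+ 2 by rewrite mulr_gt0// exprn_gt0.
    rewrite lef_pV2 ?posrE ?exprn_gt0//.
    apply: lerXn2r; [by rewrite nnegrE ltW|by rewrite nnegrE ltW|].
    rewrite /sqdist -sqr_enorm (_ : 9 * _ = (3 * d) ^+ 2); last by ring.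
    by apply: lerXn2r; rewrite ?nnegrE ?enorm_ge0// mulr_ge0// ltW.
apply: (@ge0_subset_integral _ LT R leb Q D mQ mD (fun x => (\sum_(i < n) dg i x ^+ 2)%:E)).
- exact: sumsq_measurable.
- by move=> x _; rewrite lee_fin; apply: sumr_ge0 => i _; exact: sqr_ge0.
- by move=> x /inner[].
Qed.

(** The integral is split at squared distance [eta] from the pole. Nearby, the weight is of order
    [eta] and multiplies the energy; farther away, [rho * rho ^ - n] is at most [eta ^ - (n - 1)], a
    bound that does not involve [d]. *)
Lemma moment_le (eta : R) : 0 < eta ->
  vipD D (fun i x => enorm (x - p) * dg i x) (fun i x => enorm (x - p) * dg i x) <=
  (1 + Lam) ^+ 2 * (eta * vipD D dg dg + bigC * (eta ^+ n')^-1 * fine (leb D)).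
Proof.
move=> eta0; have C0 : 0 <= bigC.
  by apply: addr_ge0 => //; apply: mulr_ge0 => //; rewrite subr_ge0 ler_nat.
have eta_n : 0 <= (eta ^+ n')^-1 by rewrite invr_ge0 exprn_ge0// ltW.
have L2 : 0 <= (1 + Lam) ^+ 2 by exact: sqr_ge0.
have lw : vl2 leb D ((fun i x => enorm (x - p) * dg i x) : 'I_n -> LT -> R).
  move=> i; apply: (l2D_continuous oD DM) => x.
  have ce := @continuous_enormB R n p; have cg := smooth_continuous (smooth_partial i sg).
  exact: (continuousM (ce x) (cg x)).
have [v Dfin] : exists v, (leb D = v%:E)%E.
  by exists (fine (leb D)); rewrite fineK// ge0_fin_numE//; exact: leb_bounded_lty mD DM.
rewrite -lee_fin -(vip_sqE mD lw) Dfin /=.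
have -> : ((1 + Lam) ^+ 2 * (eta * vipD D dg dg + bigC * (eta ^+ n')^-1 * v))%:E =
    (((1 + Lam) ^+ 2)%:E * (eta%:E * (vipD D dg dg)%:E + (bigC * (eta ^+ n')^-1)%:E * leb D))%E.
  by rewrite Dfin.
rewrite -(vip_sqE mD lgrad).
rewrite -(integral_cst leb mD) -ge0_integralZl; last first.
- exact: ltW.
- by move=> x _; rewrite lee_fin; apply: sumr_ge0 => i _; exact: sqr_ge0.
- exact: sumsq_measurable.
- exact: mD.
rewrite -ge0_integralD; last first.
- exact: measurable_cst.
- by move=> x _; rewrite lee_fin; apply: mulr_ge0.
- by apply: measurable_funeM; exact: sumsq_measurable.
- move=> x _; apply: mule_ge0; first by rewrite lee_fin ltW.
  by rewrite lee_fin; apply: sumr_ge0 => i _; exact: sqr_ge0.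
- exact: mD.
rewrite -ge0_integralZl; last first.
- by rewrite lee_fin.
- move=> x _; apply: adde_ge0; last by rewrite lee_fin; apply: mulr_ge0.
  apply: mule_ge0; first by rewrite lee_fin ltW.
  by rewrite lee_fin; apply: sumr_ge0 => i _; exact: sqr_ge0.
- apply: emeasurable_funD; last exact: measurable_cst.
  by apply: measurable_funeM; exact: sumsq_measurable.
- exact: mD.
apply: (@ge0_le_integral _ LT R leb D mD
  (fun x => (\sum_(i < n) (enorm (x - p) * dg i x) ^+ 2)%:E)
  (fun x => ((1 + Lam) ^+ 2)%:E * (eta%:E * (\sum_(i < n) dg i x ^+ 2)%:E +
    cst (bigC * (eta ^+ n')^-1)%:E x))%E).
- by move=> x _; rewrite lee_fin; apply: sumr_ge0 => i _; exact: sqr_ge0.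
- apply/measurable_EFinP; apply: measurable_sum => i; apply: measurable_funX.
  by case: (lw i).
- apply: measurable_funeM; apply: emeasurable_funD; last exact: measurable_cst.
  by apply: measurable_funeM; exact: sumsq_measurable.
move=> x Dx.
rewrite -[leRHS]/(((1 + Lam) ^+ 2 * (eta * (\sum_(i < n) dg i x ^+ 2) +
  bigC * (eta ^+ n')^-1))%:E) lee_fin.
have cx := subD Dx; have rx := rho0 cx.
under eq_bigr do rewrite exprMn.
rewrite -mulr_sumr; set S := \sum_(i < n) _.
have S0 : 0 <= S by apply: sumr_ge0 => i _; exact: sqr_ge0.
have SC : S <= bigC * (rho x ^+ n)^-1 := dipole_gradient_le ord0 eps0 n_ge2 (sqdist_ge cx).
have pe : enorm (x - p) ^+ 2 <= (1 + Lam) ^+ 2 * rho x.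
  rewrite /sqdist -sqr_enorm -exprMn; apply: lerXn2r; rewrite ?nnegrE ?enorm_ge0//.
    by apply: mulr_ge0; [apply: addr_ge0 => //; exact: ltW|exact: enorm_ge0].
  exact: dist.
apply: le_trans (ler_wpM2r S0 pe) _; rewrite -mulrA; apply: ler_wpM2l => //.
have [re|re] := leP (rho x) eta.
  by apply: le_trans (ler_wpM2r S0 re) _; rewrite lerDl mulr_ge0.
apply: (@le_trans _ _ (bigC * (eta ^+ n')^-1)); last by rewrite lerDr mulr_ge0// ltW.
apply: le_trans (ler_wpM2l (ltW rx) SC) _; rewrite mulrCA; apply: ler_wpM2l => //.
rewrite exprS invfM mulrA divff ?mul1r; last exact: lt0r_neq0.
rewrite lef_pV2 ?posrE ?exprn_gt0//; by apply: lerXn2r; [rewrite nnegrE ltW|rewrite nnegrE ltW|exact: ltW].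
Qed.

(** Dyadic cubes of half-side [2 ^ k * d] about [p]: the bound [c k] on the square of the dipole
    times the surface measure of the cube is [C * (B / d) ^ n' * 2 ^ - (k * n')], and the geometric
    series is at most 2 because [n' >= 1]. *)
Lemma dipole_bdry_le (C : R) : 0 <= C -> (forall t : R, 0 < t ->
    (@hausdorff_outer R n n' (bdry D `&` cbox (p - const_mx t)%R (p + const_mx t)%R) <=
     (C * t ^+ n')%:E)%E) ->
  @ip _ HT R surf (bdry D) g g <= 2 * C * ((2 * (1 + Lam)) ^+ 2 / d) ^+ n'.
Proof.
Proof.
move=> C0 hC; pose Q k := cbox (p - const_mx (2 ^+ k * d)) (p + const_mx (2 ^+ k * d)).
pose B := (2 * (1 + Lam)) ^+ 2.
have B0 : 0 < B by rewrite exprn_gt0// mulr_gt0// addr_gt0.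
have lg : @l2 _ HT R surf (bdry D) g.
  exact: (l2S_continuous DM Hfin (smooth_continuous sg)).
have kd0 k : 0 < 2 ^+ k * d by rewrite mulr_gt0// exprn_gt0.
have [K hK] : exists K, bdry D `<=` Q K.
  have [K hK] : exists K : nat, 2 * M / d < K%:R.
    exists (Num.bound (2 * M / d)); apply: archi_boundP.
    by apply: divr_ge0; [apply: mulr_ge0 => //; exact: ltW|exact: ltW].
  exists K => x [cx _] i; have := closure_cbox DM cx i; have := closure_cbox DM Dp.1 i.
  rewrite !mxE => /andP[p1 p2] /andP[x1 x2].
  have : 2 * M <= 2 ^+ K * d.
    rewrite -ler_pdivrMr//; apply: le_trans (ltW hK) _.
    by rewrite -natrX ler_nat ltnW// ltn_expl.
  by move: (2 ^+ K * d) => t ht; apply/andP; split; lra.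
pose c k : R := (B / (2 ^+ k * d) ^+ 2) ^+ n'.
have c0 k : 0 <= c k by apply: exprn_ge0; apply: divr_ge0; [exact: ltW|exact: sqr_ge0].
have mQ k : measurable (Q k : set HT) by apply: surf_measurable_closed; exact: cbox_closed.
rewrite -lee_fin -(ip_sqE lg).
apply: (@le_trans _ _ (\int[surf]_(x in bdry D) (\sum_(k < K.+1) (c k)%:E * (\1_(Q k) x)%:E))%E).
  apply: (@ge0_le_integral _ HT R surf (bdry D) mB (fun x => (g x ^+ 2)%:E)
    (fun x => (\sum_(k < K.+1) (c k)%:E * (\1_(Q k) x)%:E)%E)).
  - by move=> x _; rewrite lee_fin sqr_ge0.
  - by apply: measurable_sqrE; case: lg.
  - apply: emeasurable_sum => k; apply: measurable_funeM; apply/measurable_EFinP.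
    exact: (@measurable_indic _ HT R (bdry D) (Q k) (mQ k)).
  move=> x Bx; have cx := Bx.1; have rx := rho0 cx.
  (* The least [k] with [x] in [Q k]: missing the previous cube forces [|x - p| >= 2 ^ (k - 1) * d],
     hence a comparable distance to the pole. For [k = 0] the depth of the pole is used. *)
  have [k kK hk] : exists2 k, (k <= K)%N & Q k x /\ (2 ^+ k * d) ^+ 2 <= B * rho x.
    have ex : exists k, `[< Q k x >] by exists K; apply/asboolP; exact: hK.
    have /asboolP hQ := ex_minnP.
    case: (ex_minnP ex) => k /asboolP Qk kmin.
    exists k; first by apply: kmin; apply/asboolP; exact: hK.
    split=> //; rewrite /B /sqdist -sqr_enorm -exprMn.
    apply: lerXn2r; rewrite ?nnegrE ?(ltW (kd0 k))//.
      by apply: mulr_ge0; [apply: mulr_ge0 => //; apply: addr_ge0 => //; exact: ltW|exact: enorm_ge0].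
    case: k Qk kmin => [|k] Qk kmin.
      rewrite expr0 mul1r; apply: le_trans (depth cx) _.
      apply: ler_wpM2r; [exact: enorm_ge0|move: Lam0; lra].
    have nQ : ~ Q k x by move=> Qx; have := kmin k (asboolT Qx); rewrite ltnn.
    have : 2 ^+ k * d <= enorm (x - p).
      rewrite leNgt; apply/negP => xp; apply: nQ => i.
      have := le_lt_trans (coord_le_enorm (x - p) i) xp.
      rewrite !mxE ltr_norml => /andP[]; move: (2 ^+ k * d) => t *; apply/andP; split; lra.
    move=> /le_trans /(_ (dist cx)) h; rewrite exprS -!mulrA; exact: ler_wpM2l.
  rewrite (bigD1 (Ordinal (kK : (k < K.+1)%N)))//=.
  apply: lee_paddr.
    by apply: sume_ge0 => j _; apply: mule_ge0; rewrite lee_fin// indicE.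
  rewrite indicE mem_set; last by case: hk.
  rewrite mule1 lee_fin; apply: le_trans (dipole_sqr_le ord0 eps0 (ltn0Sn _) (sqdist_ge cx)) _.
  rewrite /= /c -exprVn; apply: lerXn2r; rewrite ?nnegrE ?invr_ge0 ?(ltW rx)//.
    by apply: divr_ge0; [exact: ltW|exact: sqr_ge0].
  by rewrite ler_pdivlMr ?exprn_gt0// mulrC ler_pdivrMr//; case: hk.
rewrite ge0_integral_sum; last first.
- by move=> k x _; apply: mule_ge0; rewrite lee_fin// indicE.
- move=> k; apply: measurable_funeM; apply/measurable_EFinP.
  exact: (@measurable_indic _ HT R (bdry D) (Q k) (mQ k)).
- exact: mB.
apply: (@le_trans _ _ (\sum_(k < K.+1) (C * (B / d) ^+ n' * 2^-1 ^+ k)%:E)%E).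
  apply: lee_sum => k _; rewrite ge0_integralZl; last first.
  - by rewrite lee_fin.
  - by move=> x _; rewrite lee_fin indicE.
  - by apply/measurable_EFinP; exact: (@measurable_indic _ HT R (bdry D) (Q k) (mQ k)).
  - exact: mB.
  rewrite integral_indic; [|exact: mB|exact: mQ].
  rewrite setIC; apply: le_trans (lee_wpmul2l _ (hC _ (kd0 k))) _; first by rewrite lee_fin.
  rewrite -EFinM lee_fin mulrCA -[C * _ * _]mulrA; apply: ler_wpM2l => //.
  rewrite /c -exprMn.
  have -> : B / (2 ^+ k * d) ^+ 2 * (2 ^+ k * d) = (B / d) * (2 ^+ k)^-1.
    by field; rewrite !lt0r_neq0// exprn_gt0.
  rewrite exprMn; apply: ler_wpM2l; first by apply: exprn_ge0; apply: divr_ge0; exact: ltW.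
  rewrite [2^-1 ^+ k]exprVn -[X in _ <= X]expr1; apply: ler_wiXn2l => //.
  by rewrite invf_le1 ?exprn_gt0// exprn_ege1// ler1n.
rewrite sumEFin lee_fin -mulr_sumr -/B [2 * C]mulrC [leRHS]mulrAC; apply: ler_wpM2l.
  by apply: mulr_ge0 => //; apply: exprn_ge0; apply: divr_ge0; exact: ltW.
suff -> : \sum_(k < K.+1) 2^-1 ^+ k = 2 - 2^-1 ^+ K :> R by rewrite lerBlDr lerDl exprn_ge0.
elim: K {hK} => [|K IH]; first by rewrite big_ord1 !expr0; ring.
by rewrite big_ord_recr/= IH exprS; field.
Qed.

End dipole_estimates.

Lemma expr_half_le {R : realType} (e : R) : 0 < e ->
  exists N, forall k, (N <= k)%N -> 2^-1 ^+ k <= e.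
Proof.
move=> e0; exists (Num.bound e^-1) => k Nk.
have ei : 0 < e^-1 by rewrite invr_gt0.
rewrite exprVn -[e]invrK lef_pV2 ?posrE ?exprn_gt0//.
apply: le_trans (ltW (archi_boundP (ltW ei))) _.
by rewrite -natrX ler_nat; apply: leq_trans Nk _; rewrite ltnW// ltn_expl.
Qed.

Lemma partial_scale {R : realType} {n : nat} (c : R) (f : 'rV[R]_n -> R) i : smooth f ->
  partial i (fun x => c * f x) = (fun x => c * partial i f x).
Proof.
move=> sf; have := partial_lin c 0 i sf sf.
have e (g : 'rV[R]_n -> R) : (fun x => c * g x + 0 * g x) = (fun x => c * g x).
  by apply/funext => x; rewrite mul0r addr0.
by rewrite !e.
Qed.

Lemma smooth_scale {R : realType} {n : nat} (c : R) (f : 'rV[R]_n -> R) : smooth f ->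
  smooth (fun x => c * f x).
Proof. by move=> sf; exact: smooth_mul (smooth_cst c) sf. Qed.

Local Notation vleb D := (@vip _ (caratheodory_type (@lebesgue_om _ _)) _ (@lebesgue_rV _ _) D _).
Local Notation ipsurf R n' D :=
  (@ip _ (caratheodory_type (@hausdorff_om R n'.+1 n')) R (@hausdorff R n'.+1 n') (bdry D)).

Lemma concentrating_sequence {R : realType} {n' : nat} (D : set 'rV[R]_n'.+1) (p : 'rV[R]_n'.+1) :
  (0 < n')%N -> bounded_lipschitz_domain D -> bdry D p -> exists f : nat -> 'rV[R]_n'.+1 -> R,
  [/\ forall k, smooth (f k),
      forall k x, D x -> \sum_(i < n'.+1) partial i (partial i (f k)) x = 0,
      forall k, vleb D
        (fun i => partial i (f k)) (fun i => partial i (f k)) = 1,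
      forall e : R, 0 < e -> exists N, forall k, (N <= k)%N ->
        vleb D
          (fun i x => enorm (x - p) * partial i (f k) x)
          (fun i x => enorm (x - p) * partial i (f k) x) <= e &
      exists C : R, 0 <= C /\ forall k,
        ipsurf R n' D
          (f k) (f k) <= C * 2^-1 ^+ k].
Proof.
move=> n'0 Dlip Bp; have [oD _ _ bD lip] := Dlip.
have Hfin := hausdorff_bdry_lty Dlip.
have [M [M0 DM]] := bounded_cbox bD.
have [nu [phi [L [r [nu1 L0 phiL r0 chart]]]]] := lipschitz_boundary_chart lip Bp.
pose Lam := 1 + 2 * L; have Lam1 : 1 <= Lam by rewrite lerDl mulr_ge0.
have Lam0 : 0 < Lam by exact: lt_le_trans Lam1.
have [C [C0 hC]] := local_hausdorff oD nu1 L0 phiL r0 chart Hfin.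
have half0 k : 0 < 2^-1 ^+ k :> R by rewrite exprn_gt0// invr_gt0.
have half1 k : 2^-1 ^+ k <= 1 :> R by rewrite exprn_ile1 ?invr_ge0// invf_le1// ler1n.
(* The factor [r / 4] keeps [2 * d k] below the radius of the chart. *)
pose d k := r / 4 * 2^-1 ^+ k.
have d0 k : 0 < d k by rewrite mulr_gt0// divr_gt0.
have dr k : 2 * d k < r.
  have := ler_wpM2l (ltW (divr_gt0 r0 (ltr0Sn R 3))) (half1 k).
  by rewrite -/(d k) mulr1; move: r0; lra.
pose q k := p - d k *: nu.
have depth k x : closure D x -> d k <= Lam * enorm (x - q k).
  exact: (pole_depth oD Bp nu1 L0 phiL r0 chart (d0 k) (ltW (dr k))).
have dist k x : closure D x -> enorm (x - p) <= (1 + Lam) * enorm (x - q k).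
  exact: (pole_dist oD Bp nu1 L0 phiL r0 chart (d0 k) (ltW (dr k))).
have inner k x := @inner_cube _ _ _ _ _ _ _ _ oD Bp nu1 L0 phiL r0 chart (d k) x (d0 k) (dr k).
pose eps k := (d k / Lam) ^+ 2.
have eps0 k : 0 < eps k by rewrite exprn_gt0// divr_gt0.
pose g k := dipole (q k) (eps k) (ord0 : 'I_n'.+1).
have sg k : smooth (g k) by exact: smooth_dipole.
have mD : measurable (D : set (caratheodory_type (@lebesgue_om R n'.+1))) by exact: leb_measurable_open.
have mB := surf_measurable_bdry D.
pose V k := vleb D
        (fun i => partial i (g k)) (fun i => partial i (g k)).
pose b k := (9 * n'.+1%:R * Lam * d k) ^+ n'.+1.
have b0 k : 0 < b k.
  by apply: exprn_gt0; apply: mulr_gt0 => //; apply: mulr_gt0 => //; exact: mulr_gt0.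
have Vb k : (b k)^-1 <= V k.
  exact: (dipole_energy_ge n'0 oD DM (d0 k) Lam1 (depth k) (inner k)).
have V0 k : 0 < V k by apply: lt_le_trans (Vb k); rewrite invr_gt0.
have Vi k : (V k)^-1 <= b k by rewrite -[b k]invrK lef_pV2 ?posrE// invr_gt0.
pose c k := (Num.sqrt (V k))^-1.
have c2 k : c k ^+ 2 = (V k)^-1 by rewrite exprVn sqr_sqrtr// ltW.
pose f k x := c k * g k x.
have pf k i : partial i (f k) = (fun x => c k * partial i (g k) x) by exact: partial_scale.
have lp k i (h : 'rV[R]_n'.+1 -> R) : continuous h ->
    l2 (@lebesgue_rV R n'.+1) D ((fun x => h x * partial i (g k) x) : caratheodory_type (@lebesgue_om R n'.+1) -> R).
  move=> ch; apply: (l2D_continuous oD DM) => x.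
  have cg := smooth_continuous (smooth_partial i (sg k)).
  exact: (continuousM (ch x) (cg x)).
have ipc dT (T : measurableType dT) (mu : {measure set T -> \bar R}) (A : set T) (u : T -> R) k :
    measurable A -> l2 mu A u ->
    ip mu A (fun x => c k * u x) (fun x => c k * u x) = (V k)^-1 * ip mu A u u.
  by move=> mA lu; rewrite (ipZl mA _ lu (l2Z mA _ lu)) (ipZr mA _ lu lu) mulrA -expr2 c2.
exists f; split.
- by move=> k; exact: smooth_scale.
- move=> k x Dx; transitivity (c k * \sum_(i < n'.+1) partial i (partial i (g k)) x).
    rewrite mulr_sumr; apply: eq_bigr => i _; rewrite pf.
    by rewrite (partial_scale (c k) i (smooth_partial i (sg k))).
  rewrite (dipole_harmonic ord0 (eps0 k)) ?mulr0//.
  exact: (sqdist_ge (d0 k) Lam1 (depth k) (subset_closure Dx)).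
- move=> k; rewrite /vip; under eq_bigr => i _.
    rewrite pf (ipc _ _ _ _ _ k mD (l2D_continuous oD DM (smooth_continuous (smooth_partial i (sg k))))).
    over.
  by rewrite -mulr_sumr mulVf// lt0r_neq0.
- move=> e e0; have L2 : 0 < (1 + Lam) ^+ 2 by rewrite exprn_gt0// addr_gt0.
  (* The near part of the moment becomes [e / 2] after normalisation; the far part is divided by the
     energy, which tends to infinity. *)
  pose eta := e / (2 * (1 + Lam) ^+ 2).
  have eta0 : 0 < eta by rewrite divr_gt0// mulr_gt0.
  pose vD : R := fine (@lebesgue_rV R n'.+1 D).
  have vD0 : 0 <= vD by rewrite fine_ge0.
  pose K := (1 + n'.+1%:R * (n'.+1%:R - 2)) * (eta ^+ n')^-1 * vD : R.
  have K0 : 0 <= K.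
    apply: mulr_ge0 => //; apply: mulr_ge0; last by rewrite invr_ge0 exprn_ge0// ltW.
    by apply: addr_ge0 => //; apply: mulr_ge0 => //; rewrite subr_ge0 ler_nat.
  pose b1 := (9 * n'.+1%:R * Lam * (r / 4)) ^+ n'.+1.
  have b10 : 0 < b1.
    apply: exprn_gt0; apply: mulr_gt0; last exact: divr_gt0.
    by apply: mulr_gt0 => //; exact: mulr_gt0.
  have Kb : 0 <= (1 + Lam) ^+ 2 * K * b1 by apply: mulr_ge0; [apply: mulr_ge0 => //|]; exact: ltW.
  have e1 : 0 < e / (2 * ((1 + Lam) ^+ 2 * K * b1 + 1)).
    by apply: divr_gt0 => //; apply: mulr_gt0 => //; rewrite ltr_wpDl.
  have [N hN] := expr_half_le e1; exists N => k /hN hk.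
  have mom := moment_le n'0 oD DM (d0 k) Lam1 (depth k) (dist k) eta0.
  have -> : vleb D
          (fun i x => enorm (x - p) * partial i (f k) x)
          (fun i x => enorm (x - p) * partial i (f k) x) =
      (V k)^-1 * vleb D
          (fun i x => enorm (x - p) * partial i (g k) x)
          (fun i x => enorm (x - p) * partial i (g k) x).
    rewrite /vip mulr_sumr; apply: eq_bigr => i _.
    rewrite -(ipc _ _ _ _ _ k mD (lp k i _ (@continuous_enormB R n'.+1 p))).
    by apply: eq_ip => x _; rewrite pf mulrCA.
  apply: le_trans (ler_wpM2l _ mom) _; first by rewrite invr_ge0 ltW.
  rewrite -/(V k) -/vD -/K.
  have -> : (V k)^-1 * ((1 + Lam) ^+ 2 * (eta * V k + K)) =
     (1 + Lam) ^+ 2 * eta + (1 + Lam) ^+ 2 * K * (V k)^-1.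
    by field; rewrite lt0r_neq0.
  have -> : (1 + Lam) ^+ 2 * eta = e / 2.
    by rewrite /eta; field; rewrite lt0r_neq0// addr_gt0.
  (* One of the [n] factors of [2 ^ - k] is enough. *)
  have bk : b k <= b1 * 2^-1 ^+ k.
    rewrite /b /b1 /d mulrA exprMn; apply: ler_wpM2l; first exact: ltW.
    rewrite exprS ler_piMr ?(ltW (half0 k))//.
    by apply: exprn_ile1 => //; exact: ltW.
  have h1 : (1 + Lam) ^+ 2 * K * (V k)^-1 <= (1 + Lam) ^+ 2 * K * b1 * 2^-1 ^+ k.
    rewrite -[leRHS]mulrA; apply: ler_wpM2l; first by apply: mulr_ge0 => //; exact: ltW.
    exact: le_trans (Vi k) bk.
  have h2 : (1 + Lam) ^+ 2 * K * b1 * 2^-1 ^+ k <= e / 2.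
    apply: (@le_trans _ _ (((1 + Lam) ^+ 2 * K * b1 + 1) * (e / (2 * ((1 + Lam) ^+ 2 * K * b1 + 1))))).
      by apply: ler_pM; [exact: Kb|exact: ltW|rewrite lerDl|exact: hk].
    rewrite le_eqVlt; apply/orP; left; apply/eqP; field.
    by rewrite lt0r_neq0// ltr_wpDl.
  by rewrite [leRHS](_ : e = e / 2 + e / 2) ?lerD2l; [exact: le_trans h1 h2|lra].
(* The inverse energy contributes [d k ^ n] and the boundary integral [d k ^ - (n - 1)]; the
   remaining factor [d k] is [r / 4 * 2 ^ - k]. *)
- exists (2 * C * ((2 * (1 + Lam)) ^+ 2) ^+ n' * (9 * n'.+1%:R * Lam) ^+ n'.+1 * (r / 4)).
  have L3 : 0 <= 9 * n'.+1%:R * Lam by apply: mulr_ge0; [exact: mulr_ge0|exact: ltW].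
  split.
    apply: mulr_ge0; last by rewrite divr_ge0// ltW.
    apply: mulr_ge0; last exact: exprn_ge0.
    by apply: mulr_ge0; [exact: mulr_ge0|apply: exprn_ge0; exact: sqr_ge0].
  move=> k; rewrite /f (ipc _ _ _ _ _ k mB (l2S_continuous DM Hfin (smooth_continuous (sg k)))).
  have bd := dipole_bdry_le n'0 M0 DM Hfin Bp (d0 k) Lam1 (depth k) (dist k) C0 hC.
  apply: le_trans (ler_wpM2l _ bd) _; first by rewrite invr_ge0 ltW.
  apply: le_trans (ler_wpM2r _ (Vi k)) _.
    apply: mulr_ge0; first exact: mulr_ge0.
    by apply: exprn_ge0; apply: divr_ge0; [exact: sqr_ge0|exact: ltW].
  rewrite /b -[_ * (r / 4) * _]mulrA -/(d k) le_eqVlt; apply/orP; left; apply/eqP.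
  rewrite [X in X * _]exprMn [d k ^+ n'.+1]exprSr expr_div_n.
  have dn0 : d k ^+ n' != 0 by rewrite expf_neq0// lt0r_neq0.
  by move: dn0; move: (d k ^+ n') (_ ^+ n'.+1) (_ ^+ n') => z x y z0; field.
Qed.

(** * The noise *)

Lemma sub_sum_le {R : numDomainType} {I : eqType} (s t : seq I) (F : I -> R) :
  (forall i, 0 <= F i) -> uniq s -> {subset s <= t} -> \sum_(i <- s) F i <= \sum_(i <- t) F i.
Proof.
move=> F0; elim: s t => [|x s IH] t /=.
  by move=> _ _; rewrite big_nil; apply: sumr_ge0 => i _.
move=> /andP[xs us] st; have xt : x \in t by apply: st; rewrite inE eqxx.
rewrite (perm_big _ (perm_to_rem xt)) !big_cons lerD2l; apply: IH => // y ys.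
have yx : y != x by apply: contraNneq xs => <-.
have : y \in t by apply: st; rewrite inE ys orbT.
by rewrite (perm_mem (perm_to_rem xt)) inE (negbTE yx).
Qed.

(** * Orthogonal families and independence *)

Section bessel.
Context d (T : measurableType d) (R : realType) (mu : {measure set T -> \bar R})
  (D : set T) (mD : measurable D) (n : nat) (I : eqType) (u : I -> 'I_n -> T -> R).
Hypotheses (lu : forall j, vl2 mu D (u j))
  (ou : forall j k, vip mu D (u j) (u k) = (j == k)%:R).

(** [G] is [F] minus its projections; its squared norm is the difference of the two sides. The last
    clause of the invariant keeps the coefficients still to be removed unchanged. *)
Lemma bessel (F : 'I_n -> T -> R) (s : seq I) : vl2 mu D F -> uniq s ->
  \sum_(j <- s) vip mu D F (u j) ^+ 2 <= vip mu D F F.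
Proof.
move=> lF us; suff [G [lG GG _]] : exists G, [/\ vl2 mu D G,
    vip mu D G G = vip mu D F F - \sum_(j <- s) vip mu D F (u j) ^+ 2 &
    forall j, j \notin s -> vip mu D G (u j) = vip mu D F (u j)].
  by rewrite -subr_ge0 -GG vip_ge0.
elim: s us => [_|x s IH /= /andP[xs us]].
  by exists F; rewrite big_nil subr0.
have [G [lG GG Gj]] := IH us; pose t := vip mu D F (u x).
have ltu := vl2Z mD t (lu x).
exists (fun i y => G i y - t * u x i y); split.
- exact: (vl2B mD lG ltu).
- rewrite (vip_sqB mD _ lG (lu x)) GG Gj// ou eqxx mulr1 big_cons -/t; ring.
- move=> j; rewrite inE negb_or => /andP[jx js].
  rewrite (vipBl mD lG ltu (lu j)) (vipZl mD _ (lu x) (lu j)) ou eq_sym (negbTE jx).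
  by rewrite mulr0 subr0 Gj.
Qed.

End bessel.

Lemma pythagoras d (T : measurableType d) (R : realType) (mu : {measure set T -> \bar R})
    (D : set T) (mD : measurable D) (I : eqType) (s : seq I) (Y : I -> T -> R) :
  (forall a, l2 mu D (Y a)) -> (forall a b, a != b -> ip mu D (Y a) (Y b) = 0) -> uniq s ->
  ip mu D (fun x => \sum_(a <- s) Y a x) (fun x => \sum_(a <- s) Y a x) =
    \sum_(a <- s) ip mu D (Y a) (Y a).
Proof.
move=> lY oY; elim: s => [_|a s IH /= /andP[as_ us]].
  rewrite big_nil -[RHS](ip0l mu D (fun=> 0)).
  by apply: eq_ip => x _; rewrite big_nil.
have ls : l2 mu D (fun x => \sum_(b <- s) Y b x) by exact: l2_sum.
rewrite big_cons -(IH us) -[RHS]addr0.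
transitivity (ip mu D (fun x => Y a x + \sum_(b <- s) Y b x) (fun x => Y a x + \sum_(b <- s) Y b x)).
  by apply: eq_ip => x _; rewrite big_cons.
rewrite (ip_sqD mD (lY a) ls) addr0 -addrA [2 * _ + _]addrC addrA.
rewrite ipC (ip_suml mD _ lY (lY a)) big1_seq ?mulr0 ?addr0// => b /andP[_ bs].
by apply: oY; apply: contraNneq as_ => <-.
Qed.

(** Independence on rectangles identifies the joint law with the product of the laws, by uniqueness
    of the product measure; Fubini's theorem then makes the mean of [Z] a factor. *)
Lemma independent_uncorrelated d (T : measurableType d) (R : realType) (P : probability T R)
    (Y Z : T -> R) : l2 P setT Y -> l2 P setT Z ->
  (forall A B, measurable A -> measurable B ->
    P ((Y @^-1` A) `&` (Z @^-1` B)) = (P (Y @^-1` A) * P (Z @^-1` B))%E) ->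
  \int[P]_x Z x = 0 -> ip P setT Y Z = 0.
Proof.
move=> lY lZ ind EZ; have [mY _] := lY; have [mZ _] := lZ.
have mYZ : measurable_fun setT (fun w => (Y w, Z w)) by exact: measurable_fun_pair.
pose Yr : {RV P >-> R} := mfun_Sub (mem_set mY).
pose Zr : {RV P >-> R} := mfun_Sub (mem_set mZ).
pose YZ : {RV P >-> (R * R)%type} := mfun_Sub (mem_set mYZ).
pose m1 := distribution P Yr; pose m2 := distribution P Zr; pose m' := distribution P YZ.
pose f (z : R * R) := (z.1 * z.2)%:E.
have mf : measurable_fun setT f.
  by apply/measurable_EFinP; apply: measurable_funM; [exact: measurable_fst|exact: measurable_snd].
have if_ : P.-integrable setT (f \o (fun w => (Y w, Z w))) := l2_integrable measurableT lY lZ.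
have if' : m'.-integrable setT f.
  by apply: (integrable_pushforward mYZ mf _ measurableT); rewrite preimage_setT.
have mE X : measurable X -> (m1 \x m2)%E X = m' X.
  apply: product_measure_unique => A B mA mB; rewrite -ind//.
have if12 : (m1 \x m2)%E.-integrable setT f.
  apply/integrableP; split=> //.
  rewrite (@eq_measure_integral _ _ _ _ m')//; last by move=> A mA _; exact: mE.
  by move/integrableP : if' => [].
have l1 : l2 P setT (fun=> 1 : R).
  apply: (@l2_bounded R _ _ P setT _ 1 measurableT).
  - exact: le_lt_trans (probability_le1 P measurableT) (ltry _).
  - exact: measurable_cst.
  - by move=> x _; rewrite normr1.
have iZ : P.-integrable setT (EFin \o Z).
  have := l2_integrable measurableT l1 lZ.
  by congr (_.-integrable _ _); apply/funext => w /=; rewrite mul1r.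
have mid : measurable_fun setT (EFin : R -> \bar R) by exact/measurable_EFinP.
have iZ2 : m2.-integrable setT (EFin : R -> \bar R).
  by apply: (integrable_pushforward mZ mid _ measurableT); rewrite preimage_setT.
have EZ2 : (\int[m2]_y y%:E = 0)%E.
  rewrite (integral_pushforward mZ mid _ measurableT) preimage_setT//.
  by rewrite -(fineK (integrable_fin_num measurableT iZ)) [fine _]EZ.
have : (\int[m']_z f z = 0)%E.
  rewrite (@eq_measure_integral _ _ _ _ (m1 \x m2)%E); last by move=> A mA _; exact: (esym (mE A mA)).
  rewrite -integral12_prod_meas1//.
  transitivity (\int[m1]_x (cst 0%E : R -> \bar R) x)%E; last by rewrite integral_cst// mul0e.
  apply: eq_integral => x _; rewrite /fubini_F /f/=.
  under eq_integral do rewrite EFinM.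
  by rewrite integralZl// EZ2 mule0.
rewrite (integral_pushforward mYZ mf _ measurableT) preimage_setT// => h.
by rewrite /ip /Rintegral h.
Qed.

(** The sum of the series has finite integral, so the series converges almost everywhere and its
    terms tend to 0. *)
Lemma summable_ae_cvg0 d (T : measurableType d) (R : realType) (mu : {measure set T -> \bar R})
    (u : nat -> T -> R) (C : R) : 0 <= C -> (forall k, measurable_fun setT (u k)) ->
  (forall k x, 0 <= u k x) ->
  (forall k, (\int[mu]_x (u k x)%:E <= (C * 2^-1 ^+ k)%:E)%E) ->
  {ae mu, forall x, (u k x : R^o) @[k --> \oo] --> (0 : R^o)}.
Proof.
move=> C0 mu_ u0 uC.
have e0 k x : setT x -> (0 <= (u k x)%:E)%E by rewrite lee_fin.
have me k : measurable_fun setT (fun x => (u k x)%:E) by exact/measurable_EFinP.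
pose S x := (\sum_(j <oo) (u j x)%:E)%E.
have /(ae_nneseries_fin measurableT me e0) : (\sum_(j <oo) \int[mu]_x (u j x)%:E < +oo)%E.
  apply: (@le_lt_trans _ _ (\sum_(j <oo) ((2 * C) / (2 ^ (j + 0.+1))%:R)%:E)%E).
    apply: lee_nneseries => [j _ _|j _]; first by apply: integral_ge0 => x; exact: e0.
    apply: le_trans (uC j) _; rewrite lee_fin addn1 natrX exprS invfM mulrACA divff// mul1r exprVn.
    by [].
  by rewrite (cvg_lim _ (@cvg_geometric_eseries_half R (2 * C) 0))// ltry.
apply: filterS => x hx; have Sfin : S x \is a fin_num := hx I.
have cs : cvgn (series (fun j => u j x)).
  apply: nondecreasing_is_cvgn.
    by apply/nondecreasing_seqP => k; rewrite !seriesEnat /= big_nat_recr//= lerDl.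
  exists (fine (S x)) => _ [k _ <-]; rewrite -lee_fin fineK// seriesEnat /= -sumEFin.
  exact: (nneseries_lim_ge k (fun i _ _ => e0 i x I)).
exact: cvg_series_cvg_0 cs.
Qed.

Section complex_real.
Context {R : realType}.
Implicit Types z w : R[i].

Lemma cReD z w : complex.Re (z + w) = complex.Re z + complex.Re w.
Proof. by case: z w => [? ?] [? ?]. Qed.

Lemma cImD z w : complex.Im (z + w) = complex.Im z + complex.Im w.
Proof. by case: z w => [? ?] [? ?]. Qed.

Lemma cReM z w : complex.Re (z * w) = complex.Re z * complex.Re w - complex.Im z * complex.Im w.
Proof. by case: z w => [? ?] [? ?]. Qed.

Lemma cImM z w : complex.Im (z * w) = complex.Re z * complex.Im w + complex.Im z * complex.Re w.
Proof. by case: z w => [? ?] [? ?]. Qed.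

Lemma cReB z w : complex.Re (z - w) = complex.Re z - complex.Re w.
Proof. by case: z w => [? ?] [? ?]. Qed.

Lemma cImB z w : complex.Im (z - w) = complex.Im z - complex.Im w.
Proof. by case: z w => [? ?] [? ?]. Qed.

Lemma cRe_conjc z : complex.Re (conjc z) = complex.Re z.
Proof. by case: z. Qed.

Lemma cIm_conjc z : complex.Im (conjc z) = - complex.Im z.
Proof. by case: z. Qed.

Lemma cRe_sum (I : Type) (s : seq I) (F : I -> R[i]) :
  complex.Re (\sum_(i <- s) F i) = \sum_(i <- s) complex.Re (F i).
Proof. exact: (big_morph _ cReD). Qed.

Lemma cIm_sum (I : Type) (s : seq I) (F : I -> R[i]) :
  complex.Im (\sum_(i <- s) F i) = \sum_(i <- s) complex.Im (F i).
Proof. exact: (big_morph _ cImD). Qed.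

Lemma sqabsM z w : sqabs (z * w) = sqabs z * sqabs w.
Proof. by rewrite /sqabs cReM cImM; ring. Qed.

Lemma sqabs_ge0 z : 0 <= sqabs z.
Proof. by rewrite /sqabs addr_ge0 ?sqr_ge0. Qed.

Lemma sqabs_cvg0 (u : nat -> R[i]) : (sqabs (u k) : R^o) @[k --> \oo] --> (0 : R^o) ->
  (u k : R[i]^o) @[k --> \oo] --> (0 : R[i]^o).
Proof.
(* A positive element of [R[i]] is real, so its imaginary part [i] is 0. *)
move=> su; apply/cvgr0Pnorm_lt => -[e i] /=; rewrite ltcE /= => /andP[/eqP ie e0].
have /cvgr0Pnorm_lt /(_ _ (exprn_gt0 2 e0)) [N _ hN] := su.
exists N => // k /= /hN; rewrite ger0_norm ?sqabs_ge0//.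
rewrite normc_def ltcE /= -ie eqxx /= => h.
by rewrite -[e]ger0_norm ?(ltW e0)// -sqrtr_sqr ltr_sqrt// exprn_gt0.
Qed.

End complex_real.

(** * Complex functions through real and imaginary parts *)

Section complex_L2.
Context d (T : measurableType d) (R : realType) (mu : {measure set T -> \bar R})
  (D : set T) (mD : measurable D).
Implicit Types (f g : T -> R[i]) (u : nat -> T -> R[i]).
Local Notation re f := (fun x => complex.Re (f x)).
Local Notation im f := (fun x => complex.Im (f x)).
Local Notation l2 := (l2 mu D).
Local Notation ip := (ip mu D).

Lemma sqnormE f : l2 (re f) -> l2 (im f) ->
  sqnorm mu D f = (ip (re f) (re f) + ip (im f) (im f))%:E.
Proof.
move=> lr li; rewrite EFinD -!ip_sqE// /sqnorm /sqabs.
under eq_integral do rewrite EFinD.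
rewrite ge0_integralD//.
- by move=> x _; rewrite lee_fin sqr_ge0.
- by apply: measurable_sqrE; case: lr.
- by move=> x _; rewrite lee_fin sqr_ge0.
- by apply: measurable_sqrE; case: li.
Qed.

Lemma l2_sqnorm f : cmeasurable D f -> (sqnorm mu D f < +oo)%E -> l2 (re f) /\ l2 (im f).
Proof.
move=> [mr mi] fin; have ms : measurable_fun D (fun x => (sqabs (f x))%:E).
  by apply/measurable_EFinP; apply: measurable_funD; exact: measurable_funX.
split; split=> //; apply: le_lt_trans fin.
  apply: (@ge0_le_integral _ T R mu D mD (fun x => (complex.Re (f x) ^+ 2)%:E)) => //.
  - by move=> x _; rewrite lee_fin sqr_ge0.
  - exact: measurable_sqrE.
  - by move=> x _; rewrite lee_fin /sqabs lerDl sqr_ge0.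
apply: (@ge0_le_integral _ T R mu D mD (fun x => (complex.Im (f x) ^+ 2)%:E)) => //.
- by move=> x _; rewrite lee_fin sqr_ge0.
- exact: measurable_sqrE.
- by move=> x _; rewrite lee_fin /sqabs lerDr sqr_ge0.
Qed.

Lemma inL2P f : inL2 mu D f <-> l2 (re f) /\ l2 (im f).
Proof.
split=> [[mf fin]|[lr li]]; first exact: l2_sqnorm.
split; first by split; [case: lr|case: li].
by rewrite sqnormE// ltry.
Qed.

Lemma L2_cvgP u f : (forall k, l2 (re (u k)) /\ l2 (im (u k))) -> l2 (re f) -> l2 (im f) ->
  L2_cvg mu D u f <->
  l2cvg mu D (fun k => re (u k)) (re f) /\ l2cvg mu D (fun k => im (u k)) (im f).
Proof.
move=> lu lr li; rewrite /L2_cvg /l2cvg.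
pose a k := ip (fun x => complex.Re (u k x) - complex.Re (f x))
  (fun x => complex.Re (u k x) - complex.Re (f x)).
pose b k := ip (fun x => complex.Im (u k x) - complex.Im (f x))
  (fun x => complex.Im (u k x) - complex.Im (f x)).
have -> : (fun k => sqnorm mu D (fun x => u k x - f x)) = (fun k => (a k + b k)%:E).
  apply/funext => k; have [lrk lik] := lu k.
  have e1 : re (fun x => u k x - f x) = (fun x => complex.Re (u k x) - complex.Re (f x)).
    by apply/funext => x; rewrite cReB.
  have e2 : im (fun x => u k x - f x) = (fun x => complex.Im (u k x) - complex.Im (f x)).
    by apply/funext => x; rewrite cImB.
  by rewrite sqnormE ?e1 ?e2//; exact: l2B.
have a0 k : 0 <= a k by exact: ip_ge0.
have b0 k : 0 <= b k by exact: ip_ge0.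
rewrite -/a -/b; split=> [/fine_cvgP[_]|[ca cb]].
  rewrite (_ : fine \o _ = fun k => a k + b k)// => c; split.
    by apply: (@squeeze_cvgr _ _ _ _ (fun=> 0) (fun k => a k + b k)) => //;
      [near=> k; rewrite a0 lerDl b0|exact: cvg_cst].
  by apply: (@squeeze_cvgr _ _ _ _ (fun=> 0) (fun k => a k + b k)) => //;
    [near=> k; rewrite b0 lerDr a0|exact: cvg_cst].
apply: cvg_EFin; first by near=> k.
by rewrite (_ : fine \o _ = fun k => a k + b k)// -[0 : R]addr0; exact: cvgD.
Unshelve. all: by end_near. Qed.

Lemma Re_cintegral f : complex.Re (cintegral mu D f) = \int[mu]_(x in D) complex.Re (f x).
Proof. by []. Qed.

Lemma Im_cintegral f : complex.Im (cintegral mu D f) = \int[mu]_(x in D) complex.Im (f x).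
Proof. by []. Qed.

Lemma Re_L2dot f g : l2 (re f) -> l2 (im f) -> l2 (re g) -> l2 (im g) ->
  complex.Re (L2dot mu D f g) = ip (re f) (re g) + ip (im f) (im g).
Proof.
move=> lf lf' lg lg'; rewrite /L2dot Re_cintegral /ip -RintegralD//; try exact: l2_integrable.
apply: eq_Rintegral => x _.
by rewrite cReM cRe_conjc cIm_conjc; ring.
Qed.

Lemma Im_L2dot f g : l2 (re f) -> l2 (im f) -> l2 (re g) -> l2 (im g) ->
  complex.Im (L2dot mu D f g) = ip (im f) (re g) - ip (re f) (im g).
Proof.
move=> lf lf' lg lg'; rewrite /L2dot Im_cintegral -[- ip _ _]mulN1r -ipZl// /ip -RintegralD//;
  try by apply: l2_integrable => //; exact: l2Z.
apply: eq_Rintegral => x _.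
by rewrite cImM cRe_conjc cIm_conjc; ring.
Qed.

(** The real part of a coefficient pairs [f] with [(Re e, Im e)], the imaginary part with
    [(- Im e, Re e)]. Both families are orthonormal among real pairs, so Bessel's inequality applies
    twice, whence the factor 2. *)
Lemma sum_coefficients_le (e : nat -> T -> R[i]) f (s : seq nat) :
  (forall j, l2 (re (e j)) /\ l2 (im (e j))) ->
  (forall j k, L2dot mu D (e j) (e k) = (j == k)%:R) ->
  l2 (re f) -> l2 (im f) -> uniq s ->
  \sum_(j <- s) sqabs (L2dot mu D f (e j)) <=
    2 * (ip (re f) (re f) + ip (im f) (im f)).
Proof.
move=> le oe lr li us.
pose pr (a b : T -> R) (i : 'I_2) := if i == ord0 then a else b.
have vE a b a' b' : vip mu D (pr a b) (pr a' b') = ip a a' + ip b b'.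
  by rewrite /vip !big_ord_recl big_ord0 addr0.
have lpr a b : l2 a -> l2 b -> vl2 mu D (pr a b).
  by move=> la lb i; rewrite /pr; case: ifP.
have oR j k : ip (re (e j)) (re (e k)) + ip (im (e j)) (im (e k)) = (j == k)%:R.
  have [l1 l2'] := le j; have [l3 l4] := le k.
  by rewrite -Re_L2dot// oe; case: eqP.
have sqE j : sqabs (L2dot mu D f (e j)) =
    vip mu D (pr (re f) (im f)) (pr (re (e j)) (im (e j))) ^+ 2 +
    vip mu D (pr (re f) (im f)) (pr (fun x => -1 * complex.Im (e j x)) (re (e j))) ^+ 2.
  have [l1 l2'] := le j; rewrite /sqabs Re_L2dot// Im_L2dot// !vE ipZr//.
  by congr (_ + _ ^+ 2); ring.
rewrite (eq_bigr _ (fun j _ => sqE j)) big_split mulr2n [leRHS](_ : _ =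
  vip mu D (pr (re f) (im f)) (pr (re f) (im f)) +
  vip mu D (pr (re f) (im f)) (pr (re f) (im f))); last by rewrite vE; ring.
apply: lerD.
  apply: (bessel mD (u := fun j => pr (re (e j)) (im (e j)))) => //.
  - by move=> j; have [? ?] := le j; exact: lpr.
  - by move=> j k; rewrite vE oR.
  - exact: lpr.
apply: (bessel mD (u := fun j => pr (fun x => -1 * complex.Im (e j x)) (re (e j)))) => //.
- by move=> j; have [? ?] := le j; apply: lpr => //; exact: l2Z.
- move=> j k; have [? ?] := le j; have [? ?] := le k.
  rewrite vE ipZl// ?ipZr//; last exact: l2Z.
  by rewrite -oR; ring.
- exact: lpr.
Qed.

End complex_L2.

(** * Sums of the noise *)

Section noise_sum.
Context {R : realType} {d : measure_display} {Omega : measurableType d}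
  (P : probability Omega R) (X : nat * nat -> Omega -> R[i]).
Hypothesis X_noise : standard_noise P X.
Local Notation U a := (fun w => complex.Re (X a w)).
Local Notation V a := (fun w => complex.Im (X a w)).
Local Notation l2P := (l2 P setT).
Local Notation ipP := (ip P setT).

Let measurable_UV a : measurable_fun setT (U a) /\ measurable_fun setT (V a).
Proof. by have [/(_ a)[]] := X_noise. Qed.

(** [cexpectation] takes [fine] of an integral, so an infinite second moment would give 0 and not
    1. *)
Lemma noise_l2 a : l2P (U a) /\ l2P (V a).
Proof.
apply: (l2_sqnorm measurableT); first exact: measurable_UV.
have [_ _ /(_ a) v1 _ _] := X_noise.
rewrite ltey; apply/eqP => inf; move: v1 => /(congr1 (@complex.Re R)).
have e : (\int[P]_w (complex.Re (X a w * conjc (X a w)))%:E = sqnorm P setT (X a))%E.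
  apply: eq_integral => w _; congr EFin.
  by rewrite cReM cRe_conjc cIm_conjc /sqabs; ring.
by rewrite Re_cintegral /Rintegral e inf /= => /esym/eqP; rewrite oner_eq0.
Qed.

Lemma noise_mean a : \int[P]_w U a w = 0 /\ \int[P]_w V a w = 0.
Proof.
have [_ /(_ a) m0 _ _ _] := X_noise; split.
  by move: m0 => /(congr1 (@complex.Re R)).
by move: m0 => /(congr1 (@complex.Im R)).
Qed.

Lemma noise_variance a : [/\ ipP (U a) (U a) = 2^-1, ipP (V a) (V a) = 2^-1 & ipP (U a) (V a) = 0].
Proof.
have [lU lV] := noise_l2 a; have [_ _ /(_ a) v1 /(_ a) v0 _] := X_noise.
have h1 : ipP (U a) (U a) + ipP (V a) (V a) = 1.
  by rewrite -(Re_L2dot measurableT lU lV lU lV) [L2dot _ _ _ _]v1.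
have h2 : ipP (U a) (U a) - ipP (V a) (V a) = 0.
  move: v0 => /(congr1 (@complex.Re R)); rewrite Re_cintegral /= => <-.
  rewrite -[- ipP _ _]mulN1r -(ipZl measurableT (-1) lV lV).
  rewrite /ip -RintegralD; [|exact: measurableT|exact: l2_integrable|
    by apply: l2_integrable => //; exact: l2Z].
  by apply: eq_Rintegral => w _; rewrite cReM; ring.
have h3 : ipP (U a) (V a) + ipP (V a) (U a) = 0.
  move: v0 => /(congr1 (@complex.Im R)); rewrite Im_cintegral /= => <-.
  rewrite /ip -RintegralD; [|exact: measurableT|exact: l2_integrable|exact: l2_integrable].
  by apply: eq_Rintegral => w _; rewrite cImM.
by move: h3; rewrite (ipC _ _ (V a)) => h3; split; lra.
Qed.

Lemma noise_pair_independent a b (S1 S2 : set (R * R)) : a != b -> measurable S1 -> measurable S2 ->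
  P ([set w | S1 (U a w, V a w)] `&` [set w | S2 (U b w, V b w)]) =
  (P [set w | S1 (U a w, V a w)] * P [set w | S2 (U b w, V b w)])%E.
Proof.
move=> ab mS1 mS2; have [_ _ _ _ ind] := X_noise.
pose B c := if c == a then S1 else S2.
have mB c : measurable (B c) by rewrite /B; case: ifP.
have := ind (a |` [fset b])%fset B mB; cbv zeta.
rewrite big_fsetU1 ?inE// big_seq_fset1.
have Ba : B a = S1 by rewrite /B eqxx.
have Bb : B b = S2 by rewrite /B eq_sym (negbTE ab).
rewrite Ba Bb => <-; congr (P _); apply/seteqP; split=> w /=.
  move=> [wa wb] c /=; rewrite !inE => /orP[/eqP->|/eqP->]; first by rewrite Ba.
  by rewrite Bb.
move=> h; split; first by have := h a; rewrite /= !inE eqxx Ba; exact.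
by have := h b; rewrite /= !inE eqxx orbT Bb; exact.
Qed.

Lemma noise_uncorrelated a b : a != b ->
  [/\ ipP (U a) (U b) = 0, ipP (U a) (V b) = 0, ipP (V a) (U b) = 0 & ipP (V a) (V b) = 0].
Proof.
move=> ab; have [lUa lVa] := noise_l2 a; have [lUb lVb] := noise_l2 b.
have [mU mV] := noise_mean b.
have ind S1 S2 := noise_pair_independent (S1 := S1) (S2 := S2) ab.
have m1 (A : set R) : measurable A -> measurable (A `*` [set: R]) by move=> mA; exact: measurableX.
have m2 (A : set R) : measurable A -> measurable ([set: R] `*` A) by move=> mA; exact: measurableX.
have e1 c (A : set R) : [set w | (A `*` [set: R]) (U c w, V c w)] = U c @^-1` A.
  by apply/seteqP; split=> w //= [].
have e2 c (A : set R) : [set w | ([set: R] `*` A) (U c w, V c w)] = V c @^-1` A.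
  by apply/seteqP; split=> w //= [].
split; apply: independent_uncorrelated => // A B mA mB.
- by have := ind _ _ (m1 _ mA) (m1 _ mB); rewrite !e1.
- by have := ind _ _ (m1 _ mA) (m2 _ mB); rewrite e1 e2.
- by have := ind _ _ (m2 _ mA) (m1 _ mB); rewrite e1 e2.
- by have := ind _ _ (m2 _ mA) (m2 _ mB); rewrite !e2.
Qed.

Lemma noise_combination (J : seq (nat * nat)) (al be : nat * nat -> R) : uniq J ->
  l2P (fun w => \sum_(a <- J) (al a * U a w + be a * V a w)) /\
  ipP (fun w => \sum_(a <- J) (al a * U a w + be a * V a w))
      (fun w => \sum_(a <- J) (al a * U a w + be a * V a w)) =
  \sum_(a <- J) (al a ^+ 2 + be a ^+ 2) / 2.
Proof.
move=> uJ; pose Y a w := al a * U a w + be a * V a w.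
have lU c a : l2P (fun w => c * U a w) by apply: (l2Z measurableT); case: (noise_l2 a).
have lV c a : l2P (fun w => c * V a w) by apply: (l2Z measurableT); case: (noise_l2 a).
have lY a : l2P (Y a) by exact: (l2D measurableT (lU _ _) (lV _ _)).
have YY a b : ipP (Y a) (Y b) = al a * al b * ipP (U a) (U b) + al a * be b * ipP (U a) (V b) +
    be a * al b * ipP (V a) (U b) + be a * be b * ipP (V a) (V b).
  have [lUa lVa] := noise_l2 a; have [lUb lVb] := noise_l2 b.
  rewrite (ipDl measurableT (lU (al a) a) (lV (be a) a) (lY b)).
  rewrite (ipZl measurableT _ lUa (lY b)) (ipZl measurableT _ lVa (lY b)).
  rewrite (ipDr measurableT (lU (al b) b) (lV (be b) b) lUa).
  rewrite (ipDr measurableT (lU (al b) b) (lV (be b) b) lVa).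
  rewrite (ipZr measurableT _ lUb lUa) (ipZr measurableT _ lVb lUa).
  rewrite (ipZr measurableT _ lUb lVa) (ipZr measurableT _ lVb lVa); ring.
split; first exact: l2_sum.
rewrite (pythagoras measurableT lY _ uJ); last first.
  by move=> a b ab; rewrite YY; have [-> -> -> ->] := noise_uncorrelated ab; rewrite !mulr0 !addr0.
apply: eq_bigr => a _; rewrite YY; have [-> -> UV] := noise_variance a.
by rewrite (ipC _ _ (V a)) UV; field.
Qed.

Lemma sqnorm_noise (J : seq (nat * nat)) (c : nat * nat -> R[i]) : uniq J ->
  [/\ l2P (fun w => complex.Re (\sum_(a <- J) c a * X a w)),
      l2P (fun w => complex.Im (\sum_(a <- J) c a * X a w)) &
      sqnorm P setT (fun w => \sum_(a <- J) c a * X a w) = (\sum_(a <- J) sqabs (c a))%:E].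
Proof.
move=> uJ.
have [l1 i1] := noise_combination (fun a => complex.Re (c a)) (fun a => - complex.Im (c a)) uJ.
have [l2' i2] := noise_combination (fun a => complex.Im (c a)) (fun a => complex.Re (c a)) uJ.
have e1 : (fun w => complex.Re (\sum_(a <- J) c a * X a w)) =
    (fun w => \sum_(a <- J) (complex.Re (c a) * U a w + - complex.Im (c a) * V a w)).
  by apply/funext => w; rewrite cRe_sum; apply: eq_bigr => a _; rewrite cReM mulNr.
have e2 : (fun w => complex.Im (\sum_(a <- J) c a * X a w)) =
    (fun w => \sum_(a <- J) (complex.Im (c a) * U a w + complex.Re (c a) * V a w)).
  by apply/funext => w; rewrite cIm_sum; apply: eq_bigr => a _; rewrite cImM addrC.
split; [by rewrite e1|by rewrite e2|].
rewrite sqnormE ?e1 ?e2// i1 i2 -big_split; congr EFin.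
by apply: eq_bigr => a _; rewrite /sqabs /= sqrrN; field.
Qed.

Lemma L2_sum_bound (c : nat * nat -> R[i]) (B e : R) : 0 <= B -> 0 < e ->
  (forall J : seq (nat * nat), uniq J -> \sum_(a <- J) sqabs (c a) <= B) ->
  cmeasurable setT (L2_sum P c X) /\ (sqnorm P setT (L2_sum P c X) <= (2 * e + 2 * B)%:E)%E.
Proof.
move=> B0 e0 cB; rewrite /L2_sum; case: xgetP => [W _ [LW approx]|_]; last first.
  split; first by split; exact: measurable_cst.
  rewrite /sqnorm; under eq_integral do rewrite /sqabs /= expr0n addr0.
  by rewrite integral0 lee_fin addr_ge0// mulr_ge0// ltW.
split; first by case: LW.
have [J0 /(_ J0 (fsubset_refl _))] := approx e e0.
have [lWr lWi] := (inL2P P measurableT W).1 LW.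
have [lSr lSi SE] := sqnorm_noise c (fset_uniq J0).
set S := fun w => \sum_(a <- J0) c a * X a w in lSr lSi SE *.
have eR : (fun w => complex.Re (W w - S w)) = (fun w => complex.Re (W w) - complex.Re (S w)).
  by apply/funext => w; rewrite cReB.
have eI : (fun w => complex.Im (W w - S w)) = (fun w => complex.Im (W w) - complex.Im (S w)).
  by apply/funext => w; rewrite cImB.
have lDr := l2B measurableT lWr lSr; have lDi := l2B measurableT lWi lSi.
have := cB _ (fset_uniq J0); rewrite -lee_fin -SE.
rewrite -/S !sqnormE ?eR ?eI// lte_fin !lee_fin => h1 h2.
have h3 := ip_sqD_le measurableT lDr lSr; have h4 := ip_sqD_le measurableT lDi lSi.
have k1 : (fun w => complex.Re (W w) - complex.Re (S w) + complex.Re (S w)) = (fun w => complex.Re (W w)).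
  by apply/funext => w; rewrite subrK.
have k2 : (fun w => complex.Im (W w) - complex.Im (S w) + complex.Im (S w)) = (fun w => complex.Im (W w)).
  by apply/funext => w; rewrite subrK.
rewrite k1 in h3; rewrite k2 in h4; move: h1 h2 h3 h4; clear.
move: (ip _ _ _ _) (ip _ _ _ _) (ip _ _ _ _) (ip _ _ _ _) (ip _ _ _ _) (ip _ _ _ _) => *; lra.
Qed.

Lemma L2_sum_cvg0 (c : nat -> nat * nat -> R[i]) (C : R) : 0 <= C ->
  (forall N (J : seq (nat * nat)), uniq J -> \sum_(a <- J) sqabs (c N a) <= C * 2^-1 ^+ N) ->
  {ae P, forall w, (L2_sum P (c N) X w : R[i]^o) @[N --> \oo] --> (0 : R[i]^o)}.
Proof.
move=> C0 cC.
have half0 N : 0 < 2^-1 ^+ N :> R by rewrite exprn_gt0// invr_gt0.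
(* The approximation error is also taken to be [2 ^ - N], so that the bounds stay summable. *)
have bound N := L2_sum_bound (mulr_ge0 C0 (ltW (half0 N))) (half0 N) (cC N).
have C2 : 0 <= 2 + 2 * C by rewrite addr_ge0// mulr_ge0.
have ms N : measurable_fun setT (fun w => sqabs (L2_sum P (c N) X w)).
  by have [[mr mi] _] := bound N; apply: measurable_funD; exact: measurable_funX.
have sC N : (\int[P]_w (sqabs (L2_sum P (c N) X w))%:E <= ((2 + 2 * C) * 2^-1 ^+ N)%:E)%E.
  have [_] := bound N; rewrite /sqnorm => /le_trans; apply; rewrite lee_fin.
  by rewrite le_eqVlt; apply/orP; left; apply/eqP; ring.
have := @summable_ae_cvg0 _ _ _ P (fun N w => sqabs (L2_sum P (c N) X w)) _ C2 ms
  (fun N w => sqabs_ge0 _) sC.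
by apply: filterS => w; exact: sqabs_cvg0.
Qed.

End noise_sum.

(** * The Dirichlet-to-Neumann map *)

Section complex_traces.
Context {R : realType} {n : nat}.
Hypothesis n_ge2 : (2 <= n)%N.
Local Notation E := 'rV[R]_n.
Local Notation leb := (@lebesgue_rV R n).
Local Notation LT := (caratheodory_type (@lebesgue_om R n)).
Local Notation surf := (@hausdorff R n n.-1).
Local Notation HT := (caratheodory_type (@hausdorff_om R n n.-1)).
Local Notation re f := (fun x => complex.Re (f x)).
Local Notation im f := (fun x => complex.Im (f x)).
Local Notation cplx f := (fun x => (f x)%:C).
Variables (D : set E) (M : R).
Hypotheses (oD : open D) (DM : D `<=` cbox (- const_mx M) (const_mx M))
  (Hfin : (@hausdorff_outer R n n.-1 (bdry D) < +oo)%E).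
Local Notation L2D := (@l2 _ LT R leb D).
Local Notation L2S := (@l2 _ HT R surf (bdry D)).
Local Notation ipD := (@ip _ LT R leb D).
Local Notation vipD := (@vip _ LT R leb D n).

Let mD : measurable (D : set LT). Proof. exact: leb_measurable_open. Qed.
Let mB : measurable (bdry D : set HT). Proof. exact: surf_measurable_bdry. Qed.

Lemma has_trace_re_im (u : E -> R[i]) (G : 'I_n -> E -> R[i]) (f : E -> R[i]) :
  has_trace D u G f ->
  rtrace D (re u) (fun i => re (G i)) (re f) /\ rtrace D (im u) (fun i => im (G i)) (im f).
Proof.
move=> [[lu lG _] lf [w [sw cu cG cf]]].
have [lur lui] := (inL2P leb mD u).1 lu.
have lGi i := (inL2P leb mD (G i)).1 (lG i).
have [lfr lfi] := (inL2P surf mB f).1 lf.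
have lw k : L2D (re (w k)) /\ L2D (im (w k)).
  have [s1 s2] := sw k.
  have c1 := smooth_continuous s1; have c2 := smooth_continuous s2.
  by split; apply: (l2D_continuous oD DM); [exact: c1|exact: c2].
have lpw i k : L2D (re (cpartial i (w k))) /\ L2D (im (cpartial i (w k))).
  by have [s1 s2] := sw k; split; apply: (l2D_continuous oD DM); apply: smooth_continuous;
    exact: smooth_partial.
have lws k : L2S (re (w k)) /\ L2S (im (w k)).
  have [s1 s2] := sw k.
  have c1 := smooth_continuous s1; have c2 := smooth_continuous s2.
  by split; apply: (l2S_continuous DM Hfin); [exact: c1|exact: c2].
have [cur cui] := (L2_cvgP mD lw lur lui).1 cu.
have cGi i := (L2_cvgP mD (lpw i) (lGi i).1 (lGi i).2).1 (cG i).
have [cfr cfi] := (L2_cvgP mB lws lfr lfi).1 cf.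
split; split.
- exact: lur.
- by move=> i; case: (lGi i).
- exact: lfr.
- exists (fun k => re (w k)); split; [by move=> k; case: (sw k)|exact: cur| |exact: cfr].
  by move=> i; case: (cGi i).
- exact: lui.
- by move=> i; case: (lGi i).
- exact: lfi.
- exists (fun k => im (w k)); split; [by move=> k; case: (sw k)|exact: cui| |exact: cfi].
  by move=> i; case: (cGi i).
Qed.

Lemma bdry_disjoint x : bdry D x -> ~ D x.
Proof. by move=> [_ ix] Dx; apply: ix; move: oD; rewrite openE => /(_ x Dx). Qed.

Lemma has_trace_real (u : E -> R) (G : 'I_n -> E -> R) (f : E -> R) :
  rtrace D u G f -> has_trace D (cplx u) (fun i => cplx (G i)) (cplx f).
Proof.
move=> tr; have [lu lG lf [w [sw cu cG cf]]] := tr.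
have l0D : L2D (fun=> 0) by exact: l2_0.
have l0S : L2S (fun=> 0) by exact: l2_0.
have lw k : L2D (w k) by apply: (l2D_continuous oD DM); exact: smooth_continuous.
have lpw i k : L2D (partial i (w k)).
  by apply: (l2D_continuous oD DM); apply: smooth_continuous; exact: smooth_partial.
have lws k : L2S (w k) by apply: (l2S_continuous DM Hfin); exact: smooth_continuous.
have p0 i : partial i (fun=> 0 : R) = (fun=> 0) :> (E -> R).
  by apply/funext => x; apply: is_derive_partial; exact: is_derive_cst.
have cint (a b : E -> R) : cintegral leb D (fun x => (a x)%:C * (b x)%:C) = (ipD a b)%:C.
  apply/eqP; rewrite eq_complex; apply/andP; split; apply/eqP.
    by rewrite Re_cintegral; apply: eq_Rintegral => x _; rewrite cReM /= mulr0 subr0.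
  rewrite Im_cintegral [RHS]/= -[RHS](ip0l leb D (fun=> 0)).
  by apply: eq_Rintegral => x _; rewrite cImM /= !mulr0 mul0r addr0.
split.
- split.
  + by apply/(inL2P leb mD); split; [exact: lu|exact: l0D].
  + by move=> i; apply/(inL2P leb mD); split; [exact: lG|exact: l0D].
  + move=> h [sh [K [_ KD hK]]] i; rewrite !cint.
    have hb x : bdry D x -> h x = 0.
      by move=> Bx; apply: hK => /KD; exact: bdry_disjoint.
    by rewrite (weak_derivative n_ge2 oD DM Hfin i tr sh hb) rmorphN.
- by apply/(inL2P surf mB); split; [exact: lf|exact: l0S].
exists (fun k => cplx (w k)); split.
- by move=> k; split; [exact: sw|exact: smooth_cst].
- by apply/(@L2_cvgP _ LT R leb D mD (fun k => cplx (w k)) (cplx u) (fun k => Logic.conj (lw k) l0D) lu l0D); split; [exact: cu|exact: l2cvg_cst].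
- move=> i; rewrite (_ : (fun k => cpartial i (cplx (w k))) = (fun k => cplx (partial i (w k)))).
    apply/(@L2_cvgP _ LT R leb D mD (fun k => cplx (partial i (w k))) (cplx (G i))
      (fun k => Logic.conj (lpw i k) l0D) (lG i) l0D).
    by split; [exact: cG|exact: l2cvg_cst].
  by apply/funext => k; apply/funext => x; rewrite /cpartial /= (p0 i).
- by apply/(@L2_cvgP _ HT R surf (bdry D) mB (fun k => cplx (w k)) (cplx f)
    (fun k => Logic.conj (lws k) l0S) lf l0S); split; [exact: cf|exact: l2cvg_cst].
Qed.

Section conductivity.
Variables (gamma : E -> R) (g0 g1 : R).
Hypotheses (mg : measurable_fun (D : set LT) (gamma : LT -> R)) (g0_gt0 : 0 < g0)
  (g0_le : forall x, D x -> g0 <= gamma x) (g1_ge : forall x, D x -> gamma x <= g1).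
Local Notation wt := (fun (G : 'I_n -> E -> R) i x => gamma x * G i x).

Lemma energy_re_im (G H : 'I_n -> E -> R[i]) :
  (forall i, L2D (re (G i)) /\ L2D (im (G i))) -> (forall i, L2D (re (H i)) /\ L2D (im (H i))) ->
  energy D gamma G H =
    (vipD (wt (fun i => re (G i))) (fun i => re (H i)) -
     vipD (wt (fun i => im (G i))) (fun i => im (H i))) +i*
    (vipD (wt (fun i => re (G i))) (fun i => im (H i)) +
     vipD (wt (fun i => im (G i))) (fun i => re (H i))).
Proof.
move=> lG lH.
have lwr : vl2 leb D (wt (fun i => re (G i)) : 'I_n -> LT -> R).
  by apply: (vl2_weight mD mg g0_gt0 g0_le g1_ge) => i; case: (lG i).
have lwi : vl2 leb D (wt (fun i => im (G i)) : 'I_n -> LT -> R).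
  by apply: (vl2_weight mD mg g0_gt0 g0_le g1_ge) => i; case: (lG i).
have vE (A B : 'I_n -> LT -> R) : vl2 leb D A -> vl2 leb D B ->
    leb.-integrable D (EFin \o (fun x => \sum_(i < n) A i x * B i x)) /\
    \int[leb]_(x in D) (\sum_(i < n) A i x * B i x) = vipD A B.
  move=> lA lB; pose S (s : seq 'I_n) : LT -> R := fun x => \sum_(i <- s) A i x * B i x.
  suff : leb.-integrable D (EFin \o S (index_enum _)) /\
    \int[leb]_(x in D) S (index_enum _) x = \sum_(i <- index_enum _) ipD (A i) (B i) by [].
  elim: (index_enum _) => [|i s [IH1 IH2]].
    have e : S [::] = fun x => 0 * 0 by apply/funext => x; rewrite /S big_nil mulr0.
    have z : l2 leb D ((fun=> 0) : LT -> R) by exact: l2_0.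
    rewrite e big_nil; split; first exact: (l2_integrable mD z z).
    exact: ip0l.
  have e : S (i :: s) = fun x => A i x * B i x + S s x by apply/funext => x; rewrite /S big_cons.
  have iA := l2_integrable mD (lA i) (lB i).
  rewrite e big_cons; split; first exact: (integrableD mD iA IH1).
  by rewrite (RintegralD mD iA IH1) IH2.
have lrH : vl2 leb D ((fun i => re (H i)) : 'I_n -> LT -> R) by move=> i; case: (lH i).
have liH : vl2 leb D ((fun i => im (H i)) : 'I_n -> LT -> R) by move=> i; case: (lH i).
have liH' := vl2Z mD (-1) liH.
have [i1 e1] := vE _ _ lwr lrH; have [i2 e2] := vE _ _ lwi liH'.
have [i3 e3] := vE _ _ lwr liH; have [i4 e4] := vE _ _ lwi lrH.
apply/eqP; rewrite eq_complex /=; apply/andP; split; apply/eqP.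
  rewrite -mulN1r [in X in _ + X]vipC -(vipZl mD (-1) liH lwi) [in X in _ + X]vipC -e1 -e2.
  rewrite -(RintegralD mD i1 i2); apply: eq_Rintegral => x _.
  rewrite -big_split -[LHS]/(complex.Re ((gamma x)%:C * \sum_(i < n) G i x * H i x)) cReM /= mul0r subr0.
  by rewrite cRe_sum mulr_sumr; apply: eq_bigr => i _; rewrite cReM; ring.
rewrite -e3 -e4 -(RintegralD mD i3 i4); apply: eq_Rintegral => x _.
rewrite -big_split -[LHS]/(complex.Im ((gamma x)%:C * \sum_(i < n) G i x * H i x)) cImM /= mul0r addr0.
by rewrite cIm_sum mulr_sumr; apply: eq_bigr => i _; rewrite cImM; ring.
Qed.

(** [xget] selects unknown functions [u] and [v], so the energy must be shown independent of the
    choice: fields with the same trace differ by one of zero trace, to which solutions are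
    orthogonal. The given real solution shows that the default value is not taken. *)
Lemma DN_map_real (u0 f : E -> R) (G0 : 'I_n -> E -> R) : rtrace D u0 G0 f ->
  (forall v H, rtrace D v H (fun=> 0) -> vipD (wt G0) H = 0) ->
  DN_map D gamma (cplx f) (cplx f) = (vipD (wt G0) G0)%:C.
Proof.
move=> tr0 EL.
have lr u G h : rtrace D u G h -> vl2 leb D (G : 'I_n -> LT -> R) by case.
have l0 : vl2 leb D ((fun i => fun=> 0) : 'I_n -> LT -> R) by move=> i; exact: l2_0.
have lw G : vl2 leb D (G : 'I_n -> LT -> R) -> vl2 leb D (wt G : 'I_n -> LT -> R).
  by move=> lG; exact: (vl2_weight mD mg g0_gt0 g0_le g1_ge lG).
have v0 G : vipD G (fun i => fun=> 0) = 0.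
  by rewrite /vip big1// => i _; rewrite ipC ip0l.
have w0 G : vipD (wt (fun i => fun=> 0)) G = 0 by rewrite vip_weightC v0.
(* Against a solution [H], the gradient of any extension of [f] can be replaced by [G0]. *)
have comb u G H : [/\ rtrace D u G f, vl2 leb D (G : 'I_n -> LT -> R) & vl2 leb D (H : 'I_n -> LT -> R)] ->
    (forall v K, rtrace D v K (fun=> 0) -> vipD (wt H) K = 0) -> vipD (wt H) G = vipD (wt H) G0.
  move=> [tr lG lH] ort; have := rtrace_lin oD DM Hfin 1 (-1) tr tr0.
  rewrite (_ : (fun x => 1 * f x + -1 * f x) = fun=> 0); last by apply/funext => x; ring.
  rewrite (_ : (fun i x => 1 * G i x + -1 * G0 i x) = (fun i x => G i x - G0 i x)); last first.
    by apply/funext => i; apply/funext => x; ring.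
  move=> /ort; rewrite vipC (vipBl mD lG (lr _ _ _ tr0) (lw _ lH)) => /eqP.
  by rewrite subr_eq0 vipC => /eqP->; exact: vipC.
rewrite /DN_map; case: xgetP => [z _ [u [G [v [H [[tu sol] tv ->]]]]]|none]; last first.
  exfalso; have hsol : dirichlet_solution D gamma (cplx f) (cplx u0) (fun i => cplx (G0 i)).
    split; first exact: has_trace_real.
    move=> v H tv; have [tr ti] := has_trace_re_im tv.
    rewrite energy_re_im; first last.
    - by move=> i; split; [exact: (lr _ _ _ tr i)|exact: (lr _ _ _ ti i)].
    - by move=> i; split; [exact: (lr _ _ _ tr0 i)|exact: l0].
    by rewrite !w0 (EL _ _ tr) (EL _ _ ti) subr0 addr0.
  apply: (none (energy D gamma (fun i => cplx (G0 i)) (fun i => cplx (G0 i)))).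
  exists (cplx u0), (fun i => cplx (G0 i)), (cplx u0), (fun i => cplx (G0 i)).
  by split; [exact: hsol|exact: has_trace_real tr0|].
have [trur trui] := has_trace_re_im tu; have [trvr trvi] := has_trace_re_im tv.
have lGr := lr _ _ _ trur; have lGi := lr _ _ _ trui.
have lHr := lr _ _ _ trvr; have lHi := lr _ _ _ trvi.
have solr w K : rtrace D w K (fun=> 0) -> vipD (wt (fun i => re (G i))) K = 0 /\
    vipD (wt (fun i => im (G i))) K = 0.
  move=> trK; have lK := lr _ _ _ trK.
  have := sol _ _ (has_trace_real trK); rewrite energy_re_im; first last.
  - by move=> i; split; [exact: lK|exact: l0].
  - by move=> i; split; [exact: lGr|exact: lGi].
  rewrite !v0 subr0 add0r => /eqP; rewrite eq_complex /= => /andP[/eqP-> /eqP->].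
  by [].
rewrite energy_re_im; first last.
- by move=> i; split; [exact: lHr|exact: lHi].
- by move=> i; split; [exact: lGr|exact: lGi].
(* The imaginary parts of [u] and [v] have zero trace because the boundary data are real. *)
have [z1 z2] := solr _ _ trvi; rewrite z1 z2 subr0 add0r.
have e1 := comb _ _ _ (And3 trvr lHr lGr) (fun v K t => (solr v K t).1).
have e2 := comb _ _ _ (And3 trvr lHr lGi) (fun v K t => (solr v K t).2).
have e3 := comb _ _ _ (And3 trur lGr (lr _ _ _ tr0)) EL.
rewrite e1 e2 vip_weightC e3 [X in _ +i* X]vip_weightC (EL _ _ trui).
by [].
Qed.

End conductivity.
End complex_traces.

Lemma lipschitz_measurable {R : realType} {n : nat} (D : set 'rV[R]_n) (gamma : 'rV[R]_n -> R) (L : R) :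
  open D -> (forall x y, D x -> D y -> `|gamma x - gamma y| <= L * enorm (x - y)) ->
  measurable_fun (D : set (caratheodory_type (@lebesgue_om R n)))
    (gamma : caratheodory_type (@lebesgue_om R n) -> R).
Proof.
move=> oD gL; apply: (measurability _ (RGenOInfty.measurableE R)).
move=> _ [_ [a ->] <-]; apply: leb_measurable_open.
rewrite openE => x [Dx /=]; rewrite in_itv/= andbT => ax.
have L1 : 0 < `|L| + 1 by rewrite ltr_wpDl.
have q0 : 0 < (gamma x - a) / (`|L| + 1) by rewrite divr_gt0 ?subr_gt0.
have nD : nbhs x D by move: oD; rewrite openE; exact.
apply: filterS2 nD (enorm_nbhs x q0) => y Dy /= yx; split=> //=; rewrite in_itv/= andbT.
move: yx; rewrite ltr_pdivlMr// => yx.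
have := gL x y Dx Dy; rewrite (enormB x y) => h.
have : gamma x - gamma y < gamma x - a.
  apply: le_lt_trans (ler_norm _) _; apply: le_lt_trans h _; apply: le_lt_trans yx.
  rewrite mulrC; apply: ler_wpM2l; first exact: enorm_ge0.
  by apply: le_trans (ler_norm _) _; rewrite lerDl.
by rewrite ltrBlDr; lra.
Qed.

Lemma lipschitz_bounded {R : realType} {n : nat} (D : set 'rV[R]_n) (gamma : 'rV[R]_n -> R) (L M : R) :
  0 < M -> D `<=` cbox (- const_mx M) (const_mx M) ->
  (forall x y, D x -> D y -> `|gamma x - gamma y| <= L * enorm (x - y)) ->
  exists g1, forall x, D x -> gamma x <= g1.
Proof.
move=> M0 DM gL; have [[x0 Dx0]|D0] := pselect (D !=set0); last first.
  by exists 0 => x Dx; exfalso; apply: D0; exists x.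
exists (gamma x0 + `|L| * (n%:R * (2 * M))) => x Dx.
rewrite -lerBlDl; apply: le_trans (ler_norm _) _; apply: le_trans (gL _ _ Dx Dx0) _.
apply: le_trans (ler_wpM2r (enorm_ge0 _) (ler_norm L)) _.
apply: ler_wpM2l => //; apply: enorm_le_coord; first by rewrite mulr_ge0// ltW.
move=> i; have := DM _ Dx i; have := DM _ Dx0 i; rewrite !mxE => /andP[? ?] /andP[? ?].
by rewrite ler_norml; apply/andP; split; lra.
Qed.

(** * Limit of the energies *)

Section energy_limit.
Context {R : realType} {n : nat}.
Hypothesis n_ge2 : (2 <= n)%N.
Local Notation E := 'rV[R]_n.
Local Notation leb := (@lebesgue_rV R n).
Local Notation LT := (caratheodory_type (@lebesgue_om R n)).
Local Notation vipD D := (@vip _ LT R leb D n).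
Variables (D : set E) (M : R) (p : E) (gamma : E -> R) (g0 g1 L : R) (f : nat -> E -> R).
Hypotheses (oD : open D) (DM : D `<=` cbox (- const_mx M) (const_mx M))
  (Hfin : (@hausdorff_outer R n n.-1 (bdry D) < +oo)%E)
  (mg : measurable_fun (D : set LT) (gamma : LT -> R)) (g0_gt0 : 0 < g0)
  (g0_le : forall x, D x -> g0 <= gamma x) (g1_ge : forall x, D x -> gamma x <= g1)
  (gL : forall x, D x -> `|gamma x - gamma p| <= L * enorm (x - p))
  (sf : forall k, smooth (f k))
  (hf : forall k x, D x -> \sum_(i < n) partial i (partial i (f k)) x = 0)
  (f1 : forall k, vipD D (fun i => partial i (f k)) (fun i => partial i (f k)) = 1)
  (mf : forall e : R, 0 < e -> exists N, forall k, (N <= k)%N ->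
        vipD D (fun i x => enorm (x - p) * partial i (f k) x)
          (fun i x => enorm (x - p) * partial i (f k) x) <= e).
Local Notation wt := (fun (G : 'I_n -> E -> R) i x => gamma x * G i x).

Let mD : measurable (D : set LT). Proof. exact: leb_measurable_open. Qed.

Let lgrad k : vl2 leb D ((fun i => partial i (f k)) : 'I_n -> LT -> R).
Proof. by move=> i; exact: (l2D_continuous oD DM (smooth_continuous (smooth_partial i (sf k)))). Qed.

Lemma harmonic_orthogonal k (v : E -> R) (H : 'I_n -> E -> R) : rtrace D v H (fun=> 0) ->
  vipD D (fun i => partial i (f k)) H = 0.
Proof.
move=> tv; have [lv lH _ _] := tv.
transitivity (\sum_(i < n) - (@ip _ LT R leb D (partial i (partial i (f k))) v)).
  apply: eq_bigr => i _; rewrite ipC (green_zero_trace n_ge2 oD DM Hfin i tv (smooth_partial i (sf k))).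
  by rewrite ipC.
rewrite sumrN -(ip_suml mD) //; last first.
  by move=> i; exact: (l2D_continuous oD DM (smooth_continuous (smooth_partial i (smooth_partial i (sf k))))).
rewrite (_ : ip _ _ _ _ = 0) ?oppr0// -[RHS](ip0l leb D v).
by apply: eq_ip => [x Dx|//]; exact: (@hf k x Dx).
Qed.

Lemma energy_limit (u : nat -> E -> R) (G : nat -> 'I_n -> E -> R) :
  (forall k, rtrace D (u k) (G k) (f k)) ->
  (forall k v H, rtrace D v H (fun=> 0) -> vipD D (wt (G k)) H = 0) ->
  (vipD D (wt (G k)) (G k) : R^o) @[k --> \oo] --> (gamma p : R^o).
Proof.
move=> tr EL; apply/cvgrPdist_le => e e0.
(* Chosen so that [t + t ^ 2 / g0 <= e]: [t <= 1] gives [t ^ 2 <= t <= e * g0 / 2]. *)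
pose t := Num.min (e / 2) (Num.min 1 (e * g0 / 2)).
have t0 : 0 < t.
  rewrite /t !lt_min ltr01 divr_gt0//=; apply: divr_gt0 => //; exact: mulr_gt0.
have L1 : 0 < L ^+ 2 + 1 by rewrite ltr_wpDl// sqr_ge0.
have [N hN] := mf (divr_gt0 (exprn_gt0 2 t0) L1).
exists N => // k /= /hN hk; rewrite distrC.
have lG : vl2 leb D (G k : 'I_n -> LT -> R) by case: (tr k).
have t0D : rtrace D (fun x => 1 * u k x + -1 * f k x)
    (fun i x => G k i x - partial i (f k) x) (fun=> 0).
  have := rtrace_lin oD DM Hfin 1 (-1) (tr k) (rtrace_smooth oD DM Hfin (sf k)).
  by congr (rtrace D _ _ _); apply/funext => x; [apply/funext => y|]; ring.
have te : t + t ^+ 2 / g0 <= e.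
  have t1 : t <= e / 2 by rewrite ge_min lexx.
  have t2 : t <= 1 by rewrite /t !ge_min lexx /= orbT.
  have t3 : t <= e * g0 / 2 by rewrite /t !ge_min lexx !orbT.
  have : t ^+ 2 / g0 <= e / 2.
    rewrite ler_pdivrMr// expr2; apply: (@le_trans _ _ (t * 1)); first by rewrite ler_pM2l.
    by rewrite mulr1 mulrAC.
  lra.
apply: le_trans te.
apply: (energy_concentration mD mg g0_gt0 g0_le g1_ge lG (lgrad k) (ltW t0) (f1 k)).
- exact: harmonic_orthogonal t0D.
- exact: EL t0D.
have lm : vl2 leb D ((fun i x => enorm (x - p) * partial i (f k) x) : 'I_n -> LT -> R).
  move=> i; apply: (l2D_continuous oD DM) => x.
  have ce := @continuous_enormB R n p; have cg := smooth_continuous (smooth_partial i (sf k)).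
  exact: (continuousM (ce x) (cg x)).
have lw : vl2 leb D ((fun i x => (gamma x - gamma p) * partial i (f k) x) : 'I_n -> LT -> R).
  have h1 := vl2_weight mD mg g0_gt0 g0_le g1_ge (lgrad k).
  have := vl2B mD h1 (vl2Z mD (gamma p) (lgrad k)).
  by congr (vl2 _ _ _); apply/funext => i; apply/funext => x; rewrite mulrBl.
apply: (@le_trans _ _ (`|L| ^+ 2 * vipD D (fun i x => enorm (x - p) * partial i (f k) x)
          (fun i x => enorm (x - p) * partial i (f k) x))).
  rewrite /vip mulr_sumr; apply: ler_sum => i _.
  apply: (ip_le mD (normr_ge0 L) (lw i) (lm i)) => x Dx.
  rewrite !normrM (ger0_norm (enorm_ge0 _)) mulrA; apply: ler_wpM2r => //.
  apply: le_trans (gL Dx) _; apply: ler_wpM2r; [exact: enorm_ge0|exact: ler_norm].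
rewrite (real_normK (num_real L)).
apply: le_trans (ler_wpM2l (sqr_ge0 L) hk) _.
rewrite mulrA ler_pdivrMr// mulrC; apply: ler_wpM2l; first exact: sqr_ge0.
by rewrite lerDl.
Qed.

End energy_limit.

Theorem theorem1 (R : realType) (n : nat) (n_ge2 : (2 <= n)%N)
    (D : set 'rV[R]_n) (D_lip : bounded_lipschitz_domain D) :
  exists F : 'rV[R]_n -> nat -> 'rV[R]_n -> R[i],
  forall (gamma : 'rV[R]_n -> R) (gamma_lip : lipschitz_conductivity D gamma)
    (dO : measure_display) (Omega : measurableType dO)
    (P : probability Omega R) (P_complete : measure_is_complete P)
    (X : nat * nat -> Omega -> R[i]) (X_noise : standard_noise P X)
    (e : nat -> 'rV[R]_n -> R[i])
    (e_basis : orthonormal_basis (@hausdorff R n n.-1) (bdry D) e),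
  {ae @hausdorff R n n.-1, forall p, bdry D p ->
    (forall N, (0 < N)%N -> inHhalf D (F p N)) /\
    {ae P, forall w,
      (noisy_data P D gamma e X (F p N) (fun x => conjc (F p N x)) w : R[i]^o)
        @[N --> \oo] --> ((gamma p)%:C : R[i]^o)}}.
Proof.
case: n n_ge2 D D_lip => [//|n'] n_ge2 D D_lip.
have n'0 : (0 < n')%N by [].
have [oD _ _ bD lip] := D_lip.
have Hfin := hausdorff_bdry_lty D_lip.
have [M [M0 DM]] := bounded_cbox bD.
have /choice[f hf] : forall p, exists f : nat -> 'rV[R]_n'.+1 -> R, bdry D p ->
  [/\ forall k, smooth (f k),
      forall k x, D x -> \sum_(i < n'.+1) partial i (partial i (f k)) x = 0,
      forall k, vleb D
        (fun i => partial i (f k)) (fun i => partial i (f k)) = 1,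
      forall e : R, 0 < e -> exists N, forall k, (N <= k)%N ->
        vleb D
          (fun i x => enorm (x - p) * partial i (f k) x)
          (fun i x => enorm (x - p) * partial i (f k) x) <= e &
      exists C : R, 0 <= C /\ forall k,
        ipsurf R n' D
          (f k) (f k) <= C * 2^-1 ^+ k].
  move=> p; have [Bp|nBp] := pselect (bdry D p); last by exists (fun _ _ => 0).
  by have [f hf] := concentrating_sequence n'0 D_lip Bp; exists f.
exists (fun p N x => (f p N x)%:C) => gamma [[L gL] [g0 [g0_gt0 g0_le]]] dO Omega P _ X X_noise e [le oe _].
have subD : D `<=` closure D by exact: subset_closure.
have gLD x y : D x -> D y -> `|gamma x - gamma y| <= L * enorm (x - y).
  by move=> /subD Dx /subD Dy; exact: gL.
have mg := lipschitz_measurable oD gLD.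
have [g1 g1_ge] := lipschitz_bounded M0 DM gLD.
have g0_leD x : D x -> g0 <= gamma x by move=> /subD; exact: g0_le.
apply: aeW => p Bp; have [sf harm f1 mom [C [C0 fC]]] := hf p Bp.
have trs N := rtrace_smooth oD DM Hfin (sf N).
split=> [N _|].
  by exists (fun x => (f p N x)%:C), (fun i x => (partial i (f p N) x)%:C);
    exact: (has_trace_real n_ge2 oD DM Hfin (trs N)).
have /choice[uG hG] : forall N, exists uG : ('rV[R]_n'.+1 -> R) * ('I_n'.+1 -> 'rV[R]_n'.+1 -> R),
    rtrace D uG.1 uG.2 (f p N) /\ forall v H, rtrace D v H (fun=> 0) ->
      vleb D
        (fun i x => gamma x * uG.2 i x) H = 0.
  move=> N; have [u [G [tr EL]]] := weak_solution n_ge2 oD DM Hfin mg g0_gt0 g0_leD g1_ge (trs N).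
  by exists (u, G).
have gp x : D x -> `|gamma x - gamma p| <= L * enorm (x - p).
  by move=> /subD Dx; apply: gL => //; case: Bp.
have lim := energy_limit n_ge2 oD DM Hfin mg g0_gt0 g0_leD g1_ge gp sf harm f1 mom
  (fun N => (hG N).1) (fun N => (hG N).2).
pose En N := vleb D
        (fun i x => gamma x * (uG N).2 i x) (uG N).2.
have DN N : DN_map D gamma (fun x => (f p N x)%:C) (fun x => (f p N x)%:C) = (En N)%:C.
  exact: (DN_map_real n_ge2 oD DM Hfin mg g0_gt0 g0_leD g1_ge (hG N).1 (hG N).2).
have cF N : (fun x => conjc (f p N x)%:C) = (fun x => (f p N x)%:C).
  by apply/funext => x; rewrite /= oppr0.
pose c N (a : nat * nat) := L2dot (@hausdorff R n'.+1 n') (bdry D) (fun x => (f p N x)%:C) (e a.1) *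
  L2dot (@hausdorff R n'.+1 n') (bdry D) (fun x => (f p N x)%:C) (e a.2).
have mB := surf_measurable_bdry D.
have C4 : 0 <= 4 * C ^+ 2 by apply: mulr_ge0 => //; exact: sqr_ge0.
(* The coefficients are products, so a finite set of indices is enlarged to the product of its
   projections [s1] and [s2] and the sum factors. Each factor is at most [2 * C * 2 ^ - N], and one
   of the two powers of [2 ^ - N] is kept. *)
have cC N (J : seq (nat * nat)) : uniq J -> \sum_(a <- J) sqabs (c N a) <= 4 * C ^+ 2 * 2^-1 ^+ N.
  move=> uJ; pose s1 := undup [seq a.1 | a <- J]; pose s2 := undup [seq a.2 | a <- J].
  pose A j := sqabs (L2dot (@hausdorff R n'.+1 n') (bdry D) (fun x => (f p N x)%:C) (e j)).
  have A0 j : 0 <= A j by exact: sqabs_ge0.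
  have h0 : 0 <= 2^-1 ^+ N :> R by rewrite exprn_ge0// invr_ge0.
  have AB s : uniq s -> \sum_(j <- s) A j <= 2 * (C * 2^-1 ^+ N).
    move=> us; have l0S : l2 (@hausdorff R n'.+1 n') (bdry D)
        ((fun=> 0) : caratheodory_type (@hausdorff_om R n'.+1 n') -> R) by exact: l2_0.
    have lf := l2S_continuous DM Hfin (smooth_continuous (sf N)).
    have := @sum_coefficients_le _ _ _ (@hausdorff R n'.+1 n') (bdry D) mB e
      (fun x => (f p N x)%:C) s (fun j => (inL2P _ mB (e j)).1 (le j)) oe lf l0S us.
    move/le_trans; apply; apply: ler_wpM2l => //.
    by rewrite ip0l addr0; exact: fC.
  apply: (@le_trans _ _ (\sum_(a <- [seq (j, k) | j <- s1, k <- s2]) A a.1 * A a.2)).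
    rewrite (eq_bigr (fun a => A a.1 * A a.2)); last by move=> a _; rewrite /c sqabsM.
    apply: sub_sum_le => [a||a aJ]; [exact: mulr_ge0|exact: uJ|].
    by apply/allpairsP; exists a; split; rewrite ?mem_undup ?map_f//; case: a {aJ}.
  rewrite big_allpairs_dep /=.
  under eq_bigr do rewrite -mulr_sumr.
  rewrite -mulr_suml.
  apply: le_trans (ler_pM _ _ (AB s1 (undup_uniq _)) (AB s2 (undup_uniq _))) _.
  - by apply: sumr_ge0 => j _.
  - by apply: sumr_ge0 => j _.
  rewrite (_ : 2 * (C * 2^-1 ^+ N) * (2 * (C * 2^-1 ^+ N)) = 4 * C ^+ 2 * 2^-1 ^+ N * 2^-1 ^+ N); last by ring.
  apply: ler_piMr; first exact: mulr_ge0.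
  by rewrite exprn_ile1// invf_le1// ler1n.
have := L2_sum_cvg0 X_noise C4 cC; apply: filterS => w Sw.
(* Energy defect plus noise plus the constant limit; the first two terms tend to 0. *)
have -> : (fun N => noisy_data P D gamma e X (fun x => (f p N x)%:C)
    (fun x => conjc (f p N x)%:C) w) =
  (fun N => (En N - gamma p)%:C + L2_sum P (c N) X w + (gamma p)%:C).
  apply/funext => N; rewrite /noisy_data cF DN rmorphB /c.
  by rewrite addrAC subrK.
rewrite -[X in _ --> X]add0r -[X in _ --> X + _]addr0.
apply: cvgD; last exact: cvg_cst.
apply: cvgD; last exact: Sw.
apply: sqabs_cvg0; rewrite (_ : (fun k => _) = (fun k => (En k - gamma p) * (En k - gamma p))); last first.
  by apply/funext => k; rewrite /sqabs /= expr0n addr0 expr2.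
have h : (En k - gamma p : R^o) @[k --> \oo] --> (0 : R^o) by apply/subr_cvg0; exact: lim.
by rewrite -(mulr0 (0 : R)); exact: (cvgM h h).
Qed.
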